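(* Let $(G,K)$ be a Gelfand pair with $L^2(G//K)$ separable, and let $\alpha$ be a topological automorphism of $G$. Let $\theta\in L^2(G//K)$ be such that $\|\theta\|_{L^2(G//K)}=1$. If $u\in L^1(G\times\mathcal{S}^+)\cap L^2(G\times\mathcal{S}^+)$, then the localization operator $\mathcal{L}_{\theta,\alpha}^{u}:L^2(G//K)\to L^2(G//K)$ belongs to the Schatten-von Neumann class $S_2(L^2(G//K))$ and $$\|\mathcal{L}_{\theta,\alpha}^{u}\|_{S_2(L^2(G//K))}\leq\|u\|_{L^1(G\times\mathcal{S}^+)}.$$
   Context: $G$ is a locally compact Hausdorff group with left Haar measure $dx$, and $K$ is a compact subgroup. A function $f$ on $G$ is $K$-bi-invariant if $f(kxk')=f(x)$ for all $x\in G$, $k,k'\in K$. $\mathcal{C}_c(G//K)$ is the space of continuous compactly supported $K$-bi-invariant complex functions, and $L^p(G//K)$ is the space of $K$-bi-invariant elements of $L^p(G)$, with the norm of $L^p(G)$; the inner product $\langle f,g\rangle_{L^2(G//K)}$ means $\int_G f\overline{g}\,dx$. $(G,K)$ is a Gelfand pair if $\mathcal{C}_c(G//K)$ is commutative under convolution $(f\ast g)(x)=\int_G f(y)g(y^{-1}x)dy$ (then $G$ is unimodular). A spherical function is a continuous $K$-bi-invariant function $\varphi$ on $G$ such that $f\mapsto\int_G f(x)\varphi(x)dx$ is a nontrivial character of the convolution algebra $\mathcal{C}_c(G//K)$. $\mathcal{S}_b(G,K)$ is the set of bounded spherical functions, and $\mathcal{S}^+\subset\mathcal{S}_b(G,K)$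 is the set of positive-definite spherical functions. The spherical Fourier transform of $f\in L^1(G//K)$ is $\widehat f(\varphi)=\int_G f(x)\varphi(x^{-1})dx$. $\mathcal{S}_b(G,K)$ has the weak topology generated by the maps $\widehat f$, $f\in L^1(G//K)$. $\mathcal{S}^+$ carries the Plancherel measure, denoted $d\varphi$: the positive Radon measure such that, whenever $f\in L^1(G//K)$ is a linear combination of positive-definite $K$-bi-invariant functions, $\widehat f\in L^1(\mathcal{S}^+)$ and $f(x)=\int_{\mathcal{S}^+}\widehat f(\varphi)\varphi(x)\,d\varphi$; the map $f\mapsto \widehat f$ on $L^1(G//K)\cap L^2(G//K)$ extends to an isometry of $L^2(G//K)$ onto $L^2(\mathcal{S}^+)$. $L^p(G\times\mathcal{S}^+)$ is taken with respect to $dt\,d\varphi$. For a topological automorphism $\alpha$ of $G$, $\delta_\alpha>0$ is the constant with $d(\alpha(x))=\delta_\alpha dx$, i.e. $\int_G f(\alpha(x))dx=\delta_\alpha^{-1}\int_G f(x)dx$. For $\theta\in L^2(G//K)$, $t\in G$, $\varphi\in\mathcal{S}_b(G,K)$, put $\theta_{\alpha,\varphi,t}(x)=\delta_\alpha^{1/2}\varphi(x)\theta(\alpha(t^{-1}x))$. The Stockwell transform is $S_{\theta,\alpha}f(t,\varphi)=\langle f,\theta_{\alpha,\varphi,t}\rangle_{L^2(G//K)}=\delta_\alpha^{1/2}\int_G f(x)\overline{\varphi(x)\theta(\alpha(t^{-1}x))}\,dx$ for $f\in L^2(G//K)$. For a measurable $u:G\times\mathcal{S}^+\to\mathbb{C}$,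 the localization operator is defined for $f\in L^2(G//K)$ by $$\mathcal{L}_{\theta,\alpha}^{u}f(x)=\int_{\mathcal{S}^+}\int_G u(t,\varphi)\,S_{\theta,\alpha}f(t,\varphi)\,\theta_{\alpha,\varphi,t}(x)\,dt\,d\varphi,\quad x\in G.$$ Schatten-von Neumann classes: for a separable complex Hilbert space $H$ and a compact operator $T$ on $H$, the singular values $s_k(T)$, $k=1,2,\dots$, are the eigenvalues of $|T|=\sqrt{T^*T}$ (counted with multiplicity). For $1\le p<\infty$, $S_p(H)$ is the set of compact $T$ with $\|T\|_{S_p(H)}=\left(\sum_{k}s_k(T)^p\right)^{1/p}<\infty$.
   Formalization: The localization operator need not map L²(G//K) into itself; the claim is proved for it as an operator L²(G//K)→L²(G), and for the operator on L²(G//K) with the same sesquilinear form, which is the localization operator whenever it preserves L²(G//K). *)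

(* Defs.v *)
From HB Require Import structures.
From mathcomp Require Import all_boot all_order all_algebra.
From mathcomp Require Import monoid.
From mathcomp Require Import all_classical all_reals all_analysis.
From mathcomp Require Import complex.

Set Implicit Arguments.
Unset Strict Implicit.
Unset Printing Implicit Defensive.

Import Order.TTheory GRing.Theory Num.Theory.
Import numFieldNormedType.Exports.

Local Open Scope classical_set_scope.
Local Open Scope ring_scope.
Local Open Scope complex_scope.

(* The library puts a topology on every numFieldType, but inference does not
   find it on the concrete field R[i]. *)
HB.instance Definition _ (R : realType) :=
  Topological.copy R[i] (R[i] : numFieldType).
HB.instance Definition _ (R : realType) := isPointed.Build R[i] 0.

HB.mixin Record isTopologicalGroup G of Topological G & Group G := {
  mulg_continuous : continuous (fun x : G * G => (x.1 * x.2)%g) ;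
  invg_continuous : continuous (fun x : G => (x^-1)%g)
}.

(* The base point is only there because measurable types are pointed. *)
#[short(type="topologicalGroupType")]
HB.structure Definition TopologicalGroup :=
  {G of PointedTopological G & Group G & isTopologicalGroup G}.

Section ComplexLebesgue.
Context d (T : measurableType d) (R : realType).
Implicit Types (D : set T) (f : T -> R[i]) (p : R).

Definition modulus (z : R[i]) : R := ComplexField.Normc.normc z.

Definition cmeasurable D f :=
  measurable_fun D (fun x => complex.Re (f x)) /\
  measurable_fun D (fun x => complex.Im (f x)).

Definition cintegral (m : {measure set T -> \bar R}) D f : R[i] :=
  (\int[m]_(x in D) complex.Re (f x)) +i* (\int[m]_(x in D) complex.Im (f x)).

(* [m] is a bare set function so that it may be a product measure, which the
   library only equips with a measure structure once a factor is known to be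
   sigma-finite. *)
Definition Lp_norm (m : set T -> \bar R) D p f : \bar R :=
  ((\int[m]_(x in D) (modulus (f x) `^ p)%:E) `^ p^-1)%E.

Definition Lp (m : set T -> \bar R) D p : set (T -> R[i]) :=
  [set f | cmeasurable D f /\ (Lp_norm m D p f < +oo)%E].

Definition inner (m : {measure set T -> \bar R}) f g : R[i] :=
  cintegral m setT (fun x => f x * (g x)^*).

End ComplexLebesgue.

(* A Hilbert space is presented as a set H of vectors of V with a semidefinite
   form ip, vectors at distance 0 being identified (square-integrable functions
   modulo almost everywhere equality). Operators are functions V -> V restricted
   to their domain H, with values in H'. *)
Section Schatten.
Context (R : realType) (V : lmodType R[i]) (ip : V -> V -> R[i]).
Implicit Types (H : set V) (T A S L : V -> V) (f g : V) (s p : R).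

Definition hnorm f : R := Num.sqrt (complex.Re (ip f f)).

Definition heq f g := hnorm (f - g) = 0.

Definition separable H :=
  exists d : nat -> V, (forall n, H (d n)) /\
    forall f, H f -> forall e : R, 0 < e -> exists n, hnorm (f - d n) < e.

Definition linear_operator H H' T :=
  (forall f, H f -> H' (T f)) /\
  (forall (a : R[i]) f g, H f -> H g ->
     heq (T (a *: f + g)) (a *: T f + T g)).

Definition bounded_operator H H' T :=
  linear_operator H H' T /\
  exists M : R, forall f, H f -> hnorm (T f) <= M * hnorm f.

Definition compact_operator H H' T :=
  linear_operator H H' T /\
  forall h : nat -> V, (forall n, H (h n)) ->
    (exists M : R, forall n, hnorm (h n) <= M) ->
    exists k : nat -> nat, {homo k : m n / (m < n)%N} /\
      exists2 g, H' g & (fun n => hnorm (T (h (k n)) - g)) @ \oo --> (0 : R).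

Definition adjoint H H' T S :=
  (forall g, H' g -> H (S g)) /\
  (forall f g, H f -> H' g -> ip (T f) g = ip f (S g)).

Definition positive_operator H A :=
  bounded_operator H H A /\ forall f, H f -> 0 <= ip (A f) f.

(* A = sqrt (T^* T) on H *)
Definition is_absolute_value H H' T A :=
  positive_operator H A /\
  exists2 S, adjoint H H' T S & forall f, H f -> heq (A (A f)) (S (T f)).

(* |T| exists, and is unique up to heq, for every bounded T. *)
Definition absolute_value H H' T : V -> V :=
  xget (fun=> 0) [set A | is_absolute_value H H' T A].

Definition eigenspace H A s : set V :=
  [set f | H f /\ heq (A f) (s%:C *: f)].

Definition independent n (v : 'I_n -> V) :=
  forall c : 'I_n -> R[i], heq (\sum_i c i *: v i) 0 -> forall i, c i = 0.

Definition multiplicity H A s : \bar R :=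
  ereal_sup [set (n%:R : R)%:E | n in [set n : nat |
    exists v : 'I_n -> V, (forall i, eigenspace H A s (v i)) /\ independent v]].

(* The sum of the p-th powers of the singular values, grouped by value: s ranges
   over the positive reals, and counts as often as it is an eigenvalue of |T|. *)
Definition schatten_norm H H' p T : \bar R :=
  ((\esum_(s in [set s : R | (0 < s)%R])
      (multiplicity H (absolute_value H H' T) s * (s `^ p)%R%:E)) `^ p^-1)%E.

Definition schatten_class H H' p : set (V -> V) :=
  [set T | compact_operator H H' T /\ (schatten_norm H H' p T < +oo)%E].

(* T is the operator on H with the sesquilinear form <L f, g>, f and g in H. It
   is unique up to heq, and is L itself if L maps H to H. A localization operator
   need not do so: unless u(kt, phi) = u(t, phi) for k in K and alpha(K) = K, the
   function L f may fail to be K-bi-invariant. *)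
Definition induced_operator H L T :=
  (forall f, H f -> H (T f)) /\
  (forall f g, H f -> H g -> ip (T f) g = ip (L f) g).

End Schatten.

Definition borel (X : ptopologicalType) : measurableType _ :=
  g_sigma_algebraType (@open X).

Definition open_in (X : topologicalType) (D : set X) : set (set X) :=
  [set U `&` D | U in @open X].

(* m is a Radon measure on the subspace D of X. *)
Definition radon (R : realType) (X : topologicalType) (D : set X)
    (m : set X -> \bar R) :=
  [/\ forall C, C `<=` D -> compact C -> (m C < +oo)%E,
      forall B, <<s open_in D >> B -> B `<=` D ->
        m B = ereal_inf [set m U | U in [set U | open_in D U /\ B `<=` U]] &
      forall U, open_in D U ->
        m U = ereal_sup [set m C | C in [set C | compact C /\ C `<=` U]]].

Section Group.
Context (R : realType) (G : topologicalGroupType).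
Context (mu : {measure set (borel G) -> \bar R}) (K : set G).
Implicit Types (f g phi : G -> R[i]).

Definition left_haar :=
  [/\ radon setT (mu : set G -> \bar R), mu setT <> 0%E &
      forall (x : G) (A : set (borel G)), measurable A ->
        mu [set (x * y : G)%g | y in A] = mu A].

Definition compact_subgroup :=
  [/\ compact K, K 1%g & forall x y, K x -> K y -> K (x * y^-1)%g].

Definition bi_invariant f :=
  forall x k k', K k -> K k' -> f (k * x * k')%g = f x.

Definition CcK : set (G -> R[i]) :=
  [set f | [/\ continuous f, compact (closure [set x | f x != 0]) &
               bi_invariant f]].

Definition L2G : set (G -> R[i]) := Lp mu setT 2.

(* In a class of a.e. equal functions invariant under K on both sides there is a
   function that is invariant at every point. *)
Definition LpK (p : R) : set (G -> R[i]) :=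
  [set f | Lp mu setT p f /\ bi_invariant f].

Definition convolution f g : G -> R[i] :=
  fun x => cintegral mu setT (fun y => f y * g (y^-1 * x)%g).

Definition gelfand_pair :=
  forall f g, CcK f -> CcK g -> forall x, convolution f g x = convolution g f x.

Definition spherical phi :=
  let chi f := cintegral mu setT (fun x => f x * phi x) in
  [/\ continuous phi, bi_invariant phi,
      exists2 f, CcK f & chi f <> 0 &
      forall f g, CcK f -> CcK g -> chi (convolution f g) = chi f * chi g].

Definition positive_definite phi :=
  forall n (x : 'I_n -> G) (c : 'I_n -> R[i]),
    0 <= \sum_i \sum_j c i * (c j)^* * phi ((x j)^-1 * x i)%g.

Definition bounded_spherical : set (G -> R[i]) :=
  [set phi | spherical phi /\ exists M : R, forall x, modulus (phi x) <= M].

Definition Splus : set (G -> R[i]) :=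
  bounded_spherical `&` [set phi | positive_definite phi].

Definition spherical_transform f phi : R[i] :=
  cintegral mu setT (fun x => f x * phi (x^-1)%g).

(* All functions on G, with the topology generated by the spherical transforms
   of the functions of L^1(G//K); it induces the weak topology on
   bounded_spherical, and so on Splus. *)
Definition weak : ptopologicalType :=
  @initial_topology (G -> R[i]) {ptws (set_type (LpK 1)) -> R[i]}
    (fun phi h => spherical_transform (set_val h) phi).

(* The measurable sets included in Splus are its Borel sets, and Splus is one of
   them. *)
Definition dual : measurableType _ :=
  g_sigma_algebraType (open_in (Splus : set weak)).

Definition plancherel (pl : {measure set dual -> \bar R}) :=
  [/\ pl (~` (Splus : set dual)) = 0%E,
      radon (Splus : set weak) (pl : set weak -> \bar R) &
      forall f, LpK 1 f ->
        (exists n (c : 'I_n -> R[i]) (q : 'I_n -> G -> R[i]),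
           (forall i, [/\ continuous (q i), bi_invariant (q i) &
                          positive_definite (q i)]) /\
           forall x, f x = \sum_i c i * q i x) ->
        Lp pl Splus 1 (spherical_transform f) /\
        forall x, f x =
          cintegral pl Splus (fun phi => spherical_transform f phi * phi x)].

Definition topological_automorphism (alpha : G -> G) :=
  [/\ {morph alpha : x y / (x * y)%g}, continuous alpha &
      exists beta : G -> G,
        [/\ cancel alpha beta, cancel beta alpha & continuous beta]].

(* d(alpha(x)) = delta dx *)
Definition automorphism_modulus (alpha : G -> G) (delta : R) :=
  0 < delta /\
  forall A : set (borel G), measurable A ->
    mu [set alpha x | x in A] = (delta%:E * mu A)%E.

Section Localization.
Context (pl : {measure set dual -> \bar R}).
Context (alpha : G -> G) (delta : R) (theta : G -> R[i]).

Definition wavelet phi (t : G) : G -> R[i] :=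
  fun x => (Num.sqrt delta)%:C * phi x * theta (alpha (t^-1 * x)%g).

Definition stockwell f (t : G) phi : R[i] := inner mu f (wavelet phi t).

Definition localization (u : borel G * dual -> R[i]) f : G -> R[i] :=
  fun x => cintegral pl Splus (fun phi => cintegral mu setT (fun t =>
    u (t, phi) * stockwell f t phi * wavelet phi t x)).

Definition product_norm (p : R) (u : borel G * dual -> R[i]) : \bar R :=
  Lp_norm (mu \x^ pl)%E (setT `*` (Splus : set dual)) p u.

Definition product_Lp (p : R) : set (borel G * dual -> R[i]) :=
  Lp (mu \x^ pl)%E (setT `*` (Splus : set dual)) p.

End Localization.

End Group.

(* Main.v *)
Require Import Defs.
From HB Require Import structures.
From mathcomp Require Import all_boot all_order all_algebra.
From mathcomp Require Import monoid.
From mathcomp Require Import all_classical all_reals all_analysis.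
From mathcomp Require Import measurable_realfun complex.
From mathcomp Require Import ring lra.

(** Write [k_z] for the wavelet at [z = (t, phi)]. The localization operator is the
    superposition of rank-one operators [L f = int u(z) <f, k_z> k_z dz], and every
    wavelet has norm at most one: a positive-definite spherical function is bounded by
    its value at the identity, which is one; Haar measure is left invariant; and the
    factor [delta^(1/2)] compensates the automorphism. For an orthonormal family [v_i],
    the Cauchy-Schwarz inequality for the measure [|u| dz], Tonelli's theorem and
    Bessel's inequality at each [z] give

      [sum_i |L v_i|^2 <= |u|_1 sum_i int |u(z)| |<v_i, k_z>|^2 dz <= |u|_1^2],

    which is [kernel_operator_hilbert_schmidt]. For orthonormal eigenvectors of the
    absolute value of [L] the left-hand side is the sum of the squares of the
    eigenvalues, whence the bound on the Schatten norm ([schatten_norm_le]). The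
    operator is compact because a bounded sequence [h_n] has a weakly convergent
    subsequence, along which the coefficients [<h_n, k_z>] converge pointwise and
    boundedly ([kernel_operator_compact]). The operator induced on the bi-invariant
    functions is [L] followed by an orthogonal projection, which does not increase norms.

    The larger part of the work is to give these integrals a meaning, since [G] is
    neither second countable nor sigma-compact by assumption and [theta] is any
    square-integrable function. Separability of [L^2(G//K)] has two consequences:
    [G] is sigma-compact, so that Haar measure is sigma-finite ([sigma_compact]), and
    the compact subgroup [K] has a countable base of neighbourhoods ([countable_base]).
    Together they make a function of [(x, z)] jointly measurable as soon as it is
    measurable in [z] and, in [x], continuous and right [K]-invariant ([caratheodory]).
    This applies to [phi(x)], because averages of [phi] near [x] are spherical
    transforms ([measurable_evalV]). It applies in the same spirit to open sets in the
    variable [t^-1 x], and from them reaches every bi-invariant square-integrable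
    function off a null set ([modify_L2]); by Tonelli's theorem the null set is
    negligible in [x] as well as in [t] ([inverse_null]). Finally the Plancherel measure
    is sigma-finite on the part of the dual that carries [u] ([sigma_finite_support]).

    That [phi(1) = 1] also has to be proved, as spherical functions are given as
    characters: convolving with bump functions concentrated near [K] shows it
    ([spherical1]). *)

Set Implicit Arguments.
Unset Strict Implicit.
Unset Printing Implicit Defensive.

Import Order.TTheory GRing.Theory Num.Theory.
Import numFieldNormedType.Exports.

Local Open Scope classical_set_scope.
Local Open Scope ring_scope.
Local Open Scope complex_scope.

(** * Semi-inner product spaces *)

(** Polynomial in the real and imaginary parts, unlike [modulus], whose square it is. *)
Definition sqmod (R : realType) (z : R[i]) : R :=
  complex.Re z ^+ 2 + complex.Im z ^+ 2.

Section SquaredModulus.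
Context (R : realType).
Implicit Types z w : R[i].

Lemma sqmod_ge0 z : 0 <= sqmod z.
Proof. by rewrite addr_ge0 ?sqr_ge0. Qed.

Lemma sqmodE z : (sqmod z)%:C = z * z^*%C.
Proof.
case: z => a b; rewrite /sqmod /=; simpc; congr (_ +i* _); by ring.
Qed.

Lemma sqmodM z w : sqmod (z * w) = sqmod z * sqmod w.
Proof. by case: z => a b; case: w => c d; rewrite /sqmod /=; ring. Qed.

Lemma conjcM z w : (z * w)^*%C = z^*%C * w^*%C.
Proof. exact: rmorphM. Qed.

Lemma sqmodJ z : sqmod z^*%C = sqmod z.
Proof. by case: z => a b; rewrite /sqmod /= sqrrN. Qed.

Lemma sqmodN z : sqmod (- z) = sqmod z.
Proof. by case: z => a b; rewrite /sqmod /= !sqrrN. Qed.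

Lemma sqmod0 : sqmod (0 : R[i]) = 0.
Proof. by rewrite /sqmod /= expr0n addr0. Qed.

Lemma sqmod_real (a : R) : sqmod a%:C = a ^+ 2.
Proof. by rewrite /sqmod /= expr0n /= addr0. Qed.

Lemma sqmod_eq0 z : sqmod z = 0 -> z = 0.
Proof.
case: z => a b /eqP; rewrite /sqmod /= paddr_eq0 ?sqr_ge0// !sqrf_eq0.
by case/andP => /eqP -> /eqP ->.
Qed.

Lemma modulusE z : modulus z = Num.sqrt (sqmod z).
Proof. by case: z. Qed.

Lemma modulus_sqr z : modulus z ^+ 2 = sqmod z.
Proof. by rewrite modulusE sqr_sqrtr // sqmod_ge0. Qed.

Lemma sqmodD z w : sqmod (z + w) <= 2 * sqmod z + 2 * sqmod w.
Proof.
case: z => a b; case: w => c d; rewrite /sqmod /= -subr_ge0.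
by rewrite [X in 0 <= X](_ : _ = (a - c) ^+ 2 + (b - d) ^+ 2) ?addr_ge0 ?sqr_ge0//; ring.
Qed.

End SquaredModulus.

Section SemiInnerProduct.
Context (R : realType) (V : lmodType R[i]) (ip : V -> V -> R[i]).
Implicit Types (f g h : V) (a b : R[i]) (E H : set V).

Definition linear_subset H :=
  H 0 /\ forall a f g, H f -> H g -> H (a *: f + g).

Lemma linear_subset_sum H (I : Type) (r : seq I) (P : pred I) (c : I -> R[i])
    (v : I -> V) : linear_subset H -> (forall i, H (v i)) ->
  H (\sum_(i <- r | P i) c i *: v i).
Proof.
move=> [H0 Hl] Hv; elim: r => [|i r ih]; first by rewrite big_nil.
by rewrite big_cons; case: (P i) => //; exact: Hl.
Qed.

Lemma linear_subsetZ H a f : linear_subset H -> H f -> H (a *: f).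
Proof. by move=> [H0 Hl] Hf; rewrite -[_ *: _]addr0; exact: Hl. Qed.

Lemma linear_subsetD H f g : linear_subset H -> H f -> H g -> H (f + g).
Proof. by move=> [H0 Hl] Hf Hg; rewrite -[f]scale1r; exact: Hl. Qed.

Lemma linear_subsetB H f g : linear_subset H -> H f -> H g -> H (f - g).
Proof.
by move=> [H0 Hl] Hf Hg; rewrite addrC -[- g]scaleN1r; exact: Hl.
Qed.

(** Restricted to a subset because the integral form [inner] is defined for all
    functions but is sesquilinear on the square-integrable ones. *)
Definition semi_inner_product E :=
  [/\ forall a f g h, E f -> E g -> E h ->
        ip (a *: f + g) h = a * ip f h + ip g h,
      forall f g, E f -> E g -> ip g f = (ip f g)^*%C &
      forall f, E f -> 0 <= ip f f].

Definition orthonormal (I : finType) (v : I -> V) :=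
  forall i j, ip (v i) (v j) = (i == j)%:R.

Context (E : set V) (Elin : linear_subset E) (ipE : semi_inner_product E).

Let ipP a f g h : E f -> E g -> E h ->
  ip (a *: f + g) h = a * ip f h + ip g h.
Proof. by case: ipE => + _ _; exact. Qed.

Lemma ipC f g : E f -> E g -> ip g f = (ip f g)^*%C.
Proof. by case: ipE => _ + _; exact. Qed.

Lemma ip_ge0 f : E f -> 0 <= ip f f.
Proof. by case: ipE => _ _; exact. Qed.

Let E0 : E 0. Proof. by case: Elin. Qed.
Let EZ a f : E f -> E (a *: f). Proof. exact: linear_subsetZ. Qed.
Let ED f g : E f -> E g -> E (f + g). Proof. exact: linear_subsetD. Qed.
Let EB f g : E f -> E g -> E (f - g). Proof. exact: linear_subsetB. Qed.
Local Hint Resolve E0 EZ ED EB : core.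

Lemma ip0l h : E h -> ip 0 h = 0.
Proof.
move=> Eh; have := ipP 1 E0 E0 Eh.
by rewrite scaler0 addr0 mul1r => /(congr1 (fun z => z - ip 0 h)); rewrite subrr addrK.
Qed.

Lemma ipZl a f h : E f -> E h -> ip (a *: f) h = a * ip f h.
Proof. by move=> Ef Eh; rewrite -[a *: f]addr0 ipP// ip0l// addr0. Qed.

Lemma ipDl f g h : E f -> E g -> E h -> ip (f + g) h = ip f h + ip g h.
Proof. by move=> Ef Eg Eh; rewrite -[f]scale1r ipP// mul1r scale1r. Qed.

Lemma ipBl f g h : E f -> E g -> E h -> ip (f - g) h = ip f h - ip g h.
Proof.
move=> Ef Eg Eh; rewrite -scaleN1r ipDl// ?ipZl ?mulN1r//; exact: EZ.
Qed.

Lemma ip0r h : E h -> ip h 0 = 0.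
Proof. by move=> Eh; rewrite ipC// ip0l// conjc0. Qed.

Lemma ipZr a f h : E f -> E h -> ip f (a *: h) = a^*%C * ip f h.
Proof.
move=> Ef Eh; rewrite ipC ?ipZl//; last exact: EZ.
by rewrite rmorphM/= -ipC.
Qed.

Lemma ipDr f g h : E f -> E g -> E h -> ip f (g + h) = ip f g + ip f h.
Proof.
move=> Ef Eg Eh; rewrite ipC ?ipDl//; last exact: ED.
by rewrite rmorphD/= -!ipC.
Qed.

Lemma ipBr f g h : E f -> E g -> E h -> ip f (g - h) = ip f g - ip f h.
Proof.
move=> Ef Eg Eh; rewrite ipC ?ipBl//; last exact: EB.
by rewrite rmorphB/= -!ipC.
Qed.

Lemma ip_suml (I : Type) (r : seq I) (c : I -> R[i]) (v : I -> V) h :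
  (forall i, E (v i)) -> E h ->
  ip (\sum_(i <- r) c i *: v i) h = \sum_(i <- r) c i * ip (v i) h.
Proof.
move=> Ev Eh; elim: r => [|i r ih]; first by rewrite !big_nil ip0l.
by rewrite !big_cons ipP ?ih//; exact: linear_subset_sum.
Qed.

Lemma ip_sumr (I : Type) (r : seq I) (c : I -> R[i]) (v : I -> V) h :
  (forall i, E (v i)) -> E h ->
  ip h (\sum_(i <- r) c i *: v i) = \sum_(i <- r) (c i)^*%C * ip h (v i).
Proof.
move=> Ev Eh; rewrite ipC//; last exact: linear_subset_sum.
rewrite ip_suml// rmorph_sum/=; apply: eq_bigr => i _.
by rewrite rmorphM/= -ipC.
Qed.

Lemma hnorm_ge0 f : 0 <= hnorm ip f.
Proof. exact: sqrtr_ge0. Qed.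

Lemma Re_ip_ge0 f : E f -> 0 <= complex.Re (ip f f).
Proof. by move=> /ip_ge0; rewrite lecE => /andP[]. Qed.

Lemma hnorm_sqr f : E f -> hnorm ip f ^+ 2 = complex.Re (ip f f).
Proof. by move=> Ef; rewrite sqr_sqrtr// Re_ip_ge0. Qed.

Lemma ip_hnorm f : E f -> ip f f = (hnorm ip f ^+ 2)%:C.
Proof.
move=> Ef; rewrite hnorm_sqr//.
by have /ger0_Im := ip_ge0 Ef; case: (ip f f) => x y /= ->.
Qed.

Lemma hnorm_sqrD a f g : E f -> E g ->
  hnorm ip (a *: f + g) ^+ 2 =
  sqmod a * hnorm ip f ^+ 2 + 2 * complex.Re (a * ip f g) + hnorm ip g ^+ 2.
Proof.
move=> Ef Eg; have Eaf := EZ a Ef; have Eafg := ED Eaf Eg.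
apply: complexI; rewrite -ip_hnorm// ipP// ipDr// ipDr// ipZr// ipZr//.
rewrite (ipC Ef Eg) !ip_hnorm//; move: (ip f g) => w.
case: a {Eaf Eafg} => a b; case: w => c d.
rewrite /sqmod /=; simpc; congr (_ +i* _); ring.
Qed.

Lemma hnormZ a f : E f -> hnorm ip (a *: f) ^+ 2 = sqmod a * hnorm ip f ^+ 2.
Proof.
move=> Ef; rewrite -[a *: f]addr0 hnorm_sqrD// ip0r// mulr0/= mulr0 addr0.
by rewrite /hnorm ip0l//= sqrtr0 expr0n /= addr0.
Qed.

(** The square norm of [g - t conj(<f, g>) f] is nonnegative for every real [t]. *)
Lemma cauchy_schwarz f g : E f -> E g ->
  sqmod (ip f g) <= hnorm ip f ^+ 2 * hnorm ip g ^+ 2.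
Proof.
move=> Ef Eg; set s := sqmod (ip f g).
have s0 : 0 <= s by exact: sqmod_ge0.
have key (t : R) : 0 <= t ^+ 2 * s * hnorm ip f ^+ 2 - 2 * (t * s) + hnorm ip g ^+ 2.
  have := sqr_ge0 (hnorm ip ((- t%:C * (ip f g)^*%C) *: f + g)).
  rewrite hnorm_sqrD// sqmodM sqmodN sqmod_real sqmodJ -/s.
  suff -> : complex.Re (- t%:C * (ip f g)^*%C * ip f g) = - (t * s) by rewrite mulrN.
  by rewrite !mulNr -mulrA (mulrC _^*%C) -sqmodE -rmorphM.
have [f0|f0] := eqVneq (hnorm ip f ^+ 2) 0.
  rewrite f0 mul0r leNgt; apply/negP => sp.
  have := key ((hnorm ip g ^+ 2 + 1) / s).
  by rewrite f0 mulr0 sub0r mulfVK ?gt_eqF//; have := sqr_ge0 (hnorm ip g); lra.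
have fp : 0 < hnorm ip f ^+ 2 by rewrite lt_neqAle eq_sym f0 sqr_ge0.
have := key ((hnorm ip f ^+ 2)^-1).
set x := hnorm ip f ^+ 2 in f0 fp *; set y := hnorm ip g ^+ 2.
have -> : x^-1 ^+ 2 * s * x = x^-1 * s by field.
move=> h; rewrite mulrC -ler_pdivrMr// mulrC; lra.
Qed.

Lemma ip_eq0l f g : E f -> E g -> hnorm ip f = 0 -> ip f g = 0.
Proof.
move=> Ef Eg f0; apply: sqmod_eq0; apply/eqP; rewrite eq_le sqmod_ge0 andbT.
by apply: le_trans (cauchy_schwarz Ef Eg) _; rewrite f0 expr0n /= mul0r.
Qed.

Lemma heq_ipl f g h : E f -> E g -> E h -> heq ip f g -> ip f h = ip g h.
Proof.
move=> Ef Eg Eh fg; apply/eqP; rewrite -subr_eq0 -ipBl// ip_eq0l//.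
exact: EB.
Qed.

Lemma heq_ipr f g h : E f -> E g -> E h -> heq ip f g -> ip h f = ip h g.
Proof.
by move=> Ef Eg Eh fg; rewrite (ipC Ef)// (heq_ipl Ef Eg)// -ipC.
Qed.

Lemma ler_hnorm_sqr (x : R) f : 0 <= x -> hnorm ip f ^+ 2 <= x ^+ 2 -> hnorm ip f <= x.
Proof. by move=> x0; rewrite ler_pXn2r// nnegrE hnorm_ge0. Qed.

Lemma ler_hnormD f g : E f -> E g ->
  hnorm ip (f + g) <= hnorm ip f + hnorm ip g.
Proof.
move=> Ef Eg; apply: ler_hnorm_sqr; first by rewrite addr_ge0 ?hnorm_ge0.
rewrite -[f in X in X <= _]scale1r hnorm_sqrD// mul1r sqmod_real expr1n mul1r.
suff : complex.Re (ip f g) <= hnorm ip f * hnorm ip g by nra.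
have := cauchy_schwarz Ef Eg; rewrite -exprMn /sqmod => h.
apply: le_trans (ler_norm _) _.
rewrite -(@ler_pXn2r _ 2)// ?nnegrE ?mulr_ge0 ?hnorm_ge0 ?normr_ge0//.
by rewrite real_normK ?num_real//; have := sqr_ge0 (complex.Im (ip f g)); lra.
Qed.

Lemma hnormN f : E f -> hnorm ip (- f) = hnorm ip f.
Proof.
move=> Ef; apply/eqP; rewrite -(@eqrXn2 _ 2)// ?hnorm_ge0//.
rewrite -scaleN1r hnormZ// -(rmorphN1 (real_complex R)) sqmod_real.
by rewrite sqrrN expr1n mul1r.
Qed.

Lemma hnorm_sym f g : E f -> E g -> hnorm ip (f - g) = hnorm ip (g - f).
Proof. by move=> Ef Eg; rewrite -hnormN ?opprB//; exact: EB. Qed.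

Lemma ler_hdist f g h : E f -> E g -> E h ->
  hnorm ip (f - h) <= hnorm ip (f - g) + hnorm ip (g - h).
Proof.
move=> Ef Eg Eh; rewrite -[f - h](subrKA g).
by apply: ler_hnormD; exact: EB.
Qed.

(** Expand the square norm of [f] minus its projection on the span of [v]. *)
Lemma bessel (I : finType) (v : I -> V) f : E f -> (forall i, E (v i)) ->
  orthonormal v -> \sum_i sqmod (ip (v i) f) <= hnorm ip f ^+ 2.
Proof.
move=> Ef Ev ov; set p := \sum_i (ip f (v i)) *: v i.
have Ep : E p by exact: linear_subset_sum.
have fp : ip f p = (\sum_i sqmod (ip (v i) f))%:C.
  rewrite ip_sumr// rmorph_sum/=; apply: eq_bigr => i _.
  by rewrite (ipC Ef (Ev i)) sqmodE conjcK.
have pp : ip p p = (\sum_i sqmod (ip (v i) f))%:C.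
  rewrite ip_suml// rmorph_sum/=; apply: eq_bigr => i _.
  rewrite ip_sumr// (bigD1 i)//= big1 ?addr0 => [|j ji].
    by rewrite ov eqxx mulr1 (ipC Ef (Ev i)) sqmodE conjcK mulrC.
  by rewrite ov eq_sym (negbTE ji) mulr0.
have := ip_ge0 (EB Ef Ep); rewrite ipBl ?ipBr//; last exact: EB.
rewrite (ipC Ef Ep) fp pp conjc_real subrr subr0 ip_hnorm//.
by rewrite subr_ge0 lecR.
Qed.

End SemiInnerProduct.

(** * Orthonormalisation, projections and the Hilbert-Schmidt bound *)

Section HilbertTools.
Context (R : realType) (V : lmodType R[i]) (ip : V -> V -> R[i]).
Implicit Types (f g h : V) (a b : R[i]) (H : set V).
Context (E : set V) (Elin : linear_subset E) (ipE : semi_inner_product ip E).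

Let E0 : E 0. Proof. by case: Elin. Qed.
Let EZ a f : E f -> E (a *: f). Proof. exact: linear_subsetZ. Qed.
Let ED f g : E f -> E g -> E (f + g). Proof. exact: linear_subsetD. Qed.
Let EB f g : E f -> E g -> E (f - g). Proof. exact: linear_subsetB. Qed.

(** Operators are only linear up to distance zero, which products turn into equalities. *)
Lemma heqP f g : E f -> E g ->
  heq ip f g <-> forall h, E h -> ip f h = ip g h.
Proof.
move=> Ef Eg; split=> [fg h Eh|fg]; first exact: (heq_ipl Elin ipE).
have Efg := EB Ef Eg; apply/eqP; rewrite -sqrf_eq0; apply/eqP.
by rewrite (hnorm_sqr ipE)// (ipBl Elin ipE)// fg// subrr.
Qed.

Lemma big_ord_lift_max (W : zmodType) n (F : 'I_n.+1 -> W) :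
  \sum_i F i = \sum_i F (lift ord_max i) + F ord_max.
Proof.
rewrite big_ord_recr/=; congr (_ + _); apply: eq_bigr => i _; congr (F _).
by apply: val_inj; rewrite /= /bump leqNgt ltn_ord.
Qed.

Let extend n (T : Type) (x : T) (c : 'I_n -> T) (i : 'I_n.+1) : T :=
  if unlift ord_max i is Some j then c j else x.

Let extend_max n T (x : T) (c : 'I_n -> T) : extend x c ord_max = x.
Proof. by rewrite /extend unlift_none. Qed.

Let extend_lift n T (x : T) (c : 'I_n -> T) i : extend x c (lift ord_max i) = c i.
Proof. by rewrite /extend liftK. Qed.

(** Gram-Schmidt. The new vectors are kept as explicit combinations of the old
    ones, so that they remain in any subspace containing these, and so that
    independence prevents the next residual from being null. *)
Lemma gram_schmidt n (v : 'I_n -> V) : (forall i, E (v i)) ->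
  independent ip v -> exists w : 'I_n -> V, orthonormal ip w /\
    forall i, exists c, w i = \sum_j c j *: v j.
Proof.
elim: n v => [|n ih] v Ev vind; first by exists v; split=> -[].
have [|w [wo wc]] := ih (v \o lift ord_max) (fun i => Ev _).
  move=> c c0 i; have /(_ _ (lift ord_max i)) := vind (extend 0 c).
  rewrite extend_lift; apply.
  rewrite big_ord_lift_max extend_max scale0r addr0.
  by under eq_bigr do rewrite extend_lift.
have {wc}[C wC] := choice wc.
have Ew i : E (w i) by rewrite wC; apply: linear_subset_sum => // j; exact: Ev.
pose m := v ord_max; pose r := m - \sum_i ip m (w i) *: w i.
have Em : E m by exact: Ev.
have Es : E (\sum_i ip m (w i) *: w i) by exact: linear_subset_sum.
have Er : E r by exact: EB.
pose d := extend 1 (fun j => - \sum_i ip m (w i) * C i j).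
have rd : r = \sum_j d j *: v j.
  rewrite big_ord_lift_max /d extend_max scale1r addrC /r; congr (_ + _).
  under [in RHS]eq_bigr do rewrite extend_lift scaleNr scaler_suml.
  rewrite sumrN exchange_big/=; congr (- _); apply: eq_bigr => i _.
  rewrite wC scaler_sumr; apply: eq_bigr => j _.
  by rewrite scalerA.
have r0 : hnorm ip r != 0.
  apply/eqP => r0; have := vind d; rewrite -rd /heq subr0 => /(_ r0 ord_max).
  by rewrite /d extend_max => /eqP; rewrite oner_eq0.
have rw i : ip r (w i) = 0.
  rewrite (ipBl Elin ipE)// (ip_suml Elin ipE)// (bigD1 i)//= big1 ?addr0.
    by rewrite wo eqxx mulr1 subrr.
  by move=> j ji; rewrite wo (negbTE ji) mulr0.
pose u := ((hnorm ip r)^-1)%:C *: r.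
have Eu : E u by exact: EZ.
exists (extend u w); split.
  move=> i j; case: (unliftP ord_max i) => [i'|] ->; case: (unliftP ord_max j) => [j'|] ->;
    rewrite ?extend_lift ?extend_max.
  - by rewrite wo (inj_eq lift_inj).
  - rewrite (ipC ipE)// (ipZl Elin ipE)// rw mulr0 conjc0.
    by rewrite eq_sym (negbTE (neq_lift _ _)).
  - by rewrite (ipZl Elin ipE)// rw mulr0 (negbTE (neq_lift _ _)).
  - rewrite eqxx (ipZl Elin ipE)// (ipZr Elin ipE)// (ip_hnorm ipE)//.
    by rewrite conjc_real -!rmorphM/= expr2 mulKf// mulVf.
move=> i; case: (unliftP ord_max i) => [i'|] ->; rewrite ?extend_lift ?extend_max.
  exists (extend 0 (C i')); rewrite big_ord_lift_max extend_max scale0r addr0 wC.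
  by under [RHS]eq_bigr do rewrite extend_lift.
exists (fun j => ((hnorm ip r)^-1)%:C * d j); rewrite /u rd scaler_sumr.
by apply: eq_bigr => j _; rewrite scalerA.
Qed.

Section Eigenvectors.
Context (H : set V) (Hlin : linear_subset H) (HE : H `<=` E).
Context (A : V -> V) (bA : bounded_operator ip H H A).

Let A_in f : H f -> H (A f). Proof. by case: bA => -[+ _] _; exact. Qed.

Let A_ip a f g h : H f -> H g -> E h ->
  ip (A (a *: f + g)) h = a * ip (A f) h + ip (A g) h.
Proof.
move=> Hf Hg Eh; have Hfg : H (a *: f + g) by case: Hlin => _; exact.
have EAf : E (A f) by exact/HE/A_in.
have EAg : E (A g) by exact/HE/A_in.
rewrite -(ipZl Elin ipE)// -(ipDl ipE)//; last exact: EZ.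
apply/(heqP _ _).1 => //; first exact/HE/A_in.
- by apply: ED => //; exact: EZ.
- by case: bA => -[_ +] _; exact.
Qed.

Lemma bounded_operator_heq f g : H f -> H g -> heq ip f g -> heq ip (A f) (A g).
Proof.
move=> Hf Hg fg; case: (bA) => _ [M AM].
have Hfg : H (f - g) by exact: linear_subsetB.
have z : hnorm ip (A (f - g)) = 0.
  by apply/eqP; rewrite eq_le hnorm_ge0 andbT (le_trans (AM _ Hfg))// fg mulr0.
apply/heqP => [||h Eh]; [exact/HE/A_in|exact/HE/A_in|].
have := ip_eq0l Elin ipE (HE (A_in Hfg)) Eh z.
rewrite addrC -scaleN1r A_ip// mulN1r addrC => /eqP.
by rewrite subr_eq0 => /eqP.
Qed.

Lemma linear_eigenspace s : linear_subset (Defs.eigenspace ip H A s).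
Proof.
have H0 : H 0 by case: Hlin.
split.
  split=> //; rewrite scaler0; apply/heqP => [||h Eh] => //; first exact/HE/A_in.
  have := A_ip 1 H0 H0 Eh; rewrite scaler0 addr0 mul1r.
  move=> /(congr1 (fun z => z - ip (A 0) h)); rewrite subrr addrK => <-.
  by rewrite (ip0l Elin ipE).
move=> a f g [Hf Af] [Hg Ag].
have Hfg : H (a *: f + g) by case: Hlin => _; exact.
have [Ef Eg] := (HE Hf, HE Hg); have Efg := HE Hfg.
split=> //; apply/heqP => [||h Eh]; [exact/HE/A_in|exact: EZ|].
rewrite A_ip//.
move/(heqP (HE (A_in Hf)) (EZ _ Ef)) : Af => ->//.
move/(heqP (HE (A_in Hg)) (EZ _ Eg)) : Ag => ->//.
rewrite !(ipZl Elin ipE)// (ipDl ipE)//; last exact: EZ.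
by rewrite (ipZl Elin ipE)//; ring.
Qed.

Context (H' : set V) (T S : V -> V).
Context (HT : forall f, H f -> H' (T f)) (TS : adjoint ip H H' T S).
Context (AS : forall f, H f -> heq ip (A (A f)) (S (T f))).

(** Since [A] squares to [S T], the form [<T f, T g>] is [<f, A A g>]. *)
Lemma ip_eigenvectors s f g : H f -> Defs.eigenspace ip H A s g ->
  ip (T f) (T g) = (s ^+ 2)%:C * ip f g.
Proof.
move=> Hf [Hg Ag]; have [TSH TSip] := TS.
have HAg := A_in Hg; have HAAg := A_in HAg.
have HS : H (S (T g)) by exact/TSH/HT.
have Hsg : H (s%:C *: g) by exact: linear_subsetZ.
have HAsg := A_in Hsg.
have H0 : H 0 by case: Hlin.
rewrite TSip//; last exact: HT.
rewrite -(heq_ipr Elin ipE (HE HAAg) (HE HS) (HE Hf) (AS Hg)).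
rewrite (heq_ipr Elin ipE (HE HAAg) (HE HAsg) (HE Hf) (bounded_operator_heq _ _ Ag))//.
rewrite (ipC ipE (HE HAsg) (HE Hf)).
have A0 : ip (A 0) f = 0.
  have [_ /heqP h] := (linear_eigenspace 0).1.
  rewrite (h _ _ f (HE Hf)) ?scaler0 ?(ip0l Elin ipE)//; first exact: HE.
  exact/HE/A_in.
have := A_ip s%:C Hg H0 (HE Hf); rewrite addr0 A0 addr0 => ->.
rewrite (heq_ipl Elin ipE (HE HAg) (HE Hsg) (HE Hf) Ag).
rewrite (ipZl Elin ipE) ?(HE Hg) ?(HE Hf)//; try exact: HE.
rewrite mulrA -rmorphM/= conjcM conjc_real -expr2.
by rewrite -(ipC ipE)//; exact: HE.
Qed.

End Eigenvectors.

End HilbertTools.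

Section SchattenBound.
Context (R : realType) (V : lmodType R[i]) (ip : V -> V -> R[i]).
Context (E : set V) (Elin : linear_subset E) (ipE : semi_inner_product ip E).
Context (H : set V) (Hlin : linear_subset H) (HE : H `<=` E).
Context (H' : set V) (HE' : H' `<=` E) (T : V -> V).
Context (HT : forall f, H f -> H' (T f)).
Implicit Types (A : V -> V) (s : R).

Definition eigen_dim A s (n : nat) := exists v : 'I_n -> V,
  (forall i, Defs.eigenspace ip H A s (v i)) /\ independent ip v.

Lemma eigen_dim0 A s : eigen_dim A s 0.
Proof. by exists (fun=> 0); split=> [[]//|c _ []]. Qed.

Lemma eigen_dim_orthonormal A s n : bounded_operator ip H H A ->
  eigen_dim A s n -> exists v : 'I_n -> V,
    (forall i, Defs.eigenspace ip H A s (v i)) /\ orthonormal ip v.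
Proof.
move=> bA [v [Av vi]].
have [|w [wo wv]] := gram_schmidt Elin ipE _ vi.
  by move=> i; case: (Av i) => /HE.
exists w; split=> // i; have [c ->] := wv i.
apply: linear_subset_sum => //; exact: (linear_eigenspace Elin ipE Hlin HE bA).
Qed.

Context (C : R) (C0 : 0 <= C).
Context (HS : forall (I : finType) (v : I -> V), (forall i, H (v i)) ->
  orthonormal ip v -> \sum_i hnorm ip (T (v i)) ^+ 2 <= C ^+ 2).

(** Orthonormal bases of eigenspaces of [A] for distinct eigenvalues combine to
    one orthonormal family, because [s^2 <f, g> = <T f, T g> = t^2 <f, g>]
    whenever [f] and [g] belong to the eigenvalues [s] and [t]. *)
Lemma sum_eigenvalues (A S : V -> V) (I : finType) (s : I -> R) (n : I -> nat) :
  bounded_operator ip H H A -> adjoint ip H H' T S ->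
  (forall f, H f -> heq ip (A (A f)) (S (T f))) ->
  injective s -> (forall i, 0 < s i) ->
  (forall i, eigen_dim A (s i) (n i)) ->
  \sum_i (n i)%:R * s i ^+ 2 <= C ^+ 2.
Proof.
move=> bA TS AS sI s0 sn.
have wex i : {w : 'I_(n i) -> V |
    (forall j, Defs.eigenspace ip H A (s i) (w j)) /\ orthonormal ip w}.
  by apply: cid; exact: eigen_dim_orthonormal.
pose w i := sval (wex i); have wP i : (forall j, Defs.eigenspace ip H A (s i) (w i j)) /\ orthonormal ip (w i).
  exact: svalP (wex i).
have wA i j : Defs.eigenspace ip H A (s i) (w i j) by case: (wP i).
have Hw i j : H (w i j) by case: (wA i j).
have TT i j i' j' := ip_eigenvectors Elin ipE Hlin HE bA HT TS AS (Hw i j) (wA i' j').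
pose W (p : {i : I & 'I_(n i)}) := w (tag p) (tagged p).
have oW : orthonormal ip W.
  move=> [i j] [i' j']; rewrite /W /=.
  have [ii|ii] := eqVneq i i'.
    case: _ / ii in j' *; rewrite (proj2 (wP i)); congr (nat_of_bool _)%:R.
    exact/esym/(@eq_Tagged _ (fun i => 'I_(n i)) (existT _ i j) j').
  have -> : (existT _ i j == existT _ i' j' :> {i : I & 'I_(n i)}) = false.
    by apply/negbTE; apply: contra_neq ii => -[].
  have Ew := HE (Hw i j); have Ew' := HE (Hw i' j').
  have ET x y : E (T (w x y)) by exact/HE'/HT.
  have := TT i j i' j'; rewrite (ipC ipE (ET _ _) (ET _ _)) TT conjcM conjc_real.
  rewrite -(ipC ipE)// => /eqP; rewrite -subr_eq0 -mulrBl mulf_eq0 => /orP[|/eqP//].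
  rewrite -rmorphB/= -[0]/(0%:C) (inj_eq (@complexI R)) subr_eq0 eqrXn2 ?ltW//.
  by move=> /eqP/sI/eqP; rewrite ?(negbTE ii)// eq_sym (negbTE ii).
have := HS (fun p => Hw _ _) oW; apply: le_trans.
rewrite -(sig_big_dep (fun=> true) (fun i (_ : 'I_(n i)) => true)
  (fun i j => hnorm ip (T (w i j)) ^+ 2))/=.
apply: ler_sum => i _; rewrite (eq_bigr (fun=> s i ^+ 2)).
  by rewrite sumr_const card_ord mulr_natl.
move=> j _; rewrite (hnorm_sqr ipE) ?TT; last exact/HE'/HT.
by rewrite (proj2 (wP i)) eqxx mulr1.
Qed.

(** [absolute_value] is a choice with default value [0], so both cases have to be
    covered; the zero operator has no positive eigenvalue. *)
Lemma absolute_valueP :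
  is_absolute_value ip H H' T (absolute_value ip H H' T) \/
  absolute_value ip H H' T = fun=> 0.
Proof. by rewrite /absolute_value; case: xgetP => [A _ AP|_]; [left|right]. Qed.

Lemma eigen_dim_cst0 s n : 0 < s -> eigen_dim (fun=> 0) s n -> n = 0%N.
Proof.
move=> s0 [v [Av vi]]; case: n v Av vi => // n v Av vi; exfalso.
have [Hv v0] := Av ord0; have Ev := HE Hv; have [E0 _] := Elin.
have EZ := linear_subsetZ s%:C Elin Ev.
suff /vi/(_ ord0)/eqP : heq ip (\sum_(i < n.+1) (i == ord0)%:R *: v i) 0.
  by rewrite oner_eq0.
rewrite (bigD1 ord0)//= big1 ?addr0 => [|i i0]; last first.
  by rewrite (negbTE i0) scale0r.
rewrite scale1r; apply/(heqP Elin ipE) => // h Eh.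
have /eqP := (heqP Elin ipE E0 EZ).1 v0 h Eh.
rewrite (ip0l Elin ipE)// (ipZl Elin ipE)// eq_sym mulf_eq0.
by rewrite -[0]/(0%:C) (inj_eq (@complexI R)) gt_eqF//= => /eqP.
Qed.

Let A := absolute_value ip H H' T.

Lemma sum_singular_values (I : finType) (s : I -> R) (n : I -> nat) :
  injective s -> (forall i, 0 < s i) ->
  (forall i, eigen_dim A (s i) (n i)) ->
  \sum_i (n i)%:R * s i ^+ 2 <= C ^+ 2.
Proof.
rewrite /A; case: absolute_valueP => [[[bA _] [S TS AS]]|->] sI s0 sn.
  exact: sum_eigenvalues bA TS AS sI s0 sn.
rewrite big1 ?sqr_ge0// => i _.
by rewrite (eigen_dim_cst0 (s0 i) (sn i)) mul0r.
Qed.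

(** By the Hilbert-Schmidt bound, [n] orthonormal eigenvectors for [s] satisfy
    [n s^2 <= C^2], so the supremum is one of integers below a bound. *)
Lemma multiplicity_attained s : 0 < s ->
  exists2 n, eigen_dim A s n & multiplicity ip H A s = n%:R%:E.
Proof.
move=> s0.
have bound n : eigen_dim A s n -> n%:R <= C ^+ 2 / s ^+ 2.
  move=> sn; rewrite ler_pdivlMr ?exprn_gt0//.
  have := @sum_singular_values 'I_1 (fun=> s) (fun=> n).
  rewrite big_ord1; apply => // i j _; by rewrite !ord1.
pose P n := `[< eigen_dim A s n >].
have P0 : exists n, P n by exists 0%N; apply/asboolP; exact: eigen_dim0.
have PB n : P n -> (n <= Num.bound (C ^+ 2 / s ^+ 2))%N.
  move=> /asboolP /bound nb; rewrite -(ler_nat R); apply/ltW/(le_lt_trans nb).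
  by rewrite archi_boundP// divr_ge0 ?sqr_ge0.
case: (ex_maxnP P0 PB) => n /asboolP Pn nmax; exists n => //.
apply/eqP; rewrite eq_le; apply/andP; split; last first.
  by apply: ereal_sup_ubound; exists n.
apply: ge_ereal_sup => _ [m Pm <-]; rewrite lee_fin ler_nat nmax//.
exact/asboolP.
Qed.

(** A sum over all positive reals is the supremum of its finite subsums, and a finite
    set of eigenvalues contributes at most [C^2]. *)
Lemma schatten_norm_le : (schatten_norm ip H H' 2 T <= C%:E)%E.
Proof.
have -> : (C%:E = (C ^+ 2)%:E `^ 2^-1)%E.
  by rewrite poweR_EFin powR12_sqrt ?sqr_ge0// sqrtr_sqr ger0_norm.
have m0 s : 0 < s -> (0 <= multiplicity ip H A s)%E.
  by move=> /multiplicity_attained[n _ ->]; rewrite lee_fin.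
apply: gt0_ler_poweR; rewrite ?invr_ge0//.
- rewrite in_itv/= leey andbT; apply: esum_ge0 => s s0.
  by rewrite mule_ge0 ?m0// lee_fin powR_ge0.
- by rewrite in_itv/= leey andbT lee_fin sqr_ge0.
apply: ge_ereal_sup => _ [F [finF F0] <-]; rewrite fsbig_finite//=.
set r := finmap.enum_fset (fset_set F); rewrite big_tnth.
pose s := tnth (in_tuple r).
have s0 i : 0 < s i.
  by apply: F0; have := mem_tnth i (in_tuple r); rewrite in_fset_set// inE.
have /choice[n nP] : forall i, exists n,
    eigen_dim A (s i) n /\ multiplicity ip H A (s i) = n%:R%:E.
  by move=> i; have [n] := multiplicity_attained (s0 i); exists n.
under eq_bigr => i _ do rewrite (proj2 (nP i)) -EFinM -/(2%:R) powR_mulrn ?ltW//.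
rewrite sumEFin lee_fin; apply: sum_singular_values => //.
  by apply/tuple_uniqP; exact: finmap.fset_uniq.
by move=> i; case: (nP i).
Qed.

End SchattenBound.

Section Projection.
Context (R : realType) (V : lmodType R[i]) (ip : V -> V -> R[i]).
Context (E : set V) (Elin : linear_subset E) (ipE : semi_inner_product ip E).
Implicit Types (f g h p : V) (H : set V).

Let EZ a f : E f -> E (a *: f). Proof. exact: linear_subsetZ. Qed.
Let ED f g : E f -> E g -> E (f + g). Proof. exact: linear_subsetD. Qed.
Let EB f g : E f -> E g -> E (f - g). Proof. exact: linear_subsetB. Qed.

Definition complete_subset H := forall h : nat -> V, (forall n, H (h n)) ->
  (forall e : R, 0 < e -> exists N, forall m n, (N <= m)%N -> (N <= n)%N ->
    hnorm ip (h m - h n) < e) ->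
  exists2 g, H g & forall e : R, 0 < e -> exists N, forall n, (N <= n)%N ->
    hnorm ip (h n - g) < e.

(** First variation: compare [p] with [p + t <g - p, h> h] for a small [t]. *)
Lemma nearest_orthogonal H g p : linear_subset H -> H `<=` E -> E g -> H p ->
  (forall h, H h -> hnorm ip (g - p) ^+ 2 <= hnorm ip (g - h) ^+ 2) ->
  forall h, H h -> ip p h = ip g h.
Proof.
move=> Hlin HE Eg Hp pmin h Hh; have [Ep Eh] := (HE _ Hp, HE _ Hh).
have Er := EB Eg Ep; set r := g - p in Er pmin.
suff : ip r h = 0.
  by rewrite (ipBl Elin ipE)// => /eqP; rewrite subr_eq0 => /eqP.
set w := ip r h; set s := sqmod w.
(* The quadratic term in [t] must not exceed the linear one, also when [h] is null. *)
set t := (hnorm ip h ^+ 2 + 1)^-1.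
have t0 : 0 < t by rewrite invr_gt0 ltr_wpDl ?sqr_ge0.
have := pmin _ (linear_subsetD Hlin Hp (linear_subsetZ (t%:C * w) Hlin Hh)).
rewrite opprD addrA -/r addrC -scaleNr (hnorm_sqrD Elin ipE)// -/r.
rewrite (ipC ipE Er Eh) -/w sqmodN sqmodM sqmod_real.
have -> : complex.Re (- (t%:C * w) * w^*%C) = - (t * s).
  by rewrite !mulNr -mulrA -sqmodE -rmorphM.
rewrite -/s => h0; apply: sqmod_eq0; rewrite -/s; apply/eqP.
rewrite eq_le sqmod_ge0 andbT.
have th : t * hnorm ip h ^+ 2 < 1.
  by rewrite mulrC ltr_pdivrMr ?mul1r ?ltrDl// ltr_wpDl ?sqr_ge0.
have s0 : 0 <= s by exact: sqmod_ge0.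
have : 0 <= t * s * (t * hnorm ip h ^+ 2 - 2).
  by move: h0; set a := hnorm ip h ^+ 2; set b := hnorm ip r ^+ 2; lra.
rewrite nmulr_lge0; last by move: th; set a := t * _; lra.
by rewrite pmulr_rle0.
Qed.

(** A minimising sequence for the distance is Cauchy by the parallelogram law. *)
Lemma projection_exists H g : linear_subset H -> H `<=` E -> complete_subset H ->
  E g -> exists2 p, H p & forall h, H h -> ip p h = ip g h.
Proof.
move=> Hlin HE Hc Eg; have [H0 _] := Hlin.
pose D := [set hnorm ip (g - h) ^+ 2 | h in H]; pose d := inf D.
have Di : has_inf D.
  split; first by exists (hnorm ip (g - 0) ^+ 2), 0.
  by exists 0 => _ [h Hh <-]; exact: sqr_ge0.
have dmin h : H h -> d <= hnorm ip (g - h) ^+ 2.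
  by move=> Hh; apply: ge_inf; [case: Di|exists h].
have /choice[h hP] : forall n, exists h,
    H h /\ hnorm ip (g - h) ^+ 2 < d + n.+1%:R^-1.
  move=> n; have [|_ [h Hh <-] hd] := @inf_adherent _ D n.+1%:R^-1 _ Di.
    by rewrite invr_gt0.
  by exists h.
have Hh n : H (h n) by case: (hP n).
have hd n : hnorm ip (g - h n) ^+ 2 < d + n.+1%:R^-1 by case: (hP n).
have Eh n := HE _ (Hh n).
have half2 : 2^-1 + 2^-1 = 1 :> R by field.
have small e : 0 < e -> exists N, forall k, (N <= k)%N -> k.+1%:R^-1 < e :> R.
  move=> e0; have [N _ hN] := near_infty_natSinv_lt (PosNum e0).
  by exists N => k; exact: hN.
have par m n : hnorm ip (h m - h n) ^+ 2 <= 2 * (m.+1%:R^-1 + n.+1%:R^-1).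
  pose x := g - h m; pose y := g - h n.
  have Ex : E x by exact: EB. have Ey : E y by exact: EB.
  have xy : hnorm ip (h m - h n) ^+ 2 =
      hnorm ip x ^+ 2 - 2 * complex.Re (ip x y) + hnorm ip y ^+ 2.
    have -> : h m - h n = (-1) *: x + y.
      by rewrite scaleN1r opprB addrA subrK.
    rewrite (hnorm_sqrD Elin ipE)// mulN1r -(rmorphN1 (real_complex R)) sqmod_real.
    by rewrite sqrrN expr1n mul1r raddfN mulrN.
  have := dmin (2^-1%:C *: (h m + h n)).
  have -> : g - 2^-1%:C *: (h m + h n) = 2^-1%:C *: x + 2^-1%:C *: y.
    rewrite -scalerDr /x /y addrACA -opprD scalerBr; congr (_ - _).
    by rewrite scalerDr -scalerDl -rmorphD/= half2 scale1r.
  rewrite (hnorm_sqrD Elin ipE)//; last exact: EZ.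
  rewrite (ipZr Elin ipE)// conjc_real mulrA -rmorphM/=.
  rewrite !(hnormZ Elin ipE)// !sqmod_real => dm.
  have {dm} := dm (linear_subsetZ _ Hlin (linear_subsetD Hlin (Hh m) (Hh n))).
  have -> : complex.Re ((2^-1 * 2^-1)%:C * ip x y) = 2^-1 * 2^-1 * complex.Re (ip x y).
    by case: (ip x y) => a b; simpc.
  have := hd m; have := hd n; rewrite -/x -/y xy.
  move: (complex.Re _) => c; move: (_ ^+ 2) (_ ^+ 2) => a b.
  by move: (_^-1) (_^-1) => i j; lra.
have [||p Hp hp] := Hc h => //.
  move=> e e0; have e2 : 0 < e ^+ 2 / 4 by rewrite divr_gt0// exprn_gt0.
  have [N hN] := small _ e2; exists N => m n /hN mN /hN nN.
  rewrite -(@ltr_pXn2r _ 2)// ?nnegrE ?hnorm_ge0 ?ltW//.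
  apply: le_lt_trans (par _ _) _.
  by move: mN nN; move: (m.+1%:R^-1) (n.+1%:R^-1) => a b; lra.
exists p => //; apply: (nearest_orthogonal Hlin HE Eg Hp) => f Hf.
apply: le_trans (dmin _ Hf).
have Ep := HE _ Hp.
have d0 : 0 <= d by apply: lb_le_inf => [|_ [k Hk <-]]; [case: Di|exact: sqr_ge0].
have dp : hnorm ip (g - p) <= Num.sqrt d.
  apply/ler_addgt0Pr => e e0.
  have [N hN] := hp (e / 2) (divr_gt0 e0 (ltr0Sn _ 1)).
  have [|M hM] := small (e ^+ 2 / 4); first by rewrite divr_gt0// exprn_gt0.
  pose n := maxn N M; have := hN n (leq_maxl _ _); have := hM n (leq_maxr _ _).
  move=> nM nN; apply: le_trans (ler_hdist Elin ipE Eg (Eh n) Ep) _.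
  have -> : Num.sqrt d + e = (Num.sqrt d + e / 2) + e / 2 by field.
  apply: lerD (ltW nN); apply: ler_hnorm_sqr.
    by rewrite addr_ge0 ?sqrtr_ge0// divr_ge0// ltW.
  apply/ltW/(lt_trans (hd n)); rewrite sqrrD sqr_sqrtr//.
  have : 0 <= Num.sqrt d * (e / 2) by rewrite mulr_ge0 ?sqrtr_ge0// divr_ge0// ltW.
  by move: nM; move: (n.+1%:R^-1) => a; rewrite exprMn; lra.
by rewrite -[leRHS]sqr_sqrtr// ler_pXn2r// nnegrE ?hnorm_ge0 ?sqrtr_ge0.
Qed.

(** ** The operator induced on a subspace *)

Section Induced.
Context (H : set V) (Hlin : linear_subset H) (HE : H `<=` E).
Context (Hc : complete_subset H).
Context (L : V -> V) (LE : forall f, H f -> E (L f)).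

Lemma induced_operator_exists : exists T, induced_operator ip H L T.
Proof.
have /choice[T TP] : forall f, exists p, H f ->
    H p /\ forall g, H g -> ip p g = ip (L f) g.
  move=> f; have [Hf|nHf] := pselect (H f); last by exists 0.
  by have [p Hp pf] := projection_exists Hlin HE Hc (LE Hf); exists p.
by exists T; split=> [f /TP[]//|f g /TP[_]]; exact.
Qed.

Lemma hnorm_projection p g : H p -> E g ->
  (forall h, H h -> ip p h = ip g h) -> hnorm ip p <= hnorm ip g.
Proof.
move=> Hp Eg pg; have Ep := HE Hp.
have := cauchy_schwarz Elin ipE Eg Ep; rewrite -pg// (ip_hnorm ipE)// sqmod_real.
have := hnorm_ge0 ip p; rewrite le_eqVlt => /predU1P[<- _|p0].
  exact: hnorm_ge0.
rewrite expr2 ler_pM2r ?exprn_gt0// => pg2.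
by apply: ler_hnorm_sqr pg2; exact: hnorm_ge0.
Qed.

Context (T : V -> V) (TL : induced_operator ip H L T).

Lemma hnorm_induced f : H f -> hnorm ip (T f) <= hnorm ip (L f).
Proof.
have [TH TLip] := TL => Hf; apply: hnorm_projection; [exact: TH|exact: LE|].
by move=> h; exact: TLip.
Qed.

(** [T f] is the projection of [L f], so the projection of a limit of [L h_n] is a limit
    of [T h_n]; linearity up to [heq] follows from the same estimate. *)
Lemma compact_induced : compact_operator ip H E L -> compact_operator ip H H T.
Proof.
move=> [[_ Llin] Lcpt]; have [TH TLip] := TL; split.
  split=> // a f g Hf Hg; have Hfg : H (a *: f + g) by case: Hlin => _; exact.
  have Hr : H (T (a *: f + g) - (a *: T f + T g)).
    by apply: linear_subsetB => //; [exact: TH|case: Hlin => _; apply; exact: TH].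
  have EL h : H h -> E (L h) by exact: LE.
  have ET h : H h -> E (T h) by move=> Hh; exact/HE/TH.
  have Er : E (L (a *: f + g) - (a *: L f + L g)).
    by apply: EB; [exact: EL|case: Elin => _; apply; exact: EL].
  apply/eqP; rewrite eq_le hnorm_ge0 andbT -(Llin a f g Hf Hg).
  apply: hnorm_projection => // h Hh; have Eh := HE Hh.
  have [ETf ETg ETfg] := And3 (ET _ Hf) (ET _ Hg) (ET _ Hfg).
  have [ELf ELg ELfg] := And3 (EL _ Hf) (EL _ Hg) (EL _ Hfg).
  have [aT aL] := (EZ a ETf, EZ a ELf).
  have [sT sL] := (ED aT ETg, ED aL ELg).
  rewrite !(ipBl Elin ipE)// !(ipDl ipE)// !(ipZl Elin ipE)//.
  by rewrite !TLip.
move=> h Hh hb; have [k [kmono [g Eg kg]]] := Lcpt h Hh hb.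
exists k; split => //; have [p Hp pg] := projection_exists Hlin HE Hc Eg.
exists p => //; apply: squeeze_cvgr (cvg_cst 0) kg.
apply: nearW => n; rewrite hnorm_ge0/=.
apply: hnorm_projection; [exact: linear_subsetB (TH _ _) _|exact: EB (LE _) _|].
move=> f Hf; have Ef := HE Hf.
rewrite !(ipBl Elin ipE)//; [|exact: LE|exact/HE/TH|exact: HE].
by rewrite TLip// pg.
Qed.

End Induced.

End Projection.

(** * Integration of complex functions *)

Section ComplexMeasurable.
Context d (T : measurableType d) (R : realType).
Implicit Types (f g : T -> R[i]) (D : set T).

Lemma cmeasurable_cst D (c : R[i]) : cmeasurable D (fun=> c : R[i]).
Proof. by split; exact: measurable_cst. Qed.

Lemma cmeasurableD D f g : cmeasurable D f -> cmeasurable D g ->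
  cmeasurable D (fun x => f x + g x).
Proof.
move=> [f1 f2] [g1 g2]; split.
  rewrite [X in measurable_fun _ X](_ : _ = (fun x => complex.Re (f x) + complex.Re (g x))).
    exact: measurable_funD.
  by apply/funext => x; case: (f x) (g x) => ? ? [].
rewrite [X in measurable_fun _ X](_ : _ = (fun x => complex.Im (f x) + complex.Im (g x))).
  exact: measurable_funD.
by apply/funext => x; case: (f x) (g x) => ? ? [].
Qed.

Lemma cmeasurableM D f g : cmeasurable D f -> cmeasurable D g ->
  cmeasurable D (fun x => f x * g x).
Proof.
move=> [f1 f2] [g1 g2]; split.
  rewrite [X in measurable_fun _ X](_ : _ = (fun x =>
    complex.Re (f x) * complex.Re (g x) - complex.Im (f x) * complex.Im (g x))).
    by apply: measurable_funB; exact: measurable_funM.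
  by apply/funext => x; case: (f x) (g x) => ? ? [].
rewrite [X in measurable_fun _ X](_ : _ = (fun x =>
  complex.Re (f x) * complex.Im (g x) + complex.Im (f x) * complex.Re (g x))).
  by apply: measurable_funD; exact: measurable_funM.
by apply/funext => x; case: (f x) (g x) => ? ? [].
Qed.

Lemma cmeasurableJ D f : cmeasurable D f -> cmeasurable D (fun x => (f x)^*%C).
Proof.
move=> [f1 f2]; split.
  rewrite [X in measurable_fun _ X](_ : _ = (fun x => complex.Re (f x)))//.
  by apply/funext => x; case: (f x).
rewrite [X in measurable_fun _ X](_ : _ = (fun x => - complex.Im (f x))).
  exact: measurable_funN.
by apply/funext => x; case: (f x).
Qed.

Lemma cmeasurable_real D (f : T -> R) : measurable_fun D f ->
  cmeasurable D (fun x => (f x)%:C).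
Proof. by move=> mf; split => //=; exact: measurable_cst. Qed.

Lemma cmeasurable_comp d' (T' : measurableType d') (f : T -> R[i]) (h : T' -> T) :
  cmeasurable setT f -> measurable_fun setT h -> cmeasurable setT (f \o h).
Proof.
move=> [f1 f2] mh; split.
  exact: (measurableT_comp (f := fun x => complex.Re (f x))).
exact: (measurableT_comp (f := fun x => complex.Im (f x))).
Qed.

Lemma measurable_sqmod D f : cmeasurable D f ->
  measurable_fun D (fun x => sqmod (f x)).
Proof.
by move=> [f1 f2]; apply: measurable_funD; exact: measurable_funX.
Qed.

Lemma measurable_modulus D f : cmeasurable D f ->
  measurable_fun D (fun x => modulus (f x)).
Proof.
move=> mf; rewrite [X in measurable_fun _ X](_ : _ =
    (fun x => sqmod (f x) `^ 2^-1)).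
  apply: (measurableT_comp (f := fun x : R => x `^ 2^-1)); last exact: measurable_sqmod.
  exact: measurable_powR.
by apply/funext => x; rewrite modulusE powR12_sqrt// sqmod_ge0.
Qed.

End ComplexMeasurable.

Section ModulusTheory.
Context (R : realType).
Implicit Types z w : R[i].

Lemma modulus_ge0 z : 0 <= modulus z.
Proof. by rewrite modulusE sqrtr_ge0. Qed.

Lemma modulusM z w : modulus (z * w) = modulus z * modulus w.
Proof. by rewrite !modulusE sqmodM sqrtrM// sqmod_ge0. Qed.

Lemma modulusJ z : modulus z^*%C = modulus z.
Proof. by rewrite !modulusE sqmodJ. Qed.

Lemma modulus0 : modulus (0 : R[i]) = 0.
Proof. by rewrite modulusE sqmod0 sqrtr0. Qed.

Lemma modulus_real (a : R) : modulus a%:C = `|a|.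
Proof. by rewrite modulusE sqmod_real sqrtr_sqr. Qed.

Lemma ler_modulusD z w : modulus (z + w) <= modulus z + modulus w.
Proof. exact: le_normcD. Qed.

Lemma ler_Re_modulus z : `|complex.Re z| <= modulus z.
Proof.
rewrite -(@ler_pXn2r _ 2)// ?nnegrE ?modulus_ge0// modulus_sqr.
by rewrite real_normK ?num_real// lerDl sqr_ge0.
Qed.

Lemma ler_Im_modulus z : `|complex.Im z| <= modulus z.
Proof.
rewrite -(@ler_pXn2r _ 2)// ?nnegrE ?modulus_ge0// modulus_sqr.
by rewrite real_normK ?num_real// lerDr sqr_ge0.
Qed.

Lemma modulusM_le z w : modulus (z * w) <= sqmod z + sqmod w.
Proof.
rewrite modulusM -!modulus_sqr.
by have := sqr_ge0 (modulus z - modulus w); have := sqr_ge0 (modulus z + modulus w); lra.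
Qed.

Lemma sqmod_le z (x : R) : 0 <= x -> sqmod z <= x ^+ 2 -> modulus z <= x.
Proof. by move=> x0; rewrite -modulus_sqr ler_pXn2r// nnegrE modulus_ge0. Qed.

End ModulusTheory.

Section ComplexIntegral.
Context d (T : measurableType d) (R : realType) (m : {measure set T -> \bar R}).
Implicit Types (f g : T -> R[i]).

Definition cintegrable f :=
  cmeasurable setT f /\ (\int[m]_x (modulus (f x))%:E < +oo)%E.

Lemma cintegrable_modulus f : cintegrable f ->
  m.-integrable setT (fun x => (modulus (f x))%:E).
Proof.
move=> [mf foo]; apply/integrableP; split.
  by apply/measurable_EFinP; exact: measurable_modulus.
rewrite (eq_integral (fun x => (modulus (f x))%:E))// => x _.
by rewrite gee0_abs// lee_fin modulus_ge0.
Qed.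

Lemma cintegrable_Re f : cintegrable f ->
  m.-integrable setT (EFin \o (fun x => complex.Re (f x))).
Proof.
move=> fi; have [[mf _] _] := fi.
apply: le_integrable (cintegrable_modulus fi) => //; first exact/measurable_EFinP.
by move=> x _ /=; rewrite lee_fin (le_trans (ler_Re_modulus _))// ler_norm.
Qed.

Lemma cintegrable_Im f : cintegrable f ->
  m.-integrable setT (EFin \o (fun x => complex.Im (f x))).
Proof.
move=> fi; have [[_ mf] _] := fi.
apply: le_integrable (cintegrable_modulus fi) => //; first exact/measurable_EFinP.
by move=> x _ /=; rewrite lee_fin (le_trans (ler_Im_modulus _))// ler_norm.
Qed.

Lemma cintegrable_le f (h : T -> R) : cmeasurable setT f ->
  (forall x, modulus (f x) <= h x) -> measurable_fun setT h ->
  (\int[m]_x (h x)%:E < +oo)%E -> cintegrable f.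
Proof.
move=> mf fh mh hoo; split=> //; apply: le_lt_trans hoo.
apply: ge0_le_integral => //.
- by move=> x _; rewrite lee_fin modulus_ge0.
- by apply/measurable_EFinP; exact: measurable_modulus.
- exact/measurable_EFinP.
- by move=> x _; rewrite lee_fin.
Qed.

Lemma cintegrable_lin (a : R[i]) f g : cintegrable f -> cintegrable g ->
  cintegrable (fun x => a * f x + g x).
Proof.
move=> fi gi; have [mf foo] := fi; have [mg goo] := gi.
apply: (@cintegrable_le _ (fun x => modulus a * modulus (f x) + modulus (g x))).
- by apply: cmeasurableD => //; apply: cmeasurableM => //; exact: cmeasurable_cst.
- by move=> x; rewrite (le_trans (ler_modulusD _ _))// modulusM.
- apply: measurable_funD; last exact: measurable_modulus.
  by apply: measurable_funM => //; exact: measurable_modulus.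
under eq_integral do rewrite EFinD EFinM.
have mm (h : T -> R[i]) : cmeasurable setT h -> measurable_fun setT (fun x => (modulus (h x))%:E).
  by move=> mh; apply/measurable_EFinP; exact: measurable_modulus.
have m0 z : (0 <= (modulus z)%:E :> \bar R)%E by rewrite lee_fin modulus_ge0.
rewrite ge0_integralD//; [|by move=> x _; exact: mule_ge0
  |exact: measurable_funeM (mm _ mf)|exact: mm].
rewrite ge0_integralZl//; last exact: mm.
by rewrite lte_add_pinfty// lte_mul_pinfty.
Qed.

Lemma cintegral_lin (a : R[i]) f g : cintegrable f -> cintegrable g ->
  cintegral m setT (fun x => a * f x + g x) =
  a * cintegral m setT f + cintegral m setT g.
Proof.
move=> fi gi; have [fr fI] := (cintegrable_Re fi, cintegrable_Im fi).
have [gr gI] := (cintegrable_Re gi, cintegrable_Im gi).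
have Z (b : R) (h : T -> R) : m.-integrable setT (EFin \o h) ->
    m.-integrable setT (EFin \o (fun x => b * h x)).
  move=> hi; rewrite (_ : EFin \o _ = (fun x => b%:E * (h x)%:E)%E); last first.
    by apply/funext => x /=; rewrite EFinM.
  exact: integrableZl.
have N (h k : T -> R) : m.-integrable setT (EFin \o h) ->
    m.-integrable setT (EFin \o k) -> m.-integrable setT (EFin \o (fun x => h x + k x)).
  move=> hi ki; rewrite (_ : EFin \o _ = ((EFin \o h) \+ (EFin \o k))%E)//.
  exact: integrableD.
case: a => a b; rewrite /cintegral; apply/eqP; rewrite eq_complex /=; apply/andP; split.
- rewrite [X in _ == X](_ : _ = \int[m]_x (a * complex.Re (f x)) +
    \int[m]_x (- b * complex.Im (f x)) + \int[m]_x complex.Re (g x)); last first.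
    by rewrite !RintegralZl// mulNr.
  have [i1 i2] := (Z a _ fr, Z (- b) _ fI); have i3 := N _ _ i1 i2.
  rewrite -RintegralD// -RintegralD//.
  by apply/eqP/eq_Rintegral => x _; case: (f x) (g x) => ? ? [? ?] /=; rewrite mulNr.
- rewrite [X in _ == X](_ : _ = \int[m]_x (a * complex.Im (f x)) +
    \int[m]_x (b * complex.Re (f x)) + \int[m]_x complex.Im (g x)); last first.
    by rewrite !RintegralZl.
  have [i1 i2] := (Z a _ fI, Z b _ fr); have i3 := N _ _ i1 i2.
  rewrite -RintegralD// -RintegralD//.
  by apply/eqP/eq_Rintegral => x _; case: (f x) (g x) => ? ? [? ?] /=.
Qed.

Lemma eq_cintegral D f g : (forall x, D x -> f x = g x) ->
  cintegral m D f = cintegral m D g.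
Proof.
by move=> fg; rewrite /cintegral; congr (_ +i* _); apply: eq_Rintegral => x;
  rewrite inE => /fg ->.
Qed.

Lemma cintegral0 : cintegral m setT (fun=> 0 : R[i]) = 0.
Proof. by rewrite /cintegral /Rintegral /= !integral0. Qed.

Lemma cintegrable0 : cintegrable (fun=> 0).
Proof.
split; first exact: cmeasurable_cst.
by rewrite integral0_eq// => x _; rewrite modulus0.
Qed.

Lemma cintegralZ (a : R[i]) f : cintegrable f ->
  cintegral m setT (fun x => a * f x) = a * cintegral m setT f.
Proof.
move=> fi; have := cintegral_lin a fi cintegrable0.
rewrite cintegral0 addr0 => <-; apply: eq_cintegral => x _.
by rewrite addr0.
Qed.

Lemma cintegralJ f : cintegrable f ->
  cintegral m setT (fun x => (f x)^*%C) = (cintegral m setT f)^*%C.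
Proof.
move=> fi; rewrite /cintegral /=; congr (_ +i* _).
  by apply: eq_Rintegral => x _; case: (f x).
rewrite -mulN1r -RintegralZl//; last exact: cintegrable_Im.
by apply: eq_Rintegral => x _; rewrite mulN1r; case: (f x).
Qed.

(** Rotate the integral to the positive real axis by the conjugate of its phase. *)
Lemma modulus_cintegral_le f : cintegrable f ->
  ((modulus (cintegral m setT f))%:E <= \int[m]_x (modulus (f x))%:E)%E.
Proof.
move=> fi; set w := cintegral m setT f.
have mi := cintegrable_modulus fi.
have Ifin : (\int[m]_x (modulus (f x))%:E)%E \is a fin_num by exact: integrable_fin_num.
rewrite -(fineK Ifin) lee_fin.
have := modulus_ge0 w; rewrite le_eqVlt => /predU1P[<-|w0].
  by rewrite fine_ge0// integral_ge0// => x _; rewrite lee_fin modulus_ge0.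
rewrite -(ler_pM2l w0) -expr2 modulus_sqr.
have Ci : cintegrable (fun x => w^*%C * f x).
  have := cintegrable_lin w^*%C fi cintegrable0.
  by under eq_fun do rewrite addr0.
have -> : sqmod w = \int[m]_x complex.Re (w^*%C * f x).
  transitivity (complex.Re (w^*%C * w)); first by rewrite mulrC -sqmodE.
  by rewrite /w -cintegralZ.
rewrite -RintegralZl//; apply: le_Rintegral => //.
- exact: cintegrable_Re.
- rewrite (_ : EFin \o _ = fun x => ((modulus w)%:E * (modulus (f x))%:E)%E).
    exact: integrableZl.
  by apply/funext => x; rewrite /= EFinM.
move=> x _; rewrite -(modulusJ w) -modulusM.
exact: le_trans (ler_norm _) (ler_Re_modulus _).
Qed.

End ComplexIntegral.

(** * The space of square-integrable functions *)

Section SquareIntegrable.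
Context d (T : measurableType d) (R : realType) (m : {measure set T -> \bar R}).
Implicit Types (f g h : T -> R[i]).

Local Notation L2 := (Lp m setT 2 : set (T -> R[i])).

Lemma poweR_lty (x : \bar R) (r : R) : 0 < r -> (0 <= x)%E ->
  (x `^ r < +oo)%E = (x < +oo)%E.
Proof.
move=> r0; case: x => [x| |]//= x0; last by rewrite gt_eqF.
by rewrite !ltry.
Qed.

Lemma Lp1P f (D : set T) : Lp_norm m D 1 f = (\int[m]_(x in D) (modulus (f x))%:E)%E.
Proof.
rewrite /Lp_norm invr1 poweRe1; last first.
  by apply: integral_ge0 => x _; rewrite lee_fin powR_ge0.
by apply: eq_integral => x _; rewrite powRr1// modulus_ge0.
Qed.

Lemma Lp_norm2 f :
  Lp_norm m setT 2 f = ((\int[m]_x (sqmod (f x))%:E) `^ 2^-1)%E.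
Proof.
congr (_ `^ _)%E; apply: eq_integral => x _.
by rewrite -/(2%:R) powR_mulrn ?modulus_ge0// modulus_sqr.
Qed.

Lemma integral_sqmod_ge0 f : (0 <= \int[m]_x (sqmod (f x))%:E)%E.
Proof. by apply: integral_ge0 => x _; rewrite lee_fin sqmod_ge0. Qed.

Lemma L2P f : L2 f <->
  cmeasurable setT f /\ (\int[m]_x (sqmod (f x))%:E < +oo)%E.
Proof.
rewrite /Lp/= Lp_norm2 poweR_lty//; exact: integral_sqmod_ge0.
Qed.

Lemma measurable_sqmodE f (D : set T) : cmeasurable D f ->
  measurable_fun D (fun x => (sqmod (f x))%:E).
Proof. by move=> mf; apply/measurable_EFinP; exact: measurable_sqmod. Qed.

Lemma L2_le f (h : T -> R) : cmeasurable setT f ->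
  (forall x, sqmod (f x) <= h x) -> measurable_fun setT h ->
  (\int[m]_x (h x)%:E < +oo)%E -> L2 f.
Proof.
move=> mf fh mh hoo; apply/L2P; split=> //; apply: le_lt_trans hoo.
apply: ge0_le_integral => //.
- by move=> x _; rewrite lee_fin sqmod_ge0.
- exact: measurable_sqmodE.
- exact/measurable_EFinP.
- by move=> x _; rewrite lee_fin.
Qed.

Lemma integral_sqmod_lin (a b : R) f g : 0 <= a -> 0 <= b ->
  cmeasurable setT f -> cmeasurable setT g ->
  (\int[m]_x (a * sqmod (f x) + b * sqmod (g x))%:E =
   a%:E * \int[m]_x (sqmod (f x))%:E + b%:E * \int[m]_x (sqmod (g x))%:E)%E.
Proof.
move=> a0 b0 mf mg; under eq_integral do rewrite EFinD !EFinM.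
have s0 z : (0 <= (sqmod z)%:E :> \bar R)%E by rewrite lee_fin sqmod_ge0.
rewrite ge0_integralD//.
- by rewrite !ge0_integralZl//; exact: measurable_sqmodE.
- by move=> x _; rewrite mule_ge0.
- exact: measurable_funeM (measurable_sqmodE _).
- by move=> x _; rewrite mule_ge0.
- exact: measurable_funeM (measurable_sqmodE _).
Qed.

Lemma linear_L2 : linear_subset L2.
Proof.
split.
  apply/L2P; split; first exact: cmeasurable_cst.
  by rewrite integral0_eq// => x _; rewrite sqmod0.
move=> a f g /L2P[mf foo] /L2P[mg goo].
have maf : cmeasurable setT (fun x => a * f x).
  by apply: cmeasurableM => //; exact: cmeasurable_cst.
apply: (@L2_le _ (fun x => 2 * sqmod a * sqmod (f x) + 2 * sqmod (g x))).
- exact: cmeasurableD maf mg.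
- by move=> x; rewrite (le_trans (sqmodD _ _))// sqmodM mulrA.
- by apply: measurable_funD; apply: measurable_funM => //; exact: measurable_sqmod.
rewrite integral_sqmod_lin ?mulr_ge0 ?sqmod_ge0//.
by rewrite lte_add_pinfty// lte_mul_pinfty// lee_fin ?mulr_ge0 ?sqmod_ge0.
Qed.

Lemma L2_mul f g : L2 f -> L2 g -> cintegrable m (fun x => f x * (g x)^*%C).
Proof.
move=> /L2P[mf foo] /L2P[mg goo].
apply: (@cintegrable_le _ _ _ _ _ (fun x => 1 * sqmod (f x) + 1 * sqmod (g x))).
- by apply: cmeasurableM => //; exact: cmeasurableJ.
- by move=> x; rewrite !mul1r (le_trans (modulusM_le _ _))// sqmodJ.
- by apply: measurable_funD; apply: measurable_funM => //; exact: measurable_sqmod.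
by rewrite integral_sqmod_lin// !mul1e lte_add_pinfty.
Qed.

Lemma innerE f g : inner m f g = cintegral m setT (fun x => f x * (g x)^*%C).
Proof. by []. Qed.

Lemma inner_self f : complex.Re (inner m f f) = \int[m]_x sqmod (f x).
Proof. by apply: eq_Rintegral => x _; rewrite -sqmodE. Qed.

Lemma semi_inner_product_L2 : semi_inner_product (inner m) L2.
Proof.
split.
- move=> a f g h L2f L2g L2h; rewrite !innerE -cintegral_lin; try exact: L2_mul.
  by apply: eq_cintegral => x _; rewrite mulrA -mulrDl.
- move=> f g L2f L2g; rewrite !innerE -cintegralJ; last exact: L2_mul.
  by apply: eq_cintegral => x _; rewrite conjcM conjcK mulrC.
- move=> f L2f; rewrite lecE inner_self Rintegral_ge0 ?andbT; last first.
    by move=> x _; exact: sqmod_ge0.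
  apply/eqP; rewrite /= (@eq_Rintegral _ _ _ m setT (fun=> 0)) => [|x _].
    by rewrite /Rintegral integral0.
  by rewrite -sqmodE.
Qed.

Lemma hnorm_L2 f : L2 f ->
  ((hnorm (inner m) f ^+ 2)%:E = \int[m]_x (sqmod (f x))%:E)%E.
Proof.
move=> L2f; rewrite (hnorm_sqr semi_inner_product_L2)// inner_self fineK//.
rewrite ge0_fin_numE; last exact: integral_sqmod_ge0.
by case/L2P: L2f.
Qed.

Lemma hnorm_L2_le f (c : R) : L2 f -> 0 <= c ->
  (\int[m]_x (sqmod (f x))%:E <= (c ^+ 2)%:E)%E -> hnorm (inner m) f <= c.
Proof.
by move=> L2f c0; rewrite -hnorm_L2// lee_fin; exact: ler_hnorm_sqr.
Qed.

Lemma heq_ae f g : L2 f -> L2 g -> {ae m, forall x, f x = g x} ->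
  heq (inner m) f g.
Proof.
move=> L2f L2g fg; have L2fg : L2 (f - g) by exact: linear_subsetB linear_L2 L2f L2g.
apply/eqP; rewrite -sqrf_eq0; apply/eqP/EFin_inj; rewrite hnorm_L2//.
rewrite (ge0_ae_eq_integral (g := cst 0%E))//; first by rewrite integral0.
- by case/L2P : L2fg => + _; exact: measurable_sqmodE.
- by move=> x _; rewrite lee_fin sqmod_ge0.
- by apply: filterS fg => x fgx _ /=; rewrite !fctE fgx subrr sqmod0.
Qed.

End SquareIntegrable.

Section Completeness.
Context d (T : measurableType d) (R : realType) (m : {measure set T -> \bar R}).

Local Notation L2 := (Lp m setT 2 : set (T -> R[i])).
Local Notation norm := (hnorm (inner m)).

Lemma sum_half_le n : \sum_(k < n) (2^-1 : R) ^+ k <= 2.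
Proof.
suff : \sum_(k < n) (2^-1 : R) ^+ k = 2 - 2 * 2^-1 ^+ n.
  by move=> ->; rewrite lerBlDr lerDl mulr_ge0// exprn_ge0.
elim: n => [|n ih]; first by rewrite big_ord0 expr0; lra.
by rewrite big_ord_recr/= ih exprS; lra.
Qed.

Lemma is_cvg_geometric_bound (u : nat -> R) (M : R) :
  (forall k, `|u k.+1 - u k| <= M * 2^-1 ^+ k) -> cvgn u.
Proof.
move=> uM; have -> : u = (fun n => u 0%N + series (telescope u) n).
  by apply/funext => n; exact: eq_sum_telescope.
apply: is_cvgD; first exact: is_cvg_cst.
apply: normed_cvg; apply: (@series_le_cvg _ _ (geometric M 2^-1)) => [k|k|k|].
- exact: normr_ge0.
- exact: le_trans (normr_ge0 _) (uM k).
- exact: uM.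
by apply: is_cvg_geometric_series; rewrite ger0_norm// invf_lt1// ltr1n.
Qed.

(** Riesz-Fischer. The limit is taken pointwise where the fast subsequence
    converges absolutely and is zero elsewhere, so that every equality
    [f x = f y] satisfied by all the terms passes to it: this is how invariance
    at every point survives. *)
Lemma L2_complete (h : nat -> T -> R[i]) : (forall n, L2 (h n)) ->
  (forall e : R, 0 < e -> exists N, forall p n, (N <= p)%N -> (N <= n)%N ->
    norm (h p - h n) < e) ->
  exists g, [/\ L2 g, forall x y, (forall n, h n x = h n y) -> g x = g y &
    forall e : R, 0 < e -> exists N, forall n, (N <= n)%N -> norm (h n - g) < e].
Proof.
move=> L2h hC; have [lin ip] := (linear_L2 m, semi_inner_product_L2 m).
have /choice[N NP] : forall k, exists N, forall p n, (N <= p)%N -> (N <= n)%N ->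
    norm (h p - h n) < 4^-1 ^+ k.
  by move=> k; apply: hC; rewrite exprn_gt0.
pose n k := (\sum_(j < k.+1) N j)%N.
have nS k : (n k <= n k.+1)%N by rewrite /n [X in (_ <= X)%N]big_ord_recr leq_addr.
have nN k : (N k <= n k)%N by rewrite /n big_ord_recr leq_addl.
have nmono k j : (k <= j)%N -> (n k <= n j)%N.
  by move=> /subnK <-; elim: (j - k)%N => // i /leq_trans; apply; exact: nS.
pose s k := h (n k); have L2s k : L2 (s k) by exact: L2h.
have ms k : cmeasurable setT (s k) by case/L2P: (L2s k).
have L2B f g : L2 f -> L2 g -> L2 (f - g) by exact: linear_subsetB lin.
have sk k j : (k <= j)%N -> (\int[m]_x (sqmod (s j x - s k x))%:E <= (4^-1 ^+ k * 4^-1 ^+ k)%:E)%E.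
  move=> kj; rewrite -[X in (X <= _)%E]/(\int[m]_x (sqmod ((s j - s k) x))%:E)%E.
  rewrite -hnorm_L2; last exact: L2B.
  rewrite lee_fin -expr2 ler_pXn2r ?nnegrE ?hnorm_ge0 ?exprn_ge0//.
  by apply/ltW/NP => //; rewrite (leq_trans (nN k))// nmono.
pose D k x := s k.+1 x - s k x.
have mD k : cmeasurable setT (D k).
  have := L2B _ _ (L2s k.+1) (L2s k); by case/L2P.
pose F x := (\sum_(k <oo) (4 ^+ k * sqmod (D k x))%:E)%E.
have F0 k x : (0 <= (4 ^+ k * sqmod (D k x))%:E :> \bar R)%E.
  by rewrite lee_fin mulr_ge0 ?sqmod_ge0 ?exprn_ge0.
have mF : measurable_fun setT F.
  apply: ge0_emeasurable_sum => // k _; apply/measurable_EFinP.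
  by apply: measurable_funM => //; exact: measurable_sqmod.
have iF : (\int[m]_x F x <= 2%:E)%E.
  rewrite /F integral_nneseries//; last first.
    move=> k; apply/measurable_EFinP.
    by apply: measurable_funM => //; exact: measurable_sqmod.
  apply: lime_le.
    by apply: is_cvg_nneseries => k _ _; exact: integral_ge0.
  apply: nearW => j; rewrite big_mkord.
  apply: (@le_trans _ _ (\sum_(k < j) (2^-1 ^+ k)%:E)%E); last first.
    by rewrite sumEFin lee_fin sum_half_le.
  apply: lee_sum => k _; under eq_integral do rewrite EFinM.
  rewrite ge0_integralZl//; [|exact: measurable_sqmodE
    |by move=> x _; rewrite lee_fin sqmod_ge0].
  apply: (@le_trans _ _ ((4 ^+ k)%:E * (4^-1 ^+ k * 4^-1 ^+ k)%:E)%E).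
    by rewrite lee_wpmul2l// ?lee_fin ?exprn_ge0// sk.
  rewrite -EFinM lee_fin mulrA -exprMn divff// expr1n mul1r.
  by apply: lerXn2r; rewrite ?nnegrE// lef_pV2 ?posrE// ler_nat.
pose A := [set x | (F x < +oo)%E].
have mA : measurable A.
  by rewrite -[A]setTI; exact: emeasurable_fun_infty_o.
have aeA : {ae m, forall x, A x}.
  have Fi : m.-integrable setT F.
    apply/integrableP; split=> //.
    rewrite (eq_integral F); first by apply: le_lt_trans iF _; exact: ltry.
    by move=> x _; rewrite gee0_abs//; exact: nneseries_ge0.
  apply: filterS (integrable_ae measurableT Fi) => x /(_ Logic.I) Fx.
  by rewrite /A/= -ge0_fin_numE//; exact: nneseries_ge0.
have cvgA x : A x -> cvgn (fun k => complex.Re (s k x)) /\ cvgn (fun k => complex.Im (s k x)).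
  move=> Ax; pose M := fine (F x).
  have Fx0 : (0 <= F x)%E by exact: nneseries_ge0.
  have DM k : modulus (s k.+1 x - s k x) <= Num.sqrt M * 2^-1 ^+ k.
    apply: sqmod_le; first by rewrite mulr_ge0 ?sqrtr_ge0 ?exprn_ge0.
    rewrite exprMn sqr_sqrtr ?fine_ge0// exprAC.
    have -> : (2^-1 ^+ 2 : R) = 4^-1 by rewrite exprVn -natrX.
    rewrite exprVn ler_pdivlMr ?exprn_gt0// mulrC -lee_fin fineK ?ge0_fin_numE//.
    apply: le_trans (nneseries_lim_ge k.+1 _); last by move=> *; exact: F0.
    by rewrite big_mkord big_ord_recr/= leeDr// sume_ge0.
  split; apply: (@is_cvg_geometric_bound _ (Num.sqrt M)) => k; apply: le_trans (DM k).
    apply: le_trans (ler_Re_modulus _); case: (s k.+1 x) (s k x) => a b [c e] /=.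
    exact: lexx.
  apply: le_trans (ler_Im_modulus _); case: (s k.+1 x) (s k x) => a b [c e] /=.
  exact: lexx.
pose t k x : R[i] := if `[< A x >] then s k x else 0.
pose g x : R[i] := if `[< A x >] then
  limn (fun k => complex.Re (s k x)) +i* limn (fun k => complex.Im (s k x)) else 0.
have tg x : (fun k => complex.Re (t k x)) @ \oo --> complex.Re (g x) /\
            (fun k => complex.Im (t k x)) @ \oo --> complex.Im (g x).
  rewrite /t /g; case: asboolP => [/cvgA//|_]; split; exact: cvg_cst.
have mt k : cmeasurable setT (t k).
  have -> : t k = (fun x => (\1_A x)%:C * s k x).
    apply/funext => x; rewrite /t indicE.
    by case: asboolP => Ax; [rewrite mem_set//= mul1r|rewrite memNset//= mul0r].
  apply: cmeasurableM => //; apply: cmeasurable_real; exact: measurable_indic.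
have mg : cmeasurable setT g.
  split; [apply: (@measurable_fun_cvg _ _ _ _ (fun k x => complex.Re (t k x)))
         |apply: (@measurable_fun_cvg _ _ _ _ (fun k x => complex.Im (t k x)))];
  [by move=> k; case: (mt k)|by move=> x _; case: (tg x)
  |by move=> k; case: (mt k)|by move=> x _; case: (tg x)].
have mB f f' : cmeasurable setT f -> cmeasurable setT f' ->
    cmeasurable setT (fun x => f x - f' x :> R[i]).
  move=> mf mf'; have := cmeasurableD mf (cmeasurableM (cmeasurable_cst setT (-1)) mf').
  by under eq_fun do rewrite mulN1r.
have gs k : (\int[m]_x (sqmod (g x - s k x))%:E <= (4^-1 ^+ k * 4^-1 ^+ k)%:E)%E.
  pose f j x := (sqmod (t (j + k)%N x - t k x))%:E.
  have lf x : limn_einf (f^~ x) = (sqmod (g x - t k x))%:E.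
    apply: (cvg_limn_einf_sup _).1; apply: cvg_EFin; first exact: nearW.
    have [tr ti] := tg x.
    have -> : fine \o f^~ x = (fun j => (complex.Re (t (j + k)%N x) - complex.Re (t k x)) ^+ 2 +
        (complex.Im (t (j + k)%N x) - complex.Im (t k x)) ^+ 2).
      by apply/funext => j; rewrite /= /sqmod; case: (t (j + k)%N x) (t k x) => ? ? [].
    have -> : sqmod (g x - t k x) = (complex.Re (g x) - complex.Re (t k x)) ^+ 2 +
        (complex.Im (g x) - complex.Im (t k x)) ^+ 2.
      by rewrite /sqmod; case: (g x) (t k x) => ? ? [].
    have sh (u : nat -> R) (a b : R) : u @ \oo --> a ->
        (fun j => (u (j + k)%N - b) ^+ 2) @ \oo --> (a - b) ^+ 2.
      move=> ua; rewrite expr2; under eq_fun do rewrite expr2.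
      have ub : (fun j => u (j + k)%N - b) @ \oo --> a - b.
        by apply: cvgB; [rewrite cvg_shiftn|exact: cvg_cst].
      exact: cvgM.
    by apply: cvgD; [exact: (sh (fun j => complex.Re (t j x)))
                    |exact: (sh (fun j => complex.Im (t j x)))].
  have -> : (\int[m]_x (sqmod (g x - s k x))%:E = \int[m]_x limn_einf (f^~ x))%E.
    under [RHS]eq_integral do rewrite lf.
    apply: ge0_ae_eq_integral => //.
    - by apply: measurable_sqmodE; exact: mB.
    - by apply: measurable_sqmodE; exact: mB.
    - by move=> x _; rewrite lee_fin sqmod_ge0.
    - by move=> x _; rewrite lee_fin sqmod_ge0.
    - apply: filterS aeA => x Ax _; rewrite /t.
      by case: asboolP.
  apply: le_trans (fatou _ _ _ _) _ => //.
  - by move=> j; apply: measurable_sqmodE; exact: mB.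
  - by move=> j x _; rewrite lee_fin sqmod_ge0.
  rewrite limn_einf_lim; apply: lime_le; first exact: is_cvg_einfs.
  apply: nearW => j; apply: (@le_trans _ _ (\int[m]_x f j x)%E).
    by apply: ereal_inf_lbound; exists j => /=.
  apply: le_trans (sk k (j + k)%N (leq_addl _ _)).
  apply: ge0_le_integral => //.
  - by move=> x _; rewrite lee_fin sqmod_ge0.
  - by apply: measurable_sqmodE; exact: mB.
  - by apply: measurable_sqmodE; exact: mB.
  - move=> x _; rewrite lee_fin /t; case: asboolP => // _.
    by rewrite subrr sqmod0 sqmod_ge0.
have L2gs k : L2 (g - s k).
  apply/L2P; split; first exact: mB.
  by apply: le_lt_trans (gs k) _; exact: ltry.
have L2g : L2 g by rewrite -[g](subrK (s 0%N)); exact: linear_subsetD lin (L2gs _) (L2s _).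
exists g; split => //.
- move=> x y xy; have sxy k : s k x = s k y by exact: xy.
  pose lim_of (v : nat -> R[i]) : R[i] :=
    if `[< (\sum_(k <oo) (4 ^+ k * sqmod (v k.+1 - v k))%:E < +oo)%E >] then
    limn (fun k => complex.Re (v k)) +i* limn (fun k => complex.Im (v k)) else 0.
  rewrite -[g x]/(lim_of (s^~ x)) -[g y]/(lim_of (s^~ y)).
  by congr lim_of; apply/funext => k; exact: sxy.
move=> e e0.
have [k ke] : exists k, 4^-1 ^+ k < e / 2.
  have : (fun k => (4^-1 : R) ^+ k) @ \oo --> 0.
    by apply: cvg_expr; rewrite ger0_norm// invf_lt1// ltr1n.
  move=> /cvgrPdist_lt/(_ _ (divr_gt0 e0 (ltr0Sn R 1)))[k _ /(_ k (leqnn k))].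
  by rewrite sub0r normrN ger0_norm ?exprn_ge0// => ?; exists k.
exists (n k) => j nj; have L2hj := L2h j.
apply: le_lt_trans (ler_hdist lin ip L2hj (L2s k) L2g) _.
rewrite (splitr e); apply: ltrD.
  apply: lt_trans ke; apply: NP => //.
  exact: leq_trans (nN k) nj.
rewrite (hnorm_sym lin ip (L2s k) L2g); apply: le_lt_trans ke.
by apply: hnorm_L2_le; [exact: L2gs|rewrite exprn_ge0|rewrite expr2; exact: gs].
Qed.

End Completeness.

(** * Integral superpositions of rank-one operators *)

Section NonnegativeIntegral.
Context d (T : measurableType d) (R : realType) (m : {measure set T -> \bar R}).
Implicit Types f g : T -> \bar R.
Local Open Scope ereal_scope.

Lemma integralZ_ge0 (c : R) f : (0 <= c)%R -> measurable_fun setT f ->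
  (forall x, 0 <= f x) -> \int[m]_x (c%:E * f x) = c%:E * \int[m]_x f x.
Proof. by move=> c0 mf f0; apply: ge0_integralZl. Qed.

Lemma integralD_ge0 f g : measurable_fun setT f -> measurable_fun setT g ->
  (forall x, 0 <= f x) -> (forall x, 0 <= g x) ->
  \int[m]_x (f x + g x) = \int[m]_x f x + \int[m]_x g x.
Proof. by move=> mf mg f0 g0; apply: ge0_integralD. Qed.

Lemma le_integral_ge0 f g : measurable_fun setT f -> measurable_fun setT g ->
  (forall x, 0 <= f x) -> (forall x, f x <= g x) ->
  \int[m]_x f x <= \int[m]_x g x.
Proof. by move=> mf mg f0 fg; apply: ge0_le_integral. Qed.

End NonnegativeIntegral.

Section ParametricIntegral.
Context d d' (X : measurableType d) (Z : measurableType d') (R : realType).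

Lemma measurable_integral (m : {sigma_finite_measure set X -> \bar R})
    (f : Z * X -> \bar R) : measurable_fun setT f ->
  measurable_fun setT (fun z => \int[m]_x f (z, x))%E.
Proof.
move=> mf; rewrite (_ : (fun _ => _) = (fun z => \int[m]_x (f^\+ (z, x)) -
    \int[m]_x (f^\- (z, x)))%E); last first.
  apply/funext => z; rewrite [LHS]integralE; congr (_ - _)%E;
    by apply: eq_integral => x _; rewrite ?funeposE ?funenegE.
apply: emeasurable_funB; apply: measurable_fun_fubini_tonelli_F => //.
  exact: measurable_funepos.
exact: measurable_funeneg.
Qed.

Lemma cmeasurable_cintegral (m : {sigma_finite_measure set X -> \bar R})
    (f : Z * X -> R[i]) : cmeasurable setT f ->
  cmeasurable setT (fun z => cintegral m setT (fun x => f (z, x))).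
Proof.
move=> [f1 f2]; split.
  apply: (measurableT_comp (f := fine) (g := fun z => (\int[m]_x (complex.Re (f (z, x)))%:E)%E)).
    exact: fine_measurable.
  by apply: (@measurable_integral m (fun p => (complex.Re (f p))%:E)); exact/measurable_EFinP.
apply: (measurableT_comp (f := fine) (g := fun z => (\int[m]_x (complex.Im (f (z, x)))%:E)%E)).
  exact: fine_measurable.
by apply: (@measurable_integral m (fun p => (complex.Im (f p))%:E)); exact/measurable_EFinP.
Qed.

End ParametricIntegral.

Section WeightedCauchySchwarz.
Context d (Z : measurableType d) (R : realType) (m : {measure set Z -> \bar R}).
Context (w b : Z -> R[i]) (C : R).
Hypotheses (mw : cmeasurable setT w) (mb : cmeasurable setT b) (C0 : 0 < C).
Hypothesis wC : (\int[m]_z (modulus (w z))%:E <= C%:E)%E.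

Let B := (\int[m]_z (modulus (w z) * sqmod (b z))%:E)%E.

Let mod_w : measurable_fun setT (fun z => (modulus (w z))%:E).
Proof. by apply/measurable_EFinP; exact: measurable_modulus. Qed.

Let mod_wb : measurable_fun setT (fun z => (modulus (w z) * sqmod (b z))%:E).
Proof.
apply/measurable_EFinP; apply: measurable_funM; first exact: measurable_modulus.
exact: measurable_sqmod.
Qed.

Lemma weighted_cintegrable : (B < +oo)%E -> cintegrable m (fun z => w z * b z).
Proof.
move=> Boo; apply: (@cintegrable_le _ _ _ _ _
  (fun z => modulus (w z) + modulus (w z) * sqmod (b z))).
- exact: cmeasurableM.
- move=> z; rewrite modulusM -modulus_sqr.
  have := sqr_ge0 (modulus (b z) - 1); have := modulus_ge0 (w z).
  by have := modulus_ge0 (b z); nra.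
- by apply/measurable_EFinP; exact: emeasurable_funD mod_w mod_wb.
under eq_integral do rewrite EFinD; rewrite ge0_integralD//.
- by rewrite lte_add_pinfty// (le_lt_trans wC)// ltry.
- by move=> z _; rewrite lee_fin modulus_ge0.
- by move=> z _; rewrite lee_fin mulr_ge0 ?modulus_ge0 ?sqmod_ge0.
Qed.

(** Integrate [2 c |w b| <= |w| |b|^2 + c^2 |w|] and choose the best [c]. *)
Lemma weighted_cauchy_schwarz :
  ((sqmod (cintegral m setT (fun z => w z * b z)))%:E <= C%:E * B)%E.
Proof.
have B0 : (0 <= B)%E.
  by apply: integral_ge0 => z _; rewrite lee_fin mulr_ge0 ?modulus_ge0 ?sqmod_ge0.
have [Boo|] := ltP B +oo%E; last first.
  by rewrite leye_eq => /eqP ->; rewrite gt0_muley ?leey// lte_fin.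
have wbi := weighted_cintegrable Boo.
pose A := fine (\int[m]_z (modulus (w z * b z))%:E)%E.
have Afin : (\int[m]_z (modulus (w z * b z))%:E)%E = A%:E.
  by rewrite fineK//; exact: integrable_fin_num (cintegrable_modulus wbi).
have A0 : 0 <= A by apply/fine_ge0/integral_ge0 => z _; rewrite lee_fin modulus_ge0.
have Bfin : B = (fine B)%:E by rewrite fineK// ge0_fin_numE.
have key c : 0 <= c -> 2 * c * A <= fine B + c ^+ 2 * C.
  move=> c0; rewrite -lee_fin EFinD -Bfin !EFinM -Afin.
  apply: (@le_trans _ _ (B + (c ^+ 2)%:E * \int[m]_z (modulus (w z))%:E)%E); last first.
    by rewrite leeD2l// lee_wpmul2l// lee_fin sqr_ge0.
  have m0 z : (0 <= (modulus z)%:E :> \bar R)%E by rewrite lee_fin modulus_ge0.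
  have mod_p : measurable_fun setT (fun z => (modulus (w z * b z))%:E).
    by apply/measurable_EFinP; apply: measurable_modulus; case: wbi.
  have wb0 z : (0 <= (modulus (w z) * sqmod (b z))%:E :> \bar R)%E.
    by rewrite lee_fin mulr_ge0 ?modulus_ge0 ?sqmod_ge0.
  have mc : measurable_fun setT (fun z => (c ^+ 2)%:E * (modulus (w z))%:E)%E.
    exact: measurable_funeM.
  have c20 z : (0 <= (c ^+ 2)%:E * (modulus (w z))%:E)%E.
    by rewrite mule_ge0// lee_fin sqr_ge0.
  rewrite -EFinM -!integralZ_ge0 ?mulr_ge0 ?sqr_ge0// -integralD_ge0//.
  apply: le_integral_ge0 => [||z|z].
  - exact: measurable_funeM.
  - exact: emeasurable_funD.
  - by rewrite mule_ge0// lee_fin mulr_ge0.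
  rewrite -!EFinM -!EFinD lee_fin modulusM -modulus_sqr.
  have -> : 2 * c * (modulus (w z) * modulus (b z)) =
    modulus (w z) * (2 * (c * modulus (b z))) by ring.
  rewrite (mulrC (c ^+ 2)) -mulrDr; apply: ler_wpM2l; first exact: modulus_ge0.
  by have := sqr_ge0 (modulus (b z) - c); rewrite sqrrB; lra.
rewrite Bfin -EFinM lee_fin -modulus_sqr.
apply: (@le_trans _ _ (A ^+ 2)).
  rewrite ler_pXn2r ?nnegrE ?modulus_ge0// -lee_fin -Afin.
  exact: modulus_cintegral_le.
have := key (A / C) (divr_ge0 A0 (ltW C0)).
have -> : 2 * (A / C) * A = 2 * (A ^+ 2 / C) by ring.
have -> : (A / C) ^+ 2 * C = A ^+ 2 / C by field; rewrite gt_eqF.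
by move=> h; rewrite mulrC -ler_pdivrMr//; lra.
Qed.

End WeightedCauchySchwarz.

Section KernelIntegral.
Context d d' (X : measurableType d) (Z : measurableType d') (R : realType).
Context (mu : {sigma_finite_measure set X -> \bar R}).
Context (m : {sigma_finite_measure set Z -> \bar R}).
Context (k : Z -> X -> R[i]) (u : Z -> R[i]) (C : R).
Hypothesis mk : cmeasurable setT (fun p : Z * X => k p.1 p.2).
Hypothesis k1 : forall z, (\int[mu]_x (sqmod (k z x))%:E <= 1)%E.
Hypothesis mu_ : cmeasurable setT u.
Hypothesis C0 : 0 < C.
Hypothesis uC : (\int[m]_z (modulus (u z))%:E <= C%:E)%E.
Implicit Types (f : X -> R[i]) (a : Z -> R[i]).

Local Notation L2 := (Lp mu setT 2 : set (X -> R[i])).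
Local Notation norm := (hnorm (inner mu)).

(** The coefficients [<f, k_z>], and the function with given coefficients; their
    composite is the operator under study. *)
Definition coef f z : R[i] := inner mu f (k z).

Definition superpose a x : R[i] :=
  cintegral m setT (fun z => u z * (a z * k z x)).

Lemma kernel_L2 z : L2 (k z).
Proof.
apply/L2P; split; last by apply: le_lt_trans (k1 z) _; exact: ltry.
exact: (cmeasurable_comp mk (pair1_measurable z)).
Qed.

Lemma norm_kernel z : norm (k z) <= 1.
Proof.
apply: hnorm_L2_le => //; first exact: kernel_L2.
by rewrite expr1n.
Qed.

Lemma cmeasurable_coef f : L2 f -> cmeasurable setT (coef f).
Proof.
move=> /L2P[mf _].
apply: (@cmeasurable_cintegral _ _ X Z R mu (fun p => f p.2 * (k p.1 p.2)^*%C)).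
apply: cmeasurableM; last exact: cmeasurableJ.
exact: (cmeasurable_comp mf measurable_snd).
Qed.

Lemma modulus_coef f z : L2 f -> modulus (coef f z) <= norm f.
Proof.
move=> L2f; apply: sqmod_le; first exact: hnorm_ge0.
have := cauchy_schwarz (linear_L2 mu) (semi_inner_product_L2 mu) L2f (kernel_L2 z).
move=> /le_trans; apply; rewrite ler_piMr ?sqr_ge0// expr_le1// ?hnorm_ge0//.
exact: norm_kernel.
Qed.

Let energy a := (\int[m]_z (modulus (u z) * sqmod (a z))%:E)%E.

Let weight a (p : Z * X) := (modulus (u p.1) * sqmod (a p.1 * k p.1 p.2))%:E.

Let weight_ge0 a p : (0 <= weight a p)%E.
Proof. by rewrite lee_fin mulr_ge0 ?modulus_ge0 ?sqmod_ge0. Qed.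

Let m_ak a : cmeasurable setT a ->
  cmeasurable setT (fun p : Z * X => a p.1 * k p.1 p.2).
Proof.
by move=> ma; apply: cmeasurableM => //; exact: (cmeasurable_comp ma measurable_fst).
Qed.

Let m_weight a : cmeasurable setT a -> measurable_fun setT (weight a).
Proof.
move=> ma; apply/measurable_EFinP; apply: measurable_funM.
  apply: measurable_modulus; exact: (cmeasurable_comp mu_ measurable_fst).
by apply: measurable_sqmod; exact: m_ak.
Qed.

Let weight_le a : cmeasurable setT a ->
  (\int[mu]_x \int[m]_z weight a (z, x) <= energy a)%E.
Proof.
move=> ma; have -> : (\int[mu]_x \int[m]_z weight a (z, x) =
    \int[m]_z \int[mu]_x weight a (z, x))%E.
  exact/esym/(@fubini_tonelli _ _ Z X R m mu (weight a) (m_weight ma) (weight_ge0 a)).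
apply: le_integral_ge0 => [||z|z].
- exact: (measurable_integral mu (m_weight ma)).
- apply/measurable_EFinP; apply: measurable_funM; first exact: measurable_modulus.
  exact: measurable_sqmod.
- exact: integral_ge0.
have [mkz _] := (L2P mu (k z)).1 (kernel_L2 z).
have -> : (\int[mu]_x weight a (z, x) =
    (modulus (u z) * sqmod (a z))%:E * \int[mu]_x (sqmod (k z x))%:E)%E.
  rewrite -integralZ_ge0.
  - by apply: eq_integral => x _; rewrite /weight/= sqmodM mulrA EFinM.
  - by rewrite mulr_ge0 ?modulus_ge0 ?sqmod_ge0.
  - exact: measurable_sqmodE.
  - by move=> x; rewrite lee_fin sqmod_ge0.
rewrite -[leRHS]mule1 lee_wpmul2l//.
by rewrite lee_fin mulr_ge0 ?modulus_ge0 ?sqmod_ge0.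
Qed.

Lemma cmeasurable_superpose a : cmeasurable setT a ->
  cmeasurable setT (superpose a).
Proof.
move=> ma; apply: (@cmeasurable_cintegral _ _ Z X R m
  (fun p => u p.2 * (a p.2 * k p.2 p.1))).
apply: cmeasurableM; first exact: (cmeasurable_comp mu_ measurable_snd).
by apply: (cmeasurable_comp (m_ak ma) (h := fun p : X * Z => (p.2, p.1))); exact: measurable_swap.
Qed.

(** The Hilbert-Schmidt estimate: Cauchy-Schwarz with respect to the measure
    [|u| dm], then Tonelli, since every [k z] has norm at most one. *)
Lemma superpose_le a : cmeasurable setT a ->
  (\int[mu]_x (sqmod (superpose a x))%:E <= C%:E * energy a)%E.
Proof.
move=> ma; apply: (@le_trans _ _ (C%:E * \int[mu]_x \int[m]_z weight a (z, x))%E); last first.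
  by rewrite lee_wpmul2l ?lee_fin ?(ltW C0)//; exact: weight_le.
have mw : measurable_fun setT (fun x => \int[m]_z weight a (z, x))%E.
  apply: (@measurable_integral _ _ Z X R m (fun p => weight a (p.2, p.1))).
  by apply: measurableT_comp; [exact: m_weight|exact: measurable_swap].
rewrite -integralZ_ge0; [|exact: ltW|exact: mw|by move=> x; exact: integral_ge0].
apply: le_integral_ge0 => [||x|x].
- by apply: measurable_sqmodE; exact: cmeasurable_superpose.
- exact: measurable_funeM.
- by rewrite lee_fin sqmod_ge0.
apply: weighted_cauchy_schwarz => //.
exact: (cmeasurable_comp (m_ak ma) (pair2_measurable x)).
Qed.

(** [|u| dm] is a finite measure, so bounded coefficients have finite energy. *)
Lemma energy_bounded a (M : R) : cmeasurable setT a ->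
  (forall z, modulus (a z) <= M) -> (energy a <= (M ^+ 2 * C)%:E)%E.
Proof.
move=> ma aM; rewrite EFinM.
apply: (@le_trans _ _ ((M ^+ 2)%:E * \int[m]_z (modulus (u z))%:E)%E); last first.
  by rewrite lee_wpmul2l// lee_fin sqr_ge0.
have mmu : measurable_fun setT (fun z => (modulus (u z))%:E).
  by apply/measurable_EFinP; exact: measurable_modulus.
rewrite -integralZ_ge0 ?sqr_ge0//; last by move=> z; rewrite lee_fin modulus_ge0.
apply: le_integral_ge0 => [||z|z].
- apply/measurable_EFinP; apply: measurable_funM; first exact: measurable_modulus.
  exact: measurable_sqmod.
- exact: measurable_funeM.
- by rewrite lee_fin mulr_ge0 ?modulus_ge0 ?sqmod_ge0.
rewrite -EFinM lee_fin mulrC ler_wpM2r ?modulus_ge0//.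
rewrite -modulus_sqr ler_pXn2r ?nnegrE ?modulus_ge0//.
exact: le_trans (modulus_ge0 _) (aM z).
Qed.

Lemma ae_superpose_integrable a (M : R) : cmeasurable setT a ->
  (forall z, modulus (a z) <= M) ->
  {ae mu, forall x, cintegrable m (fun z => u z * (a z * k z x))}.
Proof.
move=> ma aM; pose F x := (\int[m]_z weight a (z, x))%E.
have F0 x : (0 <= F x)%E by exact: integral_ge0.
have mF : measurable_fun setT F.
  apply: (@measurable_integral _ _ Z X R m (fun p => weight a (p.2, p.1))).
  by apply: measurableT_comp; [exact: m_weight|exact: measurable_swap].
have Fi : mu.-integrable setT F.
  apply/integrableP; split=> //; rewrite (eq_integral F).
    apply: le_lt_trans (weight_le ma) _; apply: le_lt_trans (energy_bounded ma aM) _.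
    exact: ltry.
  by move=> x _; rewrite gee0_abs.
apply: filterS (integrable_ae measurableT Fi) => x /(_ Logic.I) Fx.
apply: (weighted_cintegrable mu_ _ uC); last by rewrite -ge0_fin_numE//; exact: F0.
exact: (cmeasurable_comp (m_ak ma) (pair2_measurable x)).
Qed.

Lemma ae_superpose_lin (c : R[i]) a b (M M' : R) :
  cmeasurable setT a -> cmeasurable setT b ->
  (forall z, modulus (a z) <= M) -> (forall z, modulus (b z) <= M') ->
  {ae mu, forall x, superpose (fun z => c * a z + b z) x =
                    c * superpose a x + superpose b x}.
Proof.
move=> ma mb aM bM; near=> x.
have ia : cintegrable m (fun z => u z * (a z * k z x)).
  near: x; exact: ae_superpose_integrable ma aM.
have ib : cintegrable m (fun z => u z * (b z * k z x)).
  near: x; exact: ae_superpose_integrable mb bM.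
by rewrite /superpose -cintegral_lin//; apply: eq_cintegral => z _; ring.
Unshelve. all: by end_near. Qed.

End KernelIntegral.

Lemma cvg_cauchy_real (R : realType) (v : nat -> R) :
  (forall e, 0 < e -> exists N, forall p n, (N <= p)%N -> (N <= n)%N ->
    `|v p - v n| < e) -> cvgn v.
Proof.
move=> vC; apply/cauchy_cvgP/cauchy_exP => e e0; have [N hN] := vC e e0.
by exists (v N), N => // n /= Nn; rewrite /ball/=; exact: hN.
Qed.

(** A cluster point of the sequence exists by Tychonoff; only finitely many
    coordinates have to be controlled at each extraction step. *)
Lemma bounded_diagonal (R : realType) (b : nat -> nat * bool -> R)
    (B : nat * bool -> R) : (forall n i, `|b n i| <= B i) ->
  exists k : nat -> nat, {homo k : p n / (p < n)%N} /\
    forall i, cvgn (fun n => b (k n) i).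
Proof.
move=> bB; pose S := prod_topology (fun _ : nat * bool => R); pose A (i : nat * bool) := `[- B i, B i]%classic.
have cA : compact [set f : S | forall i, A i (f i)].
  by apply: (@tychonoff _ (fun=> R)) => i; exact: segment_compact.
have [|c [_ cc]] := cA (b @ \oo) _.
  by exists 0%N => // n _ i; rewrite /A /= in_itv/= -ler_norml.
have step n N : exists p, (N <= p)%N /\
    forall i : nat * bool, (i.1 < n)%N -> `|b p i - c i| < n.+1%:R^-1.
  have nb : nbhs c [set f : S |
      forall i : nat * bool, (i.1 < n)%N -> `|f i - c i| < n.+1%:R^-1].
    have : \forall f \near (c : S), forall j : 'I_n, forall s : bool,
        `|f (j : nat, s) - c (j : nat, s)| < n.+1%:R^-1.
      pose P j s (f : S) : Prop := `|f (j, s) - c (j, s)| < n.+1%:R^-1.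
      apply: (@filter_forall S 'I_n (fun j f => forall s, P j s f) _ (nbhs_filter _)) => j.
      apply: (@filter_forall S bool (fun s f => P j s f) _ (nbhs_filter _)) => s.
      rewrite /P.
      have pc := @proj_continuous _ (fun=> R) (nat_of_ord j, s) c.
      have n0 : 0 < n.+1%:R^-1 :> R by rewrite invr_gt0.
      have := pc _ (nbhsx_ballx (c (nat_of_ord j, s)) _ n0).
      apply: (@filterS S (nbhs (c : S)) (nbhs_filter _)) => f fc.
      by rewrite distrC; exact: fc.
    apply: (@filterS S (nbhs (c : S)) (nbhs_filter _)) => f fc [j s] jn; exact: (fc (Ordinal jn) s).
  have tl : (b @ \oo) [set b p | p in [set p | (N <= p)%N]].
    by exists N => // p Np; exists p.
  by have [_ [[p Np <-] pc]] := cc _ _ tl nb; exists p.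
have /choice[f fP] : forall q : nat * nat, exists p, (q.2 <= p)%N /\
    forall i : nat * bool, (i.1 < q.1)%N -> `|b p i - c i| < q.1.+1%:R^-1.
  by move=> [n N]; exact: step.
pose k := fix k n := if n is n'.+1 then f (n, (k n').+1) else f (0%N, 0%N).
have kS n : (k n < k n.+1)%N by rewrite [k n.+1]/=; case: (fP (n.+1, (k n).+1)).
have kc n i : (i.1 < n)%N -> `|b (k n) i - c i| < n.+1%:R^-1.
  by case: n => // n; rewrite [k _]/=; case: (fP (n.+1, (k n).+1)) => _; exact.
exists k; split.
  move=> p n; elim: n => // n ih; rewrite ltnS leq_eqVlt => /predU1P[->//|/ih].
  by move=> /ltn_trans; exact.
move=> i; apply/cvg_ex; exists (c i); apply/cvgrPdist_lt => e e0.
have [N _ hN] := near_infty_natSinv_lt (PosNum e0).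
exists (maxn N i.1.+1) => // n; rewrite /= geq_max => /andP[Nn in_].
by rewrite distrC; apply: lt_trans (kc _ _ in_) (hN n Nn).
Qed.

Section KernelOperator.
Context d d' (X : measurableType d) (Z : measurableType d') (R : realType).
Context (mu : {sigma_finite_measure set X -> \bar R}).
Context (m : {sigma_finite_measure set Z -> \bar R}).
Context (k : Z -> X -> R[i]) (u : Z -> R[i]) (C : R).
Hypothesis mk : cmeasurable setT (fun p : Z * X => k p.1 p.2).
Hypothesis k1 : forall z, (\int[mu]_x (sqmod (k z x))%:E <= 1)%E.
Hypothesis mu_ : cmeasurable setT u.
Hypothesis C0 : 0 < C.
Hypothesis uC : (\int[m]_z (modulus (u z))%:E <= C%:E)%E.
Implicit Types (f : X -> R[i]) (a : Z -> R[i]).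

Local Notation L2 := (Lp mu setT 2 : set (X -> R[i])).
Local Notation norm := (hnorm (inner mu)).
Local Notation energy a := (\int[m]_z (modulus (u z) * sqmod (a z))%:E)%E.
Local Notation coef := (coef mu k).
Local Notation superpose := (superpose m k u).

Let lin := linear_L2 mu.
Let ip := semi_inner_product_L2 mu.

Context (H : set (X -> R[i])) (Hlin : linear_subset H) (HL2 : H `<=` L2).
Context (L : (X -> R[i]) -> X -> R[i]).
Hypothesis mL : forall f, H f -> cmeasurable setT (L f).
Hypothesis aeL : forall f, H f -> {ae mu, forall x, L f x = superpose (coef f) x}.

Let H_coef f : H f -> cmeasurable setT (coef f).
Proof. by move=> /HL2; exact: cmeasurable_coef. Qed.

Let H_mod f : H f -> forall z, modulus (coef f z) <= norm f.
Proof. by move=> /HL2 Hf z; exact: modulus_coef. Qed.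

Lemma superpose_L2 a (M : R) : cmeasurable setT a ->
  (forall z, modulus (a z) <= M) -> L2 (superpose a).
Proof.
move=> ma aM; apply/L2P; split; first exact: cmeasurable_superpose.
apply: le_lt_trans (superpose_le mk k1 mu_ C0 uC ma) _.
by rewrite lte_mul_pinfty ?lee_fin ?ltW//; apply: le_lt_trans (energy_bounded mu_ uC ma aM) _; rewrite ltry.
Qed.

Let ae_sqmod_eq f g : cmeasurable setT f -> cmeasurable setT g ->
  {ae mu, forall x, f x = g x} ->
  (\int[mu]_x (sqmod (f x))%:E = \int[mu]_x (sqmod (g x))%:E)%E.
Proof.
move=> mf mg fg; apply: ge0_ae_eq_integral => //.
- exact: measurable_sqmodE.
- exact: measurable_sqmodE.
- by move=> x _; rewrite lee_fin sqmod_ge0.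
- by move=> x _; rewrite lee_fin sqmod_ge0.
- by apply: filterS fg => x ->.
Qed.

Lemma kernel_operator_L2 f : H f -> L2 (L f).
Proof.
move=> Hf; have [ms soo] := (L2P mu _).1 (superpose_L2 (H_coef Hf) (H_mod Hf)).
apply/L2P; split; first exact: mL.
by rewrite (ae_sqmod_eq (mL Hf) ms (aeL Hf)).
Qed.

(** Applied to coefficients [a] that do not come from a function: limits of coefficients
    along a weakly convergent sequence are handled in this form. *)
Lemma kernel_operator_dist f a (M : R) : H f -> cmeasurable setT a ->
  (forall z, modulus (a z) <= M) ->
  ((norm (L f - superpose a) ^+ 2)%:E <=
   C%:E * energy (fun z => (coef f z - a z)%R))%E.
Proof.
move=> Hf ma aM; have L2a := superpose_L2 ma aM; have L2f := kernel_operator_L2 Hf.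
rewrite hnorm_L2; last exact: linear_subsetB lin L2f L2a.
have mfa : cmeasurable setT (fun z => -1 * a z + coef f z).
  apply: cmeasurableD (H_coef Hf); apply: cmeasurableM => //; exact: cmeasurable_cst.
have E : (fun z => coef f z - a z) = (fun z => -1 * a z + coef f z).
  by apply/funext => z; rewrite mulN1r addrC.
rewrite [X in (_ <= _ * X)%E](_ : _ = energy (fun z => -1 * a z + coef f z)%R); last first.
  by apply: eq_integral => z _; rewrite mulN1r addrC.
apply: le_trans (superpose_le mk k1 mu_ C0 uC mfa).
have [mLa _] := (L2P mu _).1 (linear_subsetB lin L2f L2a).
rewrite (ae_sqmod_eq mLa (cmeasurable_superpose m mk mu_ mfa))//.
near=> x; rewrite !fctE.
have -> : L f x = superpose (coef f) x by near: x; exact: aeL.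
have -> : superpose (fun z => -1 * a z + coef f z) x =
    -1 * superpose a x + superpose (coef f) x.
  near: x; exact: (ae_superpose_lin mk k1 mu_ uC (-1) ma (H_coef Hf) aM (H_mod Hf)).
by rewrite mulN1r addrC.
Unshelve. all: by end_near. Qed.

Lemma kernel_operator_linear : linear_operator (inner mu) H L2 L.
Proof.
split=> [f|c f g Hf Hg]; first exact: kernel_operator_L2.
have Hfg : H (c *: f + g) by case: Hlin => _; exact.
have L2s : L2 (c *: L f + L g).
  by case: lin => _; apply; exact: kernel_operator_L2.
have Kfg := ae_superpose_lin mk k1 mu_ uC c (H_coef Hf) (H_coef Hg) (H_mod Hf) (H_mod Hg).
have cfg : coef (c *: f + g) = (fun z => c * coef f z + coef g z).
  apply/funext => z; case: ip => + _ _; apply; [exact: HL2|exact: HL2|].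
  exact: kernel_L2.
rewrite -cfg in Kfg; apply: (heq_ae (kernel_operator_L2 Hfg) L2s).
apply: filterS (filterI Kfg (filterI (aeL Hfg) (filterI (aeL Hf) (aeL Hg)))).
move=> x [e0 [e1 [e2 e3]]].
exact: (etrans e1 (etrans e0 (f_equal2 (fun p q => c * p + q) (esym e2) (esym e3)))).
Qed.

(** Sum the estimate of [superpose_le] over the family and use Bessel's inequality for
    [k z], whose norm is at most one, under the integral. *)
Lemma kernel_operator_hilbert_schmidt (I : finType) (v : I -> X -> R[i]) :
  (forall i, H (v i)) -> orthonormal (inner mu) v ->
  \sum_i norm (L (v i)) ^+ 2 <= C ^+ 2.
Proof.
move=> Hv ov; rewrite -lee_fin -sumEFin.
have e0 i z : (0 <= (modulus (u z) * sqmod (coef (v i) z))%:E :> \bar R)%E.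
  by rewrite lee_fin mulr_ge0 ?modulus_ge0 ?sqmod_ge0.
have me i : measurable_fun setT (fun z => (modulus (u z) * sqmod (coef (v i) z))%:E).
  apply/measurable_EFinP; apply: measurable_funM; first exact: measurable_modulus.
  by apply: measurable_sqmod; exact: H_coef.
apply: (@le_trans _ _ (\sum_i C%:E * energy (coef (v i)))%E).
  apply: lee_sum => i _; rewrite hnorm_L2; last exact: kernel_operator_L2.
  rewrite (ae_sqmod_eq (mL (Hv i)) (cmeasurable_superpose m mk mu_ (H_coef (Hv i))) (aeL (Hv i))).
  exact: (superpose_le mk k1 mu_ C0 uC (H_coef (Hv i))).
rewrite -ge0_sume_distrr; last by move=> i _; exact: integral_ge0.
rewrite -ge0_integral_sum// expr2 EFinM lee_wpmul2l ?lee_fin ?(ltW C0)//.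
apply: le_trans uC; apply: le_integral_ge0 => [||z|z].
- exact: emeasurable_sum.
- by apply/measurable_EFinP; exact: measurable_modulus.
- exact: sume_ge0.
rewrite sumEFin lee_fin -mulr_sumr ler_piMr ?modulus_ge0//.
apply: le_trans (bessel lin ip (kernel_L2 mk k1 z) (fun i => HL2 (Hv i)) ov) _.
by rewrite expr_le1// ?hnorm_ge0//; exact: norm_kernel.
Qed.

Context (Hsep : Defs.separable (inner mu) H) (Hcomp : complete_subset (inner mu) H).

(** Extract along a countable dense subset of [H]; equicontinuity of the products extends
    convergence to [H], and projecting onto [H] extends it to every [g]. *)
Lemma weakly_convergent_subsequence (h : nat -> X -> R[i]) (M : R) :
  (forall n, H (h n)) -> (forall n, norm (h n) <= M) ->
  exists s : nat -> nat, {homo s : p n / (p < n)%N} /\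
    forall g, L2 g -> cvgn (fun n => complex.Re (inner mu (h (s n)) g)) /\
                      cvgn (fun n => complex.Im (inner mu (h (s n)) g)).
Proof.
move=> Hh hM; have [D [HD Dd]] := Hsep.
pose part (s : bool) (z : R[i]) := if s then complex.Re z else complex.Im z.
have part_le s z : `|part s z| <= modulus z.
  by case: s => /=; [exact: ler_Re_modulus|exact: ler_Im_modulus].
have partB s (z w : R[i]) : part s z - part s w = part s (z - w).
  by case: s; case: z w => ? ? [].
have M0 : 0 <= M by apply: le_trans (hnorm_ge0 _ (h 0%N)) (hM 0%N).
have CS f g : L2 f -> L2 g -> modulus (inner mu f g) <= norm f * norm g.
  move=> L2f L2g; apply: sqmod_le; first by rewrite mulr_ge0 ?hnorm_ge0.
  by rewrite exprMn; exact: (cauchy_schwarz lin ip L2f L2g).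
have [|s [smono scv]] := @bounded_diagonal R
    (fun n i => part i.2 (inner mu (h n) (D i.1))) (fun i => M * norm (D i.1)).
  move=> n i; apply: le_trans (part_le _ _) _.
  apply: le_trans (CS _ _ (HL2 (Hh n)) (HL2 (HD i.1))) _.
  by rewrite ler_wpM2r ?hnorm_ge0.
exists s; split=> // g L2g.
have [p Hp pg] := projection_exists lin ip Hlin HL2 Hcomp L2g.
have gp n : inner mu (h n) g = inner mu (h n) p.
  rewrite (ipC ip L2g (HL2 (Hh n))) -pg; last exact: Hh.
  exact: (esym (ipC ip (HL2 Hp) (HL2 (Hh n)))).
suff cv b : cvgn (fun n => part b (inner mu (h (s n)) g)).
  by split; [exact: (cv true)|exact: (cv false)].
apply: cvg_cauchy_real => e e0.
have e4 : 0 < e / (4 * (M + 1)) by rewrite divr_gt0// mulr_gt0// ltr_wpDl.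
have [j pj] := Dd p Hp _ e4.
have e2 : 0 < e / 2 by rewrite divr_gt0.
have /cvg_ex[l /cvgrPdist_lt/(_ _ (divr_gt0 e2 (ltr0Sn R 1)))[N _ hN]] := scv (j, b).
exists N => n n' Nn Nn'; rewrite !gp.
have L2n q : L2 (h q) by exact/HL2/Hh.
have [L2p L2D] := (HL2 Hp, HL2 (HD j)).
have L2pD : L2 (p - D j) by exact: linear_subsetB lin L2p L2D.
have split_ q : part b (inner mu (h q) p) =
    part b (inner mu (h q) (D j)) + part b (inner mu (h q) (p - D j)).
  have -> : inner mu (h q) (p - D j) = inner mu (h q) p - inner mu (h q) (D j).
    exact: (ipBr lin ip (L2n q) L2p L2D).
  by rewrite -partB addrC subrK.
have small q : `|part b (inner mu (h q) (p - D j))| <= e / 4.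
  apply: le_trans (part_le _ _) _; apply: le_trans (CS _ _ (L2n q) L2pD) _.
  apply: (@le_trans _ _ ((M + 1) * (e / (4 * (M + 1))))).
    apply: ler_pM; rewrite ?hnorm_ge0//; last exact: ltW.
    by rewrite (le_trans (hM q))// lerDl.
  by rewrite le_eqVlt; apply/orP; left; apply/eqP; field; rewrite gt_eqF// ltr_wpDl.
rewrite !split_; have := small (s n); have := small (s n').
have := hN n Nn; have := hN n' Nn'; rewrite /=.
move: (part _ _) (part _ _) (part _ _) (part _ _) => x1 x2 x3 x4.
rewrite !ltr_norml !ler_norml => /andP[? ?] /andP[? ?] /andP[? ?] /andP[? ?].
by apply/andP; split; lra.
Qed.

(** Along a weakly convergent subsequence the coefficients converge pointwise
    and boundedly, so the energy of their defect tends to zero. *)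
Lemma kernel_operator_compact : compact_operator (inner mu) H L2 L.
Proof.
split=> [|h Hh [M hM]]; first exact: kernel_operator_linear.
have [s [smono scv]] := weakly_convergent_subsequence Hh hM.
have M0 : 0 <= M by apply: le_trans (hnorm_ge0 _ (h 0%N)) (hM 0%N).
exists s; split=> //.
pose a z := limn (fun n => complex.Re (coef (h (s n)) z)) +i*
            limn (fun n => complex.Im (coef (h (s n)) z)).
have Hs n : H (h (s n)) by exact: Hh.
have sa z : (fun n => sqmod (coef (h (s n)) z - a z)) @ \oo --> 0.
  have [c1 c2] := scv _ (kernel_L2 mk k1 z).
  have -> : (fun n => sqmod (coef (h (s n)) z - a z)) = (fun n =>
     (complex.Re (coef (h (s n)) z) - complex.Re (a z)) ^+ 2 +
     (complex.Im (coef (h (s n)) z) - complex.Im (a z)) ^+ 2).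
    by apply/funext => n; rewrite /sqmod; case: (coef _ z) (a z) => ? ? [].
  have sq (v : nat -> R) : cvgn v -> (fun n => (v n - limn v) ^+ 2) @ \oo --> 0.
    move=> cv; rewrite -[0](mulr0 0); under eq_fun do rewrite expr2.
    have v0 : (fun n => v n - limn v) @ \oo --> 0.
      by rewrite -[X in _ --> X](subrr (limn v)); apply: cvgB => //; exact: cvg_cst.
    exact: cvgM.
  by rewrite -[0]addr0; apply: cvgD; [exact: (sq _ c1)|exact: (sq _ c2)].
have mr : cmeasurable setT a.
  split; [apply: (@measurable_fun_cvg _ _ _ _ (fun n z => complex.Re (coef (h (s n)) z)))
         |apply: (@measurable_fun_cvg _ _ _ _ (fun n z => complex.Im (coef (h (s n)) z)))].
  - by move=> n; case: (H_coef (Hs n)).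
  - by move=> z _; exact: (proj1 (scv _ (kernel_L2 mk k1 z))).
  - by move=> n; case: (H_coef (Hs n)).
  - by move=> z _; exact: (proj2 (scv _ (kernel_L2 mk k1 z))).
have cM n z : modulus (coef (h (s n)) z) <= M.
  exact: le_trans (H_mod (Hs n) z) (hM _).
have aM z : modulus (a z) <= 2 * M.
  apply: sqmod_le; first by rewrite mulr_ge0.
  apply/ler_addgt0Pr => e e0.
  have /cvgrPdist_lt/(_ _ (divr_gt0 e0 (ltr0Sn R 1)))[n _ /(_ n (leqnn n))] := sa z.
  rewrite sub0r normrN ger0_norm ?sqmod_ge0// => hn.
  have := sqmodD (coef (h (s n)) z) (- (coef (h (s n)) z - a z)).
  rewrite sqmodN opprB addrC subrK => /le_trans; apply.
  have : sqmod (coef (h (s n)) z) <= M ^+ 2.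
    by rewrite -modulus_sqr ler_pXn2r ?nnegrE ?modulus_ge0.
  by have := sqr_ge0 M; rewrite exprMn; lra.
have L2a := superpose_L2 mr aM.
exists (superpose a) => //.
pose f n z := (modulus (u z) * sqmod (coef (h (s n)) z - a z))%:E.
have mB n : cmeasurable setT (fun z => coef (h (s n)) z - a z).
  have := cmeasurableD (H_coef (Hs n)) (cmeasurableM (cmeasurable_cst setT (-1)) mr).
  by under eq_fun do rewrite mulN1r.
have mf n : measurable_fun setT (f n).
  apply/measurable_EFinP; apply: measurable_funM; first exact: measurable_modulus.
  exact: measurable_sqmod.
pose B := 2 * M ^+ 2 + 2 * (2 * M) ^+ 2.
have B0 : 0 <= B by rewrite addr_ge0// mulr_ge0// sqr_ge0.
have ui : m.-integrable setT (fun z => (modulus (u z))%:E).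
  by apply: cintegrable_modulus; split=> //; apply: le_lt_trans uC _; exact: ltry.
have [] := @dominated_convergence _ _ _ m setT measurableT f (cst 0%E)
    (fun z => B%:E * (modulus (u z))%:E)%E mf.
- exact: measurable_cst.
- apply: aeW => z _; apply: cvg_EFin; first exact: nearW.
  rewrite -[0%R](mulr0 (modulus (u z))); apply: cvgM => //; exact: cvg_cst.
- exact: integrableZl.
- apply: aeW => z n _; rewrite gee0_abs; last first.
    by rewrite lee_fin mulr_ge0 ?modulus_ge0 ?sqmod_ge0.
  rewrite -EFinM lee_fin mulrC ler_wpM2r ?modulus_ge0//.
  apply: le_trans (sqmodD _ _) _; rewrite sqmodN -!modulus_sqr.
  apply: lerD; rewrite ler_pM2l// ler_pXn2r ?nnegrE ?modulus_ge0//.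
  by rewrite mulr_ge0.
move=> _ _; rewrite integral0 => f0.
have Lf n : norm (L (h (s n)) - superpose a) ^+ 2 <= C * fine (\int[m]_z f n z)%E.
  have I0 : (0 <= \int[m]_z f n z)%E.
    by apply: integral_ge0 => z _; rewrite lee_fin mulr_ge0 ?modulus_ge0 ?sqmod_ge0.
  have bnd z : modulus (coef (h (s n)) z - a z) <= M + 2 * M.
    apply: le_trans (ler_modulusD _ _) (lerD (cM n z) _).
    by rewrite modulusE sqmodN -modulusE.
  have Ioo := le_lt_trans (energy_bounded mu_ uC (mB n) bnd) (ltry _).
  rewrite -lee_fin [X in (_ <= X)%E]EFinM fineK; last by rewrite ge0_fin_numE.
  exact: (kernel_operator_dist (Hs n) mr aM).
have f0' : (fun n => C * fine (\int[m]_z f n z)%E) @ \oo --> 0.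
  rewrite -[X in _ --> X](mulr0 C); apply: cvgM; first exact: cvg_cst.
  exact: fine_cvg.
have n0 : (fun n => norm (L (h (s n)) - superpose a) ^+ 2) @ \oo --> 0.
  apply: squeeze_cvgr (cvg_cst 0) f0'; apply: nearW => n.
  by rewrite sqr_ge0 Lf.
have -> : (fun n => norm (L (h (s n)) - superpose a)) =
    (fun n => Num.sqrt (norm (L (h (s n)) - superpose a) ^+ 2)).
  by apply/funext => n; rewrite sqrtr_sqr ger0_norm// hnorm_ge0.
rewrite -(@sqrtr0 R); apply: (@continuous_cvg _ _ _ _ _ _ Num.sqrt) => //.
exact: sqrt_continuous.
Qed.

End KernelOperator.

(** * Topological groups *)

Section TopologicalGroups.
Context (G : topologicalGroupType).
Implicit Types (x y : G) (A B C O U V W : set G).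

Lemma mulg_cvg (T : Type) (F : set_system T) (FF : Filter F) (f g : T -> G) x y :
  f @ F --> x -> g @ F --> y -> (fun t => f t * g t)%g @ F --> (x * y)%g.
Proof.
move=> fx gy; apply: (@cvg_comp _ _ _ (fun t => (f t, g t))
  (fun p : G * G => (p.1 * p.2)%g) F (nbhs (x, y))).
  exact: cvg_pair.
exact: (mulg_continuous (x, y)).
Qed.

Lemma invg_cvg (T : Type) (F : set_system T) (FF : Filter F) (f : T -> G) x :
  f @ F --> x -> (fun t => (f t)^-1)%g @ F --> (x^-1)%g.
Proof. by move=> fx; apply: cvg_comp fx _; exact: (invg_continuous x). Qed.

Lemma continuous_mulg (T : topologicalType) (f g : T -> G) :
  continuous f -> continuous g -> continuous (fun t => f t * g t)%g.
Proof. by move=> cf cg t; apply: mulg_cvg; [exact: cf|exact: cg]. Qed.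

Lemma continuous_invg (T : topologicalType) (f : T -> G) :
  continuous f -> continuous (fun t => (f t)^-1)%g.
Proof. by move=> cf t; apply: invg_cvg; exact: cf. Qed.

Lemma continuous_cstg (T : topologicalType) x : continuous (fun _ : T => x).
Proof. by move=> t; exact: cvg_cst. Qed.

Lemma continuous_idg : continuous (fun x : G => x).
Proof. by move=> t; exact: cvg_id. Qed.

Lemma continuous_fstg (T S : topologicalType) : continuous (fun p : T * S => p.1).
Proof. by move=> t; exact: cvg_fst. Qed.

Lemma continuous_sndg (T S : topologicalType) : continuous (fun p : T * S => p.2).
Proof. by move=> t; exact: cvg_snd. Qed.

Lemma continuous_compg (T S U : topologicalType) (f : T -> S) (g : S -> U) :
  continuous f -> continuous g -> continuous (fun t => g (f t)).
Proof. by move=> cf cg t; exact: (continuous_comp (cf t) (cg (f t))). Qed.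

Lemma open_compg (T : topologicalType) (f : T -> G) O :
  continuous f -> open O -> open [set t | O (f t)].
Proof. by move=> cf oO; apply: open_comp => // t _; exact: cf. Qed.

Lemma lcosetE x A : [set (x * y)%g | y in A] = [set y | A (x^-1 * y)%g].
Proof.
apply/seteqP; split=> [_ [y Ay <-]|y Ay] /=; first by rewrite mulKg.
by exists (x^-1 * y)%g; rewrite // mulVKg.
Qed.

(** The tube lemma. *)
Lemma open_forall (T S W : topologicalType) (f : T * S -> W) (K : set S) (O : set W) :
  compact K -> continuous f -> open O ->
  open [set t | forall k, K k -> O (f (t, k))].
Proof.
move=> /compact_near_coveringP cK cf oO; rewrite openE => t /= tO.
apply: (cK T (nbhs t) (fun s k => O (f (s, k)))) => k Kk.
have nO : nbhs (f (t, k)) O by apply: open_nbhs_nbhs; split => //; exact: tO.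
have := cf (t, k) O nO; rewrite /= nbhs_simpl/= => -[[A B] /= [nA nB] AB].
by exists (B, A) => //= -[s r] /= [Bs Ar]; exact: AB.
Qed.

Lemma open_exists (T S : topologicalType) (f : T * S -> G) (K : set S) O :
  continuous f -> open O -> open [set t | exists2 k, K k & O (f (t, k))].
Proof.
move=> cf oO; have -> : [set t | exists2 k, K k & O (f (t, k))] =
    \bigcup_(k in K) [set t | O (f (t, k))].
  by apply/seteqP; split=> t [k Kk Ok]; exists k.
apply: bigcup_open => k _; apply: open_compg => // t.
by apply: (cvg_comp _ _ (_ : (fun s => (s, k)) @ t --> (t, k)) (cf (t, k)));
  apply: cvg_pair; [exact: cvg_id|exact: cvg_cst].
Qed.

Lemma compact_image (T U : topologicalType) (f : T -> U) (A : set T) :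
  continuous f -> compact A -> compact [set f x | x in A].
Proof. by move=> cf; apply: continuous_compact; exact: continuous_subspaceT. Qed.

Definition setg A B := [set (p.1 * p.2)%g | p in A `*` B].

Lemma compact_setg A B : compact A -> compact B -> compact (setg A B).
Proof.
by move=> cA cB; apply: compact_image; [exact: mulg_continuous|exact: compact_setX].
Qed.

Lemma compact_cover_seq (C : set G) (F : G -> set G) : compact C ->
  (forall x, open (F x)) -> (forall x, F x x) ->
  exists s : seq G, forall y, C y -> exists2 x, x \in s & F x y.
Proof.
rewrite compact_cover => cC oF Fx.
have [|s _ sC] := cC G setT F (fun x _ => oF x); first by move=> x _; exists x.
exists (finmap.enum_fset s) => y /sC[x xs Fxy]; exists x => //.
Qed.

Section CompactSubgroup.
Context (K : set G) (sK : compact_subgroup K).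

Let K1 : K 1%g. Proof. by case: sK. Qed.
Let cK : compact K. Proof. by case: sK. Qed.
Lemma subgroupV x : K x -> K x^-1%g.
Proof. by case: sK => _ _ Kd Kx; have := Kd 1%g x K1 Kx; rewrite mul1g. Qed.
Lemma subgroupM x y : K x -> K y -> K (x * y)%g.
Proof.
by case: sK => _ _ Kd Kx Ky; have := Kd x y^-1%g Kx (subgroupV Ky); rewrite invgK.
Qed.

Definition bi_stable A := forall x k k', K k -> K k' -> A x -> A (k * x * k')%g.

Lemma bi_stableE A : bi_stable A -> forall x k k', K k -> K k' ->
  A (k * x * k')%g <-> A x.
Proof.
move=> bA x k k' Kk Kk'; split; last exact: bA.
move=> /(bA _ _ _ (subgroupV Kk) (subgroupV Kk')).
by rewrite -!mulgA mulgV mulg1 mulKg.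
Qed.

Lemma bi_stable_l A x k : bi_stable A -> K k -> A x -> A (k * x)%g.
Proof. by move=> bA Kk Ax; rewrite -[(k * x)%g]mulg1; exact: bA. Qed.

Lemma bi_stable_r A x k : bi_stable A -> K k -> A x -> A (x * k)%g.
Proof. by move=> bA Kk Ax; rewrite -[x]mul1g; exact: bA. Qed.

(** [core A] and [sat A] are the largest bi-stable subset and the smallest
    bi-stable superset of [A]. *)
Definition core A := [set x | forall p, (K `*` K) p -> A (p.1 * x * p.2)%g].
Definition sat A := [set x | exists2 p, (K `*` K) p & A (p.1 * x * p.2)%g].

Let continuous_double : continuous (fun q : G * (G * G) => (q.2.1 * q.1 * q.2.2)%g).
Proof.
have c2 := @continuous_sndg G (G * G)%type.
apply: continuous_mulg; last exact: (continuous_compg c2 (@continuous_sndg G G)).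
apply: continuous_mulg; last exact: continuous_fstg.
exact: (continuous_compg c2 (@continuous_fstg G G)).
Qed.

Lemma open_core A : open A -> open (core A).
Proof.
by move=> oA; apply: (open_forall (compact_setX cK cK) continuous_double oA).
Qed.

Lemma open_sat A : open A -> open (sat A).
Proof. by move=> oA; apply: (open_exists _ continuous_double oA). Qed.

Lemma core_sub A : core A `<=` A.
Proof. by move=> x /(_ (1, 1)%g); rewrite /= mul1g mulg1; apply. Qed.

Lemma bi_stable_core A : bi_stable (core A).
Proof.
move=> x k k' Kk Kk' cx [a b] [Ka Kb] /=.
have := cx (a * k, k' * b)%g; rewrite /= !mulgA; apply; split; exact: subgroupM.
Qed.

Lemma bi_stable_sat A : bi_stable (sat A).
Proof.
move=> x k k' Kk Kk' [[a b] [Ka Kb] /= Ax].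
exists (a * k^-1, k'^-1 * b)%g => /=.
  by split; apply: subgroupM => //; exact: subgroupV.
by rewrite -!mulgA mulKg !mulgA -(mulgA _ k') mulgV mulg1.
Qed.

Lemma sub_core A W : bi_stable A -> A `<=` W -> A `<=` core W.
Proof. by move=> bA AW x Ax [a b] [Ka Kb]; apply: AW; exact: bA. Qed.

Lemma bi_stable_subgroup : bi_stable K.
Proof. by move=> x k k' Kk Kk' Kx; do 2?[apply: subgroupM]. Qed.

(** Compactness of [K], once for each factor of the product [x y^-1], by the tube
    lemma; the core makes the result bi-stable. *)
Lemma square_root_nbhs W : open W -> K `<=` W -> exists V,
  [/\ open V, bi_stable V, K `<=` V & forall x y, V x -> V y -> W (x * y^-1)%g].
Proof.
move=> oW KW; have oc := open_core oW.
pose f (q : (G * G) * G) := (q.1.1 * q.2 * q.1.2^-1)%g.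
have cf : continuous f.
  have c1 := @continuous_fstg (G * G)%type G.
  apply: continuous_mulg; last first.
    by apply: continuous_invg; exact: (continuous_compg c1 (@continuous_sndg G G)).
  apply: continuous_mulg; last exact: continuous_sndg.
  exact: (continuous_compg c1 (@continuous_fstg G G)).
have oS := open_forall cK cf oc.
have : nbhs (1%g : G, 1%g : G) [set t | forall k, K k -> core W (f (t, k))].
  apply: open_nbhs_nbhs; split=> // k Kk; rewrite /f /= mul1g invg1 mulg1.
  exact: sub_core bi_stable_subgroup KW _ Kk.
move=> [[A B] /= [nA nB] AB].
pose O := interior (A `&` B).
have O1 : O 1%g by exact: filterI.
exists (sat O); split.
- by apply: open_sat; exact: open_interior.
- exact: bi_stable_sat.
- move=> k Kk; exists (k^-1, 1)%g; rewrite /= ?mulVg ?mulg1//.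
  by split=> //=; exact: subgroupV.
move=> x y [[k1 k2] [/= K1' K2] Ox] [[k3 k4] [/= K3 K4] Oy]; apply: core_sub.
have [Ax _] := interior_subset Ox; have [_ By] := interior_subset Oy.
have := AB (_, _) (conj Ax By) (k2^-1 * k4)%g (subgroupM (subgroupV K2) K4).
rewrite /f /= => /(bi_stable_core (subgroupV K1') K3).
by rewrite !invgM !mulgA mulVg mul1g mulgK mulgK -(mulgA _ _ k3) mulVg mulg1.
Qed.

End CompactSubgroup.

End TopologicalGroups.

(** * Haar measure and a compact subgroup *)

Section BorelMeasurability.
Context (G : topologicalGroupType) (R : realType).

Lemma open_borel (X : ptopologicalType) (O : set X) :
  open O -> measurable (O : set (borel X)).
Proof. by move=> oO; exact: sub_sigma_algebra. Qed.

Lemma closed_borel (X : ptopologicalType) (F : set X) :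
  closed F -> measurable (F : set (borel X)).
Proof. by move=> cF; rewrite -[F]setCK; apply: measurableC; apply: open_borel; exact: closed_openC. Qed.

Lemma continuous_borel (X Y : ptopologicalType) (f : X -> Y) : continuous f ->
  measurable_fun setT (f : borel X -> borel Y).
Proof.
move=> cf; apply: (@measurability _ _ (borel X) (borel Y) setT f open) => //.
move=> _ [U oU <-]; rewrite setTI; apply: open_borel.
by apply: open_comp => // x _; exact: cf.
Qed.

Lemma continuous_borel_real (X : ptopologicalType) (f : X -> R) : continuous f ->
  measurable_fun setT (f : borel X -> R).
Proof.
move=> cf; apply: (@measurability _ _ (borel X) R setT f _ (RGenOpens.measurableE R)).
move=> _ [_ [a [b ->] <-]]; rewrite setTI; apply: open_borel.
by apply: open_comp => [x _|]; [exact: cf|exact: interval_open].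
Qed.

End BorelMeasurability.

Section Haar.
Context (R : realType) (G : topologicalGroupType).
Context (mu : {measure set (borel G) -> \bar R}) (K : set G).
Hypotheses (hG : hausdorff_space G) (lG : locally_compact [set: G]).
Hypotheses (hmu : left_haar mu) (sK : compact_subgroup K).
Implicit Types (x y : G) (A B C O V W : set G).

Lemma compact_borel C : compact C -> measurable (C : set (borel G)).
Proof. by move=> cC; apply: closed_borel; exact: compact_closed. Qed.

Lemma haar_translate x A : measurable (A : set (borel G)) ->
  mu ([set y | A (x^-1 * y)%g] : set (borel G)) = mu A.
Proof. by case: hmu => _ _ tr mA; rewrite -lcosetE; exact: tr. Qed.

Lemma haar_compact C : compact C -> (mu C < +oo)%E.
Proof. by case: hmu => -[fin _ _] _ _ cC; apply: fin. Qed.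

Lemma measurable_translate x A : measurable (A : set (borel G)) ->
  measurable ([set y | A (x * y)%g] : set (borel G)).
Proof.
move=> mA; have cx : continuous (fun y => x * y)%g.
  by apply: continuous_mulg; [exact: continuous_cstg|exact: continuous_idg].
by rewrite -[X in measurable X]setTI; apply: (continuous_borel cx).
Qed.

Lemma compact_neighbourhood : exists2 C, compact C & nbhs (1%g : G) C.
Proof.
have [C nC [cC _]] := lG (x := 1%g : G) Logic.I.
by exists C => //; move: nC; rewrite /within/=; apply: filterS => x; exact.
Qed.

(** A nonempty open null set would make every compact set null, being covered
    by finitely many translates, and then the whole group by inner regularity. *)
Lemma haar_open_gt0 O : open O -> O !=set0 -> (0 < mu O)%E.
Proof.
move=> oO [a Oa]; rewrite lt_neqAle measure_ge0 andbT eq_sym; apply/eqP => O0.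
have [[_ _ inner_reg] muT _] := hmu; apply: muT.
have cptn C : compact C -> mu C = 0%E.
  move=> cC.
  have oF x : open [set y | O (a * (x^-1 * y))%g].
    apply: (@open_compg _ _ _ O) => //; apply: continuous_mulg; first exact: continuous_cstg.
    by apply: continuous_mulg; [exact: continuous_cstg|exact: continuous_idg].
  have [|s sC] := compact_cover_seq (F := fun x => [set y | O (a * (x^-1 * y))%g]) cC oF.
    by move=> x /=; rewrite mulVg mulg1.
  have sN : mu.-negligible (\bigcup_i [set y | O (a * ((nth 1%g s i)^-1 * y))%g] : set (borel G)).
    apply: negligible_bigcup => i; apply/negligibleP; first exact: open_borel.
    rewrite -[RHS]O0 -(haar_translate (nth 1%g s i * a^-1)%g (open_borel oO)).
    by congr (mu _); apply/seteqP; split=> y /=; rewrite invgM invgK !mulgA.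
  apply/negligibleP; first exact: compact_borel.
  apply: negligibleS sN => y /sC[x xs Oxy]; exists (index x s) => //=.
  by rewrite nth_index.
rewrite inner_reg; last by exists setT; [exact: openT|rewrite setIT].
rewrite (_ : [set _ | _ in _] = [set 0%E]) ?ereal_sup1//.
apply/seteqP; split=> [_ [C [cC _] <-]|_ ->] /=; first exact: cptn.
by exists set0; [split=> //; exact: compact0|exact: measure0].
Qed.

(** The sets whose indicator functions are bi-invariant and square-integrable; they are
    what separability of [L^2(G//K)] can be applied to. *)
Definition good V := [/\ open V, bi_stable K V & (mu V < +oo)%E].

Lemma good_borel V : good V -> measurable (V : set (borel G)).
Proof. by case=> oV _ _; exact: open_borel. Qed.

Lemma le_haar A B : measurable (A : set (borel G)) -> measurable (B : set (borel G)) ->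
  A `<=` B -> (mu A <= mu B)%E.
Proof. by move=> mA mB AB; apply: le_measure; rewrite ?inE. Qed.

Lemma good_compact O C : open O -> bi_stable K O -> O `<=` C -> compact C -> good O.
Proof.
move=> oO bO OC cC; split=> //; apply: le_lt_trans (haar_compact cC).
by apply: le_haar => //; [exact: open_borel|exact: compact_borel].
Qed.

Lemma good_neighbourhood : exists V C,
  [/\ open V, bi_stable K V, K `<=` V, V `<=` C & compact C].
Proof.
have [C cC nC] := compact_neighbourhood; have [cK K1 _] := sK.
exists (sat K (interior C)), (setg (setg K C) K); split.
- by apply: open_sat; exact: open_interior.
- exact: bi_stable_sat.
- move=> k Kk; exists (k^-1, 1)%g => /=; last by rewrite mulVg mulg1.
  by split=> //; exact: (subgroupV sK).
- move=> x [[k k'] [/= Kk Kk'] /interior_subset Cx].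
  exists (k^-1 * (k * x * k'), k'^-1)%g => /=; last by rewrite !mulgA mulVg mul1g mulgK.
  split=> /=; last exact: (subgroupV sK).
  by exists (k^-1, k * x * k')%g => //=; split=> //=; exact: (subgroupV sK).
- by do 2?[apply: compact_setg => //].
Qed.

Definition char_fun V : G -> R[i] := fun x => (\1_V x)%:C.

Lemma cmeasurable_char V : measurable (V : set (borel G)) ->
  cmeasurable (setT : set (borel G)) (char_fun V).
Proof. by move=> mV; apply: cmeasurable_real; exact: measurable_indic. Qed.

Lemma sqmod_char V x : sqmod (char_fun V x) = \1_V x.
Proof.
by rewrite /char_fun sqmod_real indicE; case: (_ \in _); rewrite ?expr1n ?expr0n.
Qed.

Lemma LpK_char V : good V -> LpK mu K 2 (char_fun V).
Proof.
move=> gV; have mV := good_borel gV; case: gV => oV bV fV; split.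
  apply/L2P; split; first exact: cmeasurable_char.
  by under eq_integral do rewrite sqmod_char; rewrite integral_indic// setIT.
move=> x k k' Kk Kk'; rewrite /char_fun !indicE; congr (_%:R%:C).
by congr (nat_of_bool _); apply/idP/idP; rewrite !inE => /(bi_stableE sK bV _ Kk Kk').
Qed.

Lemma hnorm_char_diff V W A : good V -> good W -> measurable (A : set (borel G)) ->
  (forall x, A x -> ~ (V x <-> W x)) ->
  (mu A <= (hnorm (inner mu) (char_fun V - char_fun W) ^+ 2)%:E)%E.
Proof.
move=> gV gW mA AVW; have [[LV _] [LW _]] := (LpK_char gV, LpK_char gW).
have LVW := linear_subsetB (linear_L2 mu) LV LW.
rewrite hnorm_L2//; rewrite -(setIT A) -integral_indic//.
have [mVW _] := (L2P mu _).1 LVW.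
apply: le_integral_ge0.
- by apply/measurable_EFinP; exact: measurable_indic.
- exact: measurable_sqmodE.
- by move=> x; rewrite lee_fin indicE.
move=> x; rewrite lee_fin indicE; case: (boolP (x \in A)) => [|_]; last exact: sqmod_ge0.
rewrite inE => /AVW nVW; rewrite !fctE /char_fun !indicE -rmorphB/= sqmod_real.
case: (boolP (x \in V)); case: (boolP (x \in W)); rewrite ?inE => Wx Vx.
- by exfalso; apply: nVW.
- by rewrite subr0 expr1n.
- by rewrite sub0r sqrrN expr1n.
- by exfalso; apply: nVW; move: Wx Vx; rewrite !notin_setE; split.
Qed.

End Haar.

(** * Consequences of separability *)

(** Separability passes to subsets, here to an indexed family. *)
Lemma separable_subfamily (R : realType) (V : lmodType R[i])
    (ip : V -> V -> R[i]) (E H : set V) (I : Type) (i0 : I) (P : I -> V) :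
  linear_subset E -> semi_inner_product ip E -> H `<=` E ->
  Defs.separable ip H -> (forall i, H (P i)) ->
  exists j : nat -> I, forall i (e : R), 0 < e ->
    exists n, hnorm ip (P i - P (j n)) < e.
Proof.
move=> Elin ipE HE [D [HD Dd]] HP.
have /choice[j jP] : forall q : nat * nat, exists i,
    (exists i', hnorm ip (P i' - D q.1) < q.2.+1%:R^-1) ->
    hnorm ip (P i - D q.1) < q.2.+1%:R^-1.
  move=> q; have [[i' hi]|h] := pselect (exists i', hnorm ip (P i' - D q.1) < q.2.+1%:R^-1).
    by exists i'.
  by exists i0.
exists (fun n => if unpickle n is Some q then j q else i0) => i e e0.
have e2 : 0 < e / 2 by rewrite divr_gt0.
have [N _ hN] := near_infty_natSinv_lt (PosNum e2).
have dN : 0 < N.+1%:R^-1 :> R by rewrite invr_gt0.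
have [n Pn] := Dd _ (HP i) _ dN.
exists (pickle (n, N)); rewrite pickleK.
have := jP (n, N) (ex_intro _ i Pn) => /= jn.
apply: le_lt_trans (ler_hdist Elin ipE (HE _ (HP _)) (HE _ (HD n)) (HE _ (HP _))) _.
rewrite (hnorm_sym Elin ipE (HE _ (HD n)) (HE _ (HP _))) (splitr e).
by apply: ltrD; [apply: lt_trans Pn _|apply: lt_trans jn _]; exact: (hN N (leqnn N)).
Qed.

(** First countability of [G/K] at the base point, phrased with subsets of [G]. *)
Record neighbourhood_base (G : topologicalGroupType) (K : set G)
    (U : nat -> set G) : Prop := {
  base_open : forall n, open (U n) ;
  base_stable : forall n, bi_stable K (U n) ;
  base_subgroup : forall n, K `<=` U n ;
  baseV : forall n x, U n x -> U n x^-1%g ;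
  base_mono : forall n p, (n <= p)%N -> U p `<=` U n ;
  base_basis : forall W, open W -> K `<=` W -> exists n, U n `<=` W }.

Section Separable.
Context (R : realType) (G : topologicalGroupType).
Context (mu : {measure set (borel G) -> \bar R}) (K : set G).
Hypotheses (hG : hausdorff_space G) (lG : locally_compact [set: G]).
Hypotheses (hmu : left_haar mu) (sK : compact_subgroup K).
Hypothesis hsep : Defs.separable (inner mu) (LpK mu K 2).
Implicit Types (x y : G) (A B C O V W : set G).

Let LpK_L2 : LpK mu K 2 `<=` (Lp mu setT 2 : set (G -> R[i])).
Proof. by move=> f []. Qed.

Let subfamily := fun I i0 P HP => @separable_subfamily R _ (inner mu) _ (LpK mu K 2) I i0 P
  (linear_L2 mu) (semi_inner_product_L2 mu) LpK_L2 hsep HP.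

(** The sets [K x V], for a bi-stable [V], are bi-stable of measure at least that of [V]:
    if the indicators of two of them are at small distance then they meet, so
    countably many of the compact sets [K x C C^-1] cover the group. *)
Lemma sigma_compact : exists D : nat -> set G,
  (forall n, compact (D n)) /\ forall x, exists n, D n x.
Proof.
have [V [C [oV bV KV VC cC]]] := good_neighbourhood lG sK.
have [cK K1 _] := sK.
have V1 : V 1%g by exact: KV.
have gV := good_compact hG hmu oV bV VC cC.
pose A x := [set y | exists2 k, K k & V (x^-1 * (k * y))%g].
have cf x : continuous (fun q : G * G => x^-1 * (q.2 * q.1))%g.
  apply: continuous_mulg; first exact: continuous_cstg.
  by apply: continuous_mulg; [exact: continuous_sndg|exact: continuous_fstg].
have oA x : open (A x) by exact: (open_exists _ (cf x) oV).
have bA x : bi_stable K (A x).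
  move=> y k k' Kk Kk' [k1 Kk1 Vy]; exists (k1 * k^-1)%g.
    by apply: (subgroupM sK) => //; exact: (subgroupV sK).
  by rewrite !mulgA mulgVK -!mulgA mulgA mulgA; apply: (bi_stable_r sK bV) => //; rewrite -!mulgA.
have gA x : good mu K (A x).
  apply: (good_compact hG hmu (oA x) (bA x) (C := setg K (setg [set x] C))).
    move=> y [k Kk Vy]; exists (k^-1, k * y)%g => /=; last by rewrite mulKg.
    split=> /=; first exact: (subgroupV sK).
    exists (x, x^-1 * (k * y))%g => /=; last by rewrite mulVKg.
    by split=> //=; exact: VC.
  by apply: compact_setg => //; apply: compact_setg => //; exact: compact_set1.
have [j jP] := subfamily (1%g : G) (fun x => LpK_char sK (gA x)).
exists (fun n => setg K (setg [set j n] (setg C [set y^-1%g | y in C]))); split.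
  have cCV : compact [set y^-1%g | y in C].
    by apply: compact_image => //; apply: continuous_invg; exact: continuous_idg.
  move=> n; apply: compact_setg => //; apply: compact_setg; first exact: compact_set1.
  exact: compact_setg.
have Vpos : 0 < fine (mu V).
  apply: fine_gt0; rewrite haar_open_gt0//; last by exists 1%g.
  by case: gV.
have Vfin : mu V = (fine (mu V))%:E by rewrite fineK// ge0_fin_numE//; case: gV.
move=> x; have s0 : 0 < Num.sqrt (fine (mu V)) by rewrite sqrtr_gt0.
have [n nx] := jP x _ s0; exists n.
have [y [Ay Ajy]] : exists y, A x y /\ A (j n) y.
  apply/not_existsP => dis.
  have mV : (mu V <= mu (A x))%E.
    rewrite -(haar_translate hmu x (good_borel gV)); apply: le_haar.
    - by apply: measurable_translate; exact: good_borel gV.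
    - exact: good_borel (gA x).
    - by move=> y Vy; exists 1%g => //; rewrite mul1g.
  have AA y : A x y -> ~ (A x y <-> A (j n) y).
    by move=> Axy AA; apply: (dis y); split=> //; exact/AA.
  have := le_trans mV (hnorm_char_diff sK (gA x) (gA (j n)) (good_borel (gA x)) AA).
  rewrite Vfin lee_fin leNgt => /negP; apply.
  by rewrite -[ltRHS]sqr_sqrtr ?ltW// ltr_pXn2r// nnegrE ?hnorm_ge0 ?sqrtr_ge0.
have [k Kk Va] := Ay; have [k1 Kk1 Vb] := Ajy.
exists (k * k1^-1, j n * (((j n)^-1 * (k1 * y)) * (x^-1 * (k * y))^-1))%g => /=.
  split=> /=; first by apply: (subgroupM sK) => //; exact: (subgroupV sK).
  exists (j n, ((j n)^-1 * (k1 * y)) * (x^-1 * (k * y))^-1)%g => //=; split=> //=.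
  exists ((j n)^-1 * (k1 * y), (x^-1 * (k * y))^-1)%g => //=; split=> /=; first exact: VC.
  by exists (x^-1 * (k * y))%g => //; exact: VC.
by rewrite !invgM invgK !mulgA !mulgK mulgVK mulgV mul1g.
Qed.

Lemma haar_sigma_finite : sigma_finite (setT : set (borel G)) mu.
Proof.
have [D [cD DT]] := sigma_compact; exists D.
  by apply/seteqP; split=> // x _; have [n Dx] := DT x; exists n.
by move=> n; split; [exact: compact_borel|exact: haar_compact].
Qed.

Lemma lindelof O : open O -> O 1%g ->
  exists x : nat -> G, forall y, exists n, O ((x n)^-1 * y)%g.
Proof.
move=> oO O1; have [D [cD DT]] := sigma_compact.
have oF x : open [set y | O (x^-1 * y)%g].
  apply: (@open_compg _ _ _ O) => //; apply: continuous_mulg; first exact: continuous_cstg.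
  exact: continuous_idg.
have /choice[s sP] : forall n, exists s : seq G,
    forall y, D n y -> exists2 x, x \in s & O (x^-1 * y)%g.
  move=> n; apply: (compact_cover_seq (F := fun x => [set y | O (x^-1 * y)%g])) => // x.
  by rewrite /= mulVg.
exists (fun m => if unpickle m is Some q then nth 1%g (s q.1) q.2 else 1%g) => y.
have [n /sP[x xs Oxy]] := DT y.
by exists (pickle (n, index x (s n))); rewrite pickleK /= nth_index.
Qed.

Let open_in_setT V : open V -> open_in setT V.
Proof. by move=> oV; exists V => //; rewrite setIT. Qed.

(** By inner regularity a compact subset [C] of [V] fills it up to [e], and [x C] is
    still contained in [V] for [x] near [K]. *)
Lemma haar_overlap V (e : R) : good mu K V -> 0 < e -> exists W,
  [/\ open W, K `<=` W & forall x, W x ->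
    (mu V - e%:E <= mu ([set y | V (x^-1 * y)%g] `&` V : set (borel G)))%E].
Proof.
move=> gV e0; have [oV bV Vfin] := gV; have [[_ _ inner_reg] _ _] := hmu.
have muVfin : mu V \is a fin_num by rewrite ge0_fin_numE.
have := inner_reg V (open_in_setT oV).
set S := [set mu C | C in _] => muS.
have [|_ [C [cC CV] <-] muC] := @ub_ereal_sup_adherent _ S _ e0; first by rewrite -muS.
exists [set x | forall c, C c -> V (x * c)%g]; split.
- exact: (open_forall cC (@mulg_continuous G) oV).
- by move=> k Kk c /CV; exact: (bi_stable_l sK).
move=> x CxV; apply: le_trans (ltW _) _; first by rewrite muS; exact: muC.
have mC := compact_borel hG cC.
have mV := good_borel gV.
rewrite -(haar_translate hmu x mC); apply: le_haar.
- exact: measurable_translate.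
- by apply: measurableI => //; exact: measurable_translate.
- by move=> y Cy; split; [exact: CV|have := CxV _ Cy; rewrite /= mulVKg].
Qed.

(** For [x] outside [W] and [V V^-1 <= W], the sets [x V] and [V] are disjoint;
    so [x V'] and [V'] overlap little as soon as [V'] is close to [V] in measure.
    Countably many sets [V'] are close to all of the sets [V]. *)
Lemma countable_base : exists Ws : nat -> set G,
  (forall n, open (Ws n) /\ K `<=` Ws n) /\
  forall W, open W -> K `<=` W -> exists n, Ws n `<=` W.
Proof.
have [V0 [C [oV0 bV0 KV0 VC cC]]] := good_neighbourhood lG sK.
have gV0 := good_compact hG hmu oV0 bV0 VC cC.
have [cK K1 _] := sK.
pose I := {V : set G | good mu K V}.
have [j jP] := subfamily (exist _ V0 gV0 : I) (fun i : I => LpK_char sK (svalP i)).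
pose Vs n := sval (j n); have gVs n : good mu K (Vs n) := svalP (j n).
have finE V : good mu K V -> mu V = (fine (mu V))%:E.
  by move=> [_ _ fV]; rewrite fineK// ge0_fin_numE.
have /choice[Ws WsP] : forall n, exists W, [/\ open W, K `<=` W &
    0 < fine (mu (Vs n)) -> forall x, W x ->
    (mu (Vs n) - (fine (mu (Vs n)) / 4)%:E <=
       mu ([set y | Vs n (x^-1 * y)%g] `&` Vs n : set (borel G)))%E].
  move=> n; have [v0|v0] := ltP 0 (fine (mu (Vs n))); last first.
    by exists setT; split; [exact: openT|by []|by []].
  by have [W [oW KW h]] := haar_overlap (gVs n) (divr_gt0 v0 (ltr0Sn R 3)); exists W.
exists Ws; split; first by move=> n; case: (WsP n).
(* With [V] of measure [v] and [V'] within [v/8] of it, the overlap of [x V'] and [V'] is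
   at most [v/4] for [x] outside of [W], and at least [3/4] of [7v/8] for [x] in [Ws n]. *)
move=> W oW KW; have [V1 [oV1 bV1 KV1 V1W]] := square_root_nbhs sK oW KW.
pose V := V1 `&` V0.
have gV : good mu K V.
  apply: (good_compact hG hmu (C := C)) => //; first exact: openI.
    by move=> x k k' Kk Kk' [? ?]; split; [exact: bV1|exact: bV0].
  by move=> x [_ /VC].
have V1g : V 1%g by split; [exact: KV1|exact: KV0].
pose v := fine (mu V); have v0 : 0 < v.
  apply: fine_gt0; rewrite haar_open_gt0//; [|by case: gV|by exists 1%g].
  by case: gV.
have v8 : 0 < Num.sqrt (v / 8) by rewrite sqrtr_gt0 divr_gt0.
have [n nV] := jP (exist _ V gV) _ v8; exists n; move: nV => /=; rewrite -/(Vs n).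
set N := hnorm _ _ => nV.
have N8 : N ^+ 2 < v / 8.
  rewrite -[ltRHS]sqr_sqrtr ?divr_ge0 ?ltW//.
  by rewrite ltr_pXn2r// nnegrE ?hnorm_ge0 ?sqrtr_ge0.
have [mV mVs] := (good_borel gV, good_borel (gVs n)).
have dV : (mu (V `\` Vs n) <= (N ^+ 2)%:E)%E.
  apply: (hnorm_char_diff sK) => //; first exact: measurableD.
  by move=> x [Vx nx] [] /(_ Vx).
have dVs : (mu (Vs n `\` V) <= (N ^+ 2)%:E)%E.
  apply: (hnorm_char_diff sK) => //; first exact: measurableD.
  by move=> x [Vx nx] [] _ /(_ Vx).
pose w := fine (mu (Vs n)).
have vw : v <= v / 8 + w.
  rewrite -lee_fin EFinD -!finE//; apply: (@le_trans _ _ (mu ((V `\` Vs n) `|` Vs n))).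
    apply: le_haar => //; first by apply: measurableU => //; exact: measurableD.
    by move=> x Vx; have [?|?] := pselect (Vs n x); [right|left].
  apply: (le_trans (measureU2 mu (measurableD mV mVs) mVs)).
  by rewrite leeD2r// (le_trans dV)// lee_fin ltW.
have w0 : 0 < w by move: vw v0; lra.
have [_ _ /(_ w0) Wsn] := WsP n.
move=> x Wsx; apply: contrapT => nWx; have := Wsn x Wsx; apply/negP; rewrite -ltNge.
have mx A : measurable (A : set (borel G)) ->
  measurable ([set y | A (x^-1 * y)%g] : set (borel G)) by exact: measurable_translate.
have mD : measurable (Vs n `\` V : set (borel G)) by exact: measurableD.
apply: (@le_lt_trans _ _ (mu ([set y | (Vs n `\` V) (x^-1 * y)%g] `|` (Vs n `\` V)))).
  apply: le_haar; first by apply: measurableI => //; exact: mx.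
    by apply: measurableU => //; exact: mx.
  move=> y [Vxy Vy].
  have [Vy'|?] := pselect (V y); last by right.
  left; split=> // Vxy'; apply: nWx.
  by have := V1W _ _ Vy'.1 Vxy'.1; rewrite invgM invgK mulVKg.
have U2 : (mu ([set y | (Vs n `\` V) (x^-1 * y)%g] `|` (Vs n `\` V)) <=
    mu [set y | (Vs n `\` V) (x^-1 * y)%g] + mu (Vs n `\` V))%E.
  exact: (measureU2 mu (mx _ mD) mD).
apply: (le_lt_trans U2); have -> := haar_translate hmu x mD.
apply: (@le_lt_trans _ _ ((v / 8 + v / 8)%:E)).
  by rewrite EFinD; apply: leeD; rewrite (le_trans dVs)// lee_fin ltW.
rewrite finE// -EFinB lte_fin /= -/w; move: vw v0; lra.
Qed.

Lemma neighbourhood_base_exists : exists U, neighbourhood_base K U.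
Proof.
have [Ws [WsP Wsb]] := countable_base; have [cK K1 _] := sK.
pose cap n := [set x | forall i, (i <= n)%N -> Ws i x].
have ocap n : open (cap n).
  rewrite openE => x cx; apply: (@filterS _ _ _ [set y | forall i : 'I_n.+1, Ws i y]).
    by move=> y yW i; rewrite -ltnS => ile; exact: (yW (Ordinal ile)).
  apply: (@filter_forall G 'I_n.+1 (fun i => Ws i) _ (nbhs_filter x)) => i.
  apply: open_nbhs_nbhs; split; first by case: (WsP i).
  by apply: cx; rewrite -ltnS.
pose sym n := cap n `&` [set x | cap n x^-1%g].
have osym n : open (sym n).
  apply: openI => //; apply: (open_compg _ (ocap n)).
  by apply: continuous_invg; exact: continuous_idg.
have Ksym n : K `<=` sym n.
  move=> k Kk; split=> i _; have [_] := WsP i; apply => //.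
  exact: (subgroupV sK).
exists (fun n => core K (sym n)); split.
- by move=> n; exact: (open_core sK).
- by move=> n; exact: (bi_stable_core sK).
- move=> n; apply: sub_core; last exact: Ksym.
  exact: bi_stable_subgroup.
- move=> n x cx [a b] [/= Ka Kb].
  have := cx (b^-1, a^-1)%g (conj (subgroupV sK Kb) (subgroupV sK Ka)).
  move=> [c1 c2]; split=> /=.
    by move: c2; rewrite /= !invgM !invgK mulgA.
  by rewrite /= !invgM invgK mulgA; exact: c1.
- move=> n p np x cx q Kq; have [c1 c2] := cx q Kq.
  by split=> i /leq_trans/(_ np); [exact: c1|exact: c2].
- move=> W oW /(Wsb _ oW)[n nW]; exists n => x /core_sub-/(_ sK)[/(_ n (leqnn n)) + _].
  exact: nW.
Qed.

End Separable.

(** * Joint measurability on the group *)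

Section JointMeasurability.
Context (R : realType) (G : topologicalGroupType).
Context (K : set G) (sK : compact_subgroup K).
Context (U : nat -> set G) (bU : neighbourhood_base K U).
Hypothesis lind : forall O : set G, open O -> O 1%g ->
  exists x : nat -> G, forall y, exists n, O ((x n)^-1 * y)%g.
Implicit Types (x y t : G) (A O W : set G).

Let K1 : K 1%g. Proof. by case: sK. Qed.

Definition right_stable O := forall x k, K k -> O x -> O (x * k)%g.

Let centers : exists c : nat -> nat -> G,
  forall n y, exists j, U n ((c n j)^-1 * y)%g.
Proof.
have /choice[c cP] : forall n, exists c : nat -> G,
    forall y, exists j, U n ((c j)^-1 * y)%g.
  move=> n; apply: lind; first exact: (base_open bU).
  exact: (base_subgroup bU).
by exists c.
Qed.

Lemma base_at x O : open O -> (forall k, K k -> O (x * k)%g) ->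
  exists n, forall y, U n (x^-1 * y)%g -> O y.
Proof.
move=> oO OK; have oW : open [set y | O (x * y)%g].
  apply: (@open_compg _ _ _ O) => //; apply: continuous_mulg; first exact: continuous_cstg.
  exact: continuous_idg.
have [n nW] := base_basis bU oW OK; exists n => y /nW /=.
by rewrite mulVKg.
Qed.

Let measurable_left x n : measurable ([set y | U n (x^-1 * y)%g] : set (borel G)).
Proof. by apply: measurable_translate; apply: open_borel; exact: (base_open bU). Qed.

(** Approximate [f x z] by its value at the first center [c] of generation [n]
    such that [x] belongs to [c U_n]. *)
Lemma caratheodory d (Z : measurableType d) (f : G -> Z -> R) :
  (forall z, continuous (f^~ z)) -> (forall x k z, K k -> f (x * k)%g z = f x z) ->
  (forall x, measurable_fun setT (f x)) ->
  measurable_fun setT (fun p : borel G * Z => f p.1 p.2).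
Proof.
move=> cf fK mf; have [c cP] := centers.
pose B n j := [set y : borel G | U n ((c n j)^-1 * y)%g].
have ex n y : exists j, `[< B n j y >].
  by have [j Uj] := cP n y; exists j; apply/asboolP.
pose idx n y := ex_minn (ex n y).
have idxP n y : B n (idx n y) y.
  by rewrite /idx; case: ex_minnP => j /asboolP.
have midx n j : measurable ([set y | idx n y = j] : set (borel G)).
  have -> : [set y | idx n y = j] = B n j `\` \bigcup_(i in [set i | (i < j)%N]) B n i.
    apply/seteqP; split=> y.
      move=> <-; split; first exact: idxP.
      move=> [i /= + Bi]; rewrite /idx; case: ex_minnP => l _ /(_ i).
      by move=> /(_ (asboolT Bi)) li il; rewrite leqNgt il in li.
    move=> [Bj nB]; rewrite /= /idx; case: ex_minnP => l /asboolP Bl lmin.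
    apply/eqP; rewrite eqn_leq lmin ?asboolT//= leqNgt; apply/negP => lj.
    by apply: nB; exists l.
  apply: measurableD; first exact: measurable_left.
  by apply: bigcup_measurable => i _; exact: measurable_left.
apply: (@measurable_fun_cvg _ (borel G * Z)%type R setT
  (fun n (p : borel G * Z) => f (c n (idx n p.1)) p.2)).
  move=> n _ Y mY; rewrite setTI.
  have -> : (fun p : borel G * Z => f (c n (idx n p.1)) p.2) @^-1` Y =
      \bigcup_j ([set y | idx n y = j] `*` (f (c n j) @^-1` Y)).
    apply/seteqP; split=> [[y z] /= Yf|[y z] [j _ [/= -> //]]].
    by exists (idx n y).
  apply: bigcupT_measurable => j; apply: measurableX => //.
  by rewrite -[X in measurable X]setTI; exact: mf.
move=> [y z] _ /=; apply/cvgrPdist_lt => e e0.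
have oO : open [set x | `|f y z - f x z| < e].
  have -> : [set x | `|f y z - f x z| < e] = f^~ z @^-1` ball (f y z) e by [].
  by apply: open_comp => [x _|]; [exact: cf|exact: ball_open].
have [|n nO] := base_at (x := y) oO.
  by move=> k Kk; rewrite /= fK// subrr normr0.
exists n => // p np; apply: nO; apply: (base_mono bU np).
by have := baseV bU (idxP p y); rewrite invgM invgK.
Qed.

(** The set is a countable union of products of open sets: if [t^-1 x] is in [O], then
    for some [n] and some center [c] close to [x] all of [t^-1 c U_n] is in [O]. *)
Lemma joint_open O : open O -> right_stable O ->
  measurable [set p : borel G * borel G | O (p.1^-1 * p.2)%g].
Proof.
move=> oO rO; have [c cP] := centers.
pose On n := interior [set y | forall u, U n u -> O (y * u)%g].
have -> : [set p : borel G * borel G | O (p.1^-1 * p.2)%g] = \bigcup_n \bigcup_j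
    ([set t : borel G | On n (t^-1 * c n j)%g] `*`
     [set x : borel G | U n ((c n j)^-1 * x)%g]).
  apply/seteqP; split=> [[t x] /= Otx|[t x] [n _ [j _ [/= /interior_subset Ot Ux]]]]; last first.
    by have := Ot _ Ux; rewrite -mulgA mulVKg.
  set y := (t^-1 * x)%g in Otx.
  have oW : open [set v | O (y * v)%g].
    apply: (@open_compg _ _ _ O) => //; apply: continuous_mulg; first exact: continuous_cstg.
    exact: continuous_idg.
  have [V [oV bV KV VW]] := square_root_nbhs sK oW (fun k Kk => rO _ _ Kk Otx).
  have [V' [oV' bV' KV' VV]] := square_root_nbhs sK oV KV.
  have [n nV] := base_basis bU oV' KV'; have [j jx] := cP n x.
  exists n => //; exists j => //; split=> //=.
  have U1 : U n 1%g := base_subgroup bU n K1.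
  pose v := (x^-1 * c n j)%g.
  have Uv : U n v by have := baseV bU jx; rewrite invgM invgK.
  have -> : (t^-1 * c n j = y * v)%g by rewrite /y /v mulgA mulgK.
  apply: (@filterS _ _ _ [set z | U n ((y * v)^-1 * z)%g]).
    move=> z Uz u Uu; set w := ((y * v)^-1 * z)%g in Uz.
    have -> : (z * u = y * (v * w * (u^-1)^-1))%g.
      by rewrite invgK mulgA (mulgA y) /w mulVKg.
    apply: VW; last first.
      rewrite -[(u^-1)%g]mulg1 -[1%g]invg1; apply: VV; first by apply: nV; exact: (baseV bU).
      exact: nV.
    by rewrite -[w]invgK; apply: VV; [exact: nV|apply: nV; exact: (baseV bU)].
  apply: open_nbhs_nbhs; split; last by rewrite /= mulVg.
  apply: (@open_compg _ _ _ (U n)); last exact: (base_open bU).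
  by apply: continuous_mulg; [exact: continuous_cstg|exact: continuous_idg].
apply: bigcupT_measurable => n; apply: bigcupT_measurable => j.
apply: measurableX; last exact: measurable_left.
apply: open_borel; apply: (@open_compg _ _ _ (On n)); last exact: open_interior.
apply: continuous_mulg; last exact: continuous_cstg.
by apply: continuous_invg; exact: continuous_idg.
Qed.

End JointMeasurability.

(** Measurability for the product of the Borel sigma-algebras, which without second
    countability may be smaller than the Borel sigma-algebra of the product: even open
    sets [A] do not satisfy this in general. *)
Definition jointly_measurable (G : topologicalGroupType) (A : set G) :=
  measurable [set p : borel G * borel G | A (p.1^-1 * p.2)%g].

Section JointlyMeasurableSets.
Context (G : topologicalGroupType).
Implicit Types (A B : set G).
Local Notation jm := (@jointly_measurable G).

Lemma jointly_measurableC A : jm A -> jm (~` A).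
Proof. exact: measurableC. Qed.

Lemma jointly_measurable_bigcup (F : nat -> set G) (P : set nat) :
  (forall n, P n -> jm (F n)) -> jm (\bigcup_(n in P) F n).
Proof.
move=> jF; rewrite /jointly_measurable.
have -> : [set p : borel G * borel G | (\bigcup_(n in P) F n) (p.1^-1 * p.2)%g] =
    \bigcup_(n in P) [set p | F n (p.1^-1 * p.2)%g] by [].
by apply: bigcup_measurable => n /jF.
Qed.

Lemma jointly_measurable_bigcap (F : nat -> set G) :
  (forall n, jm (F n)) -> jm (\bigcap_n F n).
Proof.
move=> jF; rewrite -[\bigcap_n _]setCK setC_bigcap; apply: jointly_measurableC.
by apply: jointly_measurable_bigcup => n _; exact: jointly_measurableC.
Qed.

Lemma jointly_measurableD A B : jm A -> jm B -> jm (A `\` B).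
Proof. exact: measurableD. Qed.

Lemma jointly_measurableU A B : jm A -> jm B -> jm (A `|` B).
Proof. exact: measurableU. Qed.

End JointlyMeasurableSets.

Section Modification.
Context (R : realType) (G : topologicalGroupType).
Context (mu : {measure set (borel G) -> \bar R}) (K : set G).
Hypotheses (hmu : left_haar mu) (sK : compact_subgroup K).
Hypothesis joint : forall O : set G, open O -> right_stable K O ->
  jointly_measurable O.
Implicit Types (x y t : G) (A O W : set G).
Local Notation jm := (@jointly_measurable G).

Lemma haar_outer A (e : R) : measurable (A : set (borel G)) -> (mu A < +oo)%E ->
  0 < e -> exists W, [/\ open W, A `<=` W & (mu W <= mu A + e%:E)%E].
Proof.
have [[_ outer _] _ _] := hmu => mA Afin e0.
have ST : open_in [set: G] = open.
  apply/seteqP; split=> [_ [V oV <-]|V oV]; first by rewrite setIT.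
  by exists V => //; rewrite setIT.
have sA : <<s open_in [set: G] >> A by rewrite ST.
have := outer A sA (@subsetT _ A); set S := [set mu V | V in _] => muS.
have [|_ [W [oW AW] <-] muW] := @lb_ereal_inf_adherent _ S _ e0.
  by rewrite -muS ge0_fin_numE.
exists W; split=> //; first by rewrite ST in oW.
by rewrite muS ltW.
Qed.

(** Outer regularity gives open supersets of nearly the same measure; their bi-stable
    cores are open, contain [A] and are jointly measurable. *)
Lemma bi_stable_hull A : measurable (A : set (borel G)) -> bi_stable K A ->
  (mu A < +oo)%E -> exists A',
  [/\ jm A', bi_stable K A', measurable (A' : set (borel G)), A `<=` A' &
      mu (A' `\` A) = 0%E].
Proof.
move=> mA bA Afin.
have /choice[W WP] : forall n : nat, exists W,
    [/\ open W, A `<=` W & (mu W <= mu A + (n.+1%:R^-1)%:E)%E].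
  by move=> n; apply: haar_outer => //; rewrite invr_gt0.
have oc n : open (core K (W n)) by apply: (open_core sK); case: (WP n).
have bc n : bi_stable K (core K (W n)) by exact: (bi_stable_core sK).
exists (\bigcap_n core K (W n)); split.
- apply: jointly_measurable_bigcap => n; apply: joint; first exact: oc.
  by move=> x k Kk; exact: (bi_stable_r sK (bc n)).
- by move=> x k k' Kk Kk' Ax n _; apply: bc => //; exact: Ax.
- by apply: bigcapT_measurable => n; exact: open_borel.
- by move=> x Ax n _; apply: (sub_core bA) => //; case: (WP n).
apply/eqP; rewrite eq_le measure_ge0 andbT.
apply/lee_addgt0Pr => e e0; rewrite add0e.
have [N _ hN] := near_infty_natSinv_lt (PosNum e0).
have [oW AW muW] := WP N.
have mW := open_borel oW.
apply: (@le_trans _ _ (mu (W N `\` A))).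
  apply: le_haar.
  - by apply: measurableD => //; apply: bigcapT_measurable => n; exact: open_borel.
  - exact: measurableD.
  - by move=> x [Ax nAx]; split=> //; apply: (core_sub sK); exact: Ax.
rewrite measureD//; last by apply: le_lt_trans muW _; rewrite lte_add_pinfty ?ltry.
rewrite setIidr// leeBlDr; last by rewrite ge0_fin_numE.
apply: le_trans muW _; rewrite addeC leeD2r// lee_fin ltW//; exact: (hN N (leqnn N)).
Qed.

Lemma null_hull A : measurable (A : set (borel G)) -> bi_stable K A ->
  mu A = 0%E -> exists N,
  [/\ jm N, measurable (N : set (borel G)), A `<=` N & mu N = 0%E].
Proof.
move=> mA bA A0; have [|N [jN _ mN AN ND]] := bi_stable_hull mA bA; first by rewrite A0 ltry.
exists N; split=> //.
have -> : (mu N = mu (N `\` A) + mu (N `&` A))%E by exact: (measureDI mu mN mA).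
by rewrite ND add0e setIidr.
Qed.

(** Each level set [{g > q}], with [q > 0] rational, has a jointly measurable
    hull; the countable union [N] of null hulls of the differences is such that
    outside of any larger jointly measurable set all levels are jointly measurable. *)
Lemma modify_nonneg (g : G -> R) : (forall x, 0 <= g x) ->
  measurable_fun setT (g : borel G -> R) ->
  (forall x k k', K k -> K k' -> g (k * x * k')%g = g x) ->
  (forall q : R, 0 < q -> (mu ([set x | (q < g x)%R] : set (borel G)) < +oo)%E) ->
  exists N, [/\ jm N, measurable (N : set (borel G)), mu N = 0%E &
    forall M, jm M -> N `<=` M -> measurable_fun setT
      (fun p : borel G * borel G => g (p.1^-1 * p.2)%g * \1_(~` M) (p.1^-1 * p.2)%g)].
Proof.
move=> g0 mg gK gfin.
pose q (n : nat) : R := if unpickle n is Some r then ratr (r : rat) else 0.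
pose A n := [set x : G | q n < g x].
have mA n : measurable (A n : set (borel G)).
  have -> : A n = g @^-1` `]q n, +oo[%classic.
    by apply/seteqP; split=> x; rewrite /A /= in_itv/= andbT.
  by rewrite -[X in measurable X]setTI; apply: mg => //; exact: measurable_itv.
have bA n : bi_stable K (A n) by move=> x k k' Kk Kk'; rewrite /A /= gK.
have /choice[H HP] : forall n, exists H : set G * set G, 0 < q n ->
    [/\ jm H.1, A n `<=` H.1, jm H.2 & [/\ measurable (H.2 : set (borel G)),
        H.1 `\` A n `<=` H.2 & mu H.2 = 0%E]].
  move=> n; have [q0|q0] := ltP 0 (q n); last by exists (set0, set0).
  have [A' [jA' bA' mA' AA' AD]] := bi_stable_hull (mA n) (bA n) (gfin _ q0).
  have mD : measurable (A' `\` A n : set (borel G)) by exact: measurableD.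
  have bD : bi_stable K (A' `\` A n).
    move=> x k k' Kk Kk' [A'x nAx]; split; first exact: bA'.
    by move=> /(bi_stableE sK (bA n) _ Kk Kk').
  have [N [jN mN DN N0]] := null_hull mD bD AD.
  by exists (A', N) => _; split.
pose P := [set n | 0 < q n].
exists (\bigcup_(n in P) (H n).2); split.
- by apply: jointly_measurable_bigcup => n Pn; case: (HP n Pn).
- by apply: bigcup_measurable => n Pn; case: (HP n Pn) => _ _ _ [].
- have sub : (\bigcup_(n in P) (H n).2 : set (borel G)) `<=`
      \bigcup_n (if 0 < q n then (H n).2 else set0).
    by move=> x [n Pn Hx]; exists n => //; rewrite [0 < q n]Pn.
  have neg : mu.-negligible (\bigcup_(n in P) (H n).2 : set (borel G)).
    apply: negligibleS sub _; apply: negligible_bigcup => n.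
    case: ifPn => [Pn|_]; last exact: negligible_set0.
    by case: (HP n Pn) => _ _ _ [mH _ H0]; apply/negligibleP.
  apply/negligibleP => //; apply: bigcup_measurable => n Pn.
  by case: (HP n Pn) => _ _ _ [].
move=> M jM NM; set h := (fun p => _).
have h0 p : 0 <= h p by rewrite /h mulr_ge0// indicE.
apply: (measurability _ (RGenOInfty.measurableE R)) => //.
move=> _ [_ [r ->] <-]; rewrite setTI.
have [r0|r0] := ltP r 0.
  rewrite [X in measurable X](_ : _ = setT)//; apply/seteqP; split=> // p _.
  by rewrite /= in_itv/= andbT (lt_le_trans r0).
rewrite [X in measurable X](_ : _ = [set p : borel G * borel G |
    (\bigcup_(n in [set n | r < q n]) ((H n).1 `\` M)) (p.1^-1 * p.2)%g]).
  apply: jointly_measurable_bigcup => n rn; apply: jointly_measurableD => //.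
  by case: (HP n (le_lt_trans r0 rn)).
apply/seteqP; split=> p; rewrite /= in_itv/= andbT /h; set x := (p.1^-1 * p.2)%g.
  rewrite indicE; have [Mx|nMx] := pselect (M x).
    by rewrite memNset ?mulr0 ?ltNge ?r0//= => /(_ Mx).
  rewrite mem_set// mulr1 => rg.
  have [s] := rat_in_itvoo rg; rewrite in_itv/= => /andP[rs sg].
  have qs : q (pickle s) = ratr s by rewrite /q pickleK.
  exists (pickle s); first by rewrite /= qs.
  split=> //; have qp : 0 < q (pickle s) by rewrite qs (le_lt_trans r0).
  by case: (HP _ qp) => _ + _ _; apply; rewrite /A /= qs.
move=> [n /= rn [Hx nMx]]; have qp : 0 < q n by exact: le_lt_trans rn.
rewrite indicE mem_set// mulr1; apply: lt_trans rn _.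
have [//|nA] := pselect (A n x); exfalso; apply: nMx; apply: NM.
by exists n => //; case: (HP n qp) => _ _ _ [_ + _]; apply.
Qed.

(** The four parts of [F], positive and negative, real and imaginary, have level sets of
    finite measure because [F] is square-integrable. *)
Lemma modify_L2 (F : G -> R[i]) : LpK mu K 2 F ->
  exists N, [/\ jm N, measurable (N : set (borel G)), mu N = 0%E &
    cmeasurable setT (fun p : borel G * borel G =>
      F (p.1^-1 * p.2)%g * (\1_(~` N) (p.1^-1 * p.2)%g)%:C)].
Proof.
move=> [/L2P[mF Foo] FK]; have [mFr mFi] := mF.
pose pos (h : G -> R) x := Num.max (h x) 0.
have one (h : G -> R) : measurable_fun setT (h : borel G -> R) ->
    (forall x k k', K k -> K k' -> h (k * x * k')%g = h x) ->
    (forall x, (h x) ^+ 2 <= sqmod (F x)) ->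
    exists N, [/\ jm N, measurable (N : set (borel G)), mu N = 0%E &
    forall M, jm M -> N `<=` M -> measurable_fun setT (fun p : borel G * borel G =>
      pos h (p.1^-1 * p.2)%g * \1_(~` M) (p.1^-1 * p.2)%g)].
  move=> mh hK hF; have mp : measurable_fun setT (pos h : borel G -> R).
    by apply: measurable_maxr => //; exact: measurable_cst.
  apply: modify_nonneg => //.
  - by move=> x; rewrite le_max lexx orbT.
  - by move=> x k k' Kk Kk'; rewrite /pos hK.
  move=> q q0; set B := [set x | _].
  have mB : measurable (B : set (borel G)).
    have -> : B = pos h @^-1` `]q, +oo[%classic.
      by apply/seteqP; split=> x; rewrite /B /= in_itv/= andbT.
    by rewrite -[X in measurable X]setTI; apply: mp => //; exact: measurable_itv.
  have q2 : 0 < q ^+ 2 by rewrite exprn_gt0.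
  have : ((q ^+ 2)%:E * mu B <= \int[mu]_x (sqmod (F x))%:E)%E.
    rewrite -(setIT B) -integral_indic//.
    have mi : measurable_fun setT (fun x : borel G => (\1_B x : R)%:E).
      by apply/measurable_EFinP; exact: measurable_indic.
    rewrite -integralZ_ge0; [|exact: sqr_ge0|exact: mi|by move=> x; rewrite lee_fin indicE].
    apply: le_integral_ge0 => [||x|x].
    - exact: measurable_funeM.
    - exact: measurable_sqmodE.
    - by rewrite mule_ge0// lee_fin ?sqr_ge0// indicE.
    rewrite -EFinM lee_fin indicE; case: (boolP (x \in B)) => [|_]; last first.
      by rewrite mulr0 sqmod_ge0.
    rewrite inE /B /= /pos lt_max => /orP[qh|]; last by rewrite ltNge ltW.
    rewrite mulr1; apply: le_trans (hF x); rewrite ler_pXn2r ?nnegrE ?ltW//.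
    exact: lt_trans qh.
  rewrite ltey => le; apply/eqP => BB; move: le.
  by rewrite BB gt0_muley ?lte_fin// leye_eq => /eqP E; move: Foo; rewrite E ltxx.
have hr x : complex.Re (F x) ^+ 2 <= sqmod (F x) by rewrite lerDl sqr_ge0.
have hi x : complex.Im (F x) ^+ 2 <= sqmod (F x) by rewrite lerDr sqr_ge0.
have [N1 [j1 m1 n1 c1]] : exists N, [/\ jm N, measurable (N : set (borel G)), mu N = 0%E &
    forall M, jm M -> N `<=` M -> measurable_fun setT (fun p : borel G * borel G =>
      pos (fun x => complex.Re (F x)) (p.1^-1 * p.2)%g * \1_(~` M) (p.1^-1 * p.2)%g)].
  by apply: one => // x k k' Kk Kk'; rewrite FK.
have [N2 [j2 m2 n2 c2]] : exists N, [/\ jm N, measurable (N : set (borel G)), mu N = 0%E &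
    forall M, jm M -> N `<=` M -> measurable_fun setT (fun p : borel G * borel G =>
      pos (fun x => - complex.Re (F x)) (p.1^-1 * p.2)%g * \1_(~` M) (p.1^-1 * p.2)%g)].
  apply: one => [|x k k' Kk Kk'|x]; [exact: measurable_funN|by rewrite FK|by rewrite sqrrN].
have [N3 [j3 m3 n3 c3]] : exists N, [/\ jm N, measurable (N : set (borel G)), mu N = 0%E &
    forall M, jm M -> N `<=` M -> measurable_fun setT (fun p : borel G * borel G =>
      pos (fun x => complex.Im (F x)) (p.1^-1 * p.2)%g * \1_(~` M) (p.1^-1 * p.2)%g)].
  by apply: one => // x k k' Kk Kk'; rewrite FK.
have [N4 [j4 m4 n4 c4]] : exists N, [/\ jm N, measurable (N : set (borel G)), mu N = 0%E &
    forall M, jm M -> N `<=` M -> measurable_fun setT (fun p : borel G * borel G =>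
      pos (fun x => - complex.Im (F x)) (p.1^-1 * p.2)%g * \1_(~` M) (p.1^-1 * p.2)%g)].
  apply: one => [|x k k' Kk Kk'|x]; [exact: measurable_funN|by rewrite FK|by rewrite sqrrN].
have null2 (A B : set G) : measurable (A : set (borel G)) -> measurable (B : set (borel G)) ->
    mu A = 0%E -> mu B = 0%E -> mu (A `|` B) = 0%E.
  by move=> mA mB A0 B0; rewrite -A0; exact: (measureU0 mA mB B0).
have [j12 j34] := (jointly_measurableU j1 j2, jointly_measurableU j3 j4).
have m12 : measurable (N1 `|` N2 : set (borel G)) by exact: measurableU.
have m34 : measurable (N3 `|` N4 : set (borel G)) by exact: measurableU.
pose N := (N1 `|` N2) `|` (N3 `|` N4).
have jN : jm N by exact: jointly_measurableU.
exists N; split => //; [exact: measurableU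
  |exact: (null2 _ _ m12 m34 (null2 _ _ m1 m2 n1 n2) (null2 _ _ m3 m4 n3 n4))|].
have posB (h : G -> R) x : pos h x - pos (fun y => - h y) x = h x.
  rewrite /pos; have [h0|h0] := leP (h x) 0; have [h1|h1] := leP (- h x) 0; lra.
split.
  rewrite [X in measurable_fun _ X](_ : _ = (fun p : borel G * borel G =>
      pos (fun x => complex.Re (F x)) (p.1^-1 * p.2)%g * \1_(~` N) (p.1^-1 * p.2)%g -
      pos (fun x => - complex.Re (F x)) (p.1^-1 * p.2)%g * \1_(~` N) (p.1^-1 * p.2)%g)).
    apply: measurable_funB; [apply: c1 => // x Nx|apply: c2 => // x Nx].
      by left; left.
    by left; right.
  apply/funext => p; rewrite -mulrBl (posB (fun x => complex.Re (F x))).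
  by case: (F _) => a b /=; rewrite mulr0 subr0.
rewrite [X in measurable_fun _ X](_ : _ = (fun p : borel G * borel G =>
    pos (fun x => complex.Im (F x)) (p.1^-1 * p.2)%g * \1_(~` N) (p.1^-1 * p.2)%g -
    pos (fun x => - complex.Im (F x)) (p.1^-1 * p.2)%g * \1_(~` N) (p.1^-1 * p.2)%g)).
  apply: measurable_funB; [apply: c3 => // x Nx|apply: c4 => // x Nx].
    by right; left.
  by right; right.
apply/funext => p; rewrite -mulrBl (posB (fun x => complex.Im (F x))).
by case: (F _) => a b /=; rewrite mulr0 add0r.
Qed.

End Modification.

Section InverseNull.
Context (R : realType) (G : topologicalGroupType).
Context (mu : {sigma_finite_measure set (borel G) -> \bar R}).
Hypothesis hmu : left_haar mu.

(** The set of pairs with [t^-1 x] in [N] has null sections at every [t] by left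
    invariance, hence at almost every [x] by Tonelli; the sections at two points [x]
    are translates of each other. *)
Lemma inverse_null (N : set G) : jointly_measurable N ->
  measurable (N : set (borel G)) -> mu N = 0%E ->
  forall x, mu ([set t | N (t^-1 * x)%g] : set (borel G)) = 0%E.
Proof.
move=> jN mN N0.
pose f (p : borel G * borel G) : \bar R := (\1_[set p : borel G * borel G | N (p.1^-1 * p.2)%g] p)%:E.
have mf : measurable_fun setT f by apply/measurable_EFinP; exact: measurable_indic.
have f0 p : (0 <= f p)%E by rewrite lee_fin indicE.
have sx t : (\int[mu]_x f (t, x) = mu N)%E.
  rewrite -(haar_translate hmu t mN).
  have mNt : measurable ([set y | N (t^-1 * y)%g] : set (borel G)).
    exact: measurable_translate.
  transitivity (\int[mu]_x (\1_([set y | N (t^-1 * y)%g] : set (borel G)) x)%:E)%E => //.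
  by rewrite integral_indic// setIT.
have mt x : measurable ([set t | N (t^-1 * x)%g] : set (borel G)).
  have c : continuous (fun t => t^-1 * x)%g.
    apply: continuous_mulg; last exact: continuous_cstg.
    by apply: continuous_invg; exact: continuous_idg.
  by rewrite -[X in measurable X]setTI; exact: (continuous_borel c).
have sy x : (\int[mu]_t f (t, x) = mu [set t | N (t^-1 * x)%g])%E.
  transitivity (\int[mu]_t (\1_([set t | N (t^-1 * x)%g] : set (borel G)) t)%:E)%E => //.
  by rewrite integral_indic// setIT.
have := @fubini_tonelli _ _ _ _ R mu mu f mf f0.
rewrite /fubini_F /fubini_G; under eq_integral do rewrite sx N0.
rewrite integral0 => /esym I0.
have [_ muT _] := hmu.
have [x0 x00] : exists x0, mu ([set t | N (t^-1 * x0)%g] : set (borel G)) = 0%E.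
  pose g (x : borel G) := (\int[mu]_t f (t, x))%E.
  have mg : measurable_fun setT g by exact: measurable_fun_fubini_tonelli_G.
  have : (\int[mu]_x `|g x| = 0)%E.
    rewrite -[RHS]I0; apply: eq_integral => x _; rewrite gee0_abs//.
    exact: integral_ge0.
  move/(ae_eq_integral_abs _ measurableT mg) => [M [mM M0 sub]].
  apply: contrapT => no; apply: muT; apply/eqP.
  rewrite eq_le measure_ge0 andbT -M0; apply: le_haar => // x _; apply: sub => /=.
  by move=> /(_ Logic.I) gx; apply: no; exists x; rewrite -sy.
move=> x; rewrite -x00 -[LHS](haar_translate hmu (x0 * x^-1)%g (mt x)).
have E t : (((x0 * x^-1)^-1 * t)^-1 * x = t^-1 * x0)%g.
  by rewrite invgM invgK !mulgA mulgVK.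
by congr (mu _); apply/seteqP; split=> t /=; rewrite E.
Qed.

End InverseNull.

(** * Positive-definite spherical functions *)

Section ComplexContinuity.
Context (R : realType) (X : topologicalType).
Implicit Types (f g : X -> R[i]).

(** The topology of [R[i]] is that of its own norm, which is complex-valued; the real
    [modulus] gives the same neighbourhoods. *)
Lemma continuous_modulusP f : continuous f <->
  forall x (e : R), 0 < e -> nbhs x [set y | modulus (f x - f y) < e].
Proof.
have E (z : R[i]) (e : R) : (`|z| < e%:C) = (modulus z < e) by rewrite normc_def modulusE ltcR.
split=> cf x.
  move=> e e0; have := cf x => /(@cvgrPdist_lt _ (R[i] : numFieldType)) /(_ e%:C).
  rewrite ltcR => /(_ e0); apply: filterS => y /=; by rewrite E.
apply/(@cvgrPdist_lt _ (R[i] : numFieldType)) => e.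
case: e => e e'; rewrite ltcE /= => /andP[/eqP -> e0].
by apply: filterS (cf x e e0) => y /=; rewrite -E.
Qed.

Lemma continuous_Re f : continuous f -> continuous (fun x => complex.Re (f x)).
Proof.
move=> /continuous_modulusP cf x; apply/cvgrPdist_lt => e e0.
apply: filterS (cf x e e0) => y /=; apply: le_lt_trans.
by rewrite -raddfB; exact: ler_Re_modulus.
Qed.

Lemma continuous_Im f : continuous f -> continuous (fun x => complex.Im (f x)).
Proof.
move=> /continuous_modulusP cf x; apply/cvgrPdist_lt => e e0.
apply: filterS (cf x e e0) => y /=; apply: le_lt_trans.
by rewrite -raddfB; exact: ler_Im_modulus.
Qed.

Lemma continuous_RtoC (h : X -> R) : continuous h -> continuous (fun x => (h x)%:C).
Proof.
move=> ch; apply/continuous_modulusP => x e e0.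
have := ch x => /cvgrPdist_lt /(_ e e0); apply: filterS => y hxy.
suff E : modulus ((h x)%:C - (h y)%:C) = `|h x - h y| by have := hxy; rewrite -E.
by rewrite -modulus_real; congr modulus; apply/eqP; rewrite eq_complex /= subrr !eqxx.
Qed.

Lemma modulusN (z : R[i]) : modulus (- z) = modulus z.
Proof. by rewrite !modulusE sqmodN. Qed.

Lemma ler_modulus_dist (z w : R[i]) : `|modulus z - modulus w| <= modulus (z - w).
Proof.
have := ler_modulusD (z - w) w; rewrite subrK => h1.
have := ler_modulusD (w - z) z; rewrite subrK -opprB modulusN => h2.
by rewrite ler_norml; apply/andP; split; lra.
Qed.

Lemma continuous_modulus f : continuous f -> continuous (fun x => modulus (f x)).
Proof.
move=> /continuous_modulusP cf x; apply/cvgrPdist_lt => e e0.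
apply: filterS (cf x e e0) => y; apply: le_lt_trans; exact: ler_modulus_dist.
Qed.

Lemma continuous_subC f g : continuous f -> continuous g -> continuous (fun x => f x - g x).
Proof.
move=> /continuous_modulusP cf /continuous_modulusP cg; apply/continuous_modulusP => x e e0.
have e2 : 0 < e / 2 by rewrite divr_gt0.
apply: filterS (filterI (cf x _ e2) (cg x _ e2)) => y [/= fy /= gy].
rewrite (_ : f x - g x - (f y - g y) = (f x - f y) + - (g x - g y)); last by ring.
by apply: le_lt_trans (ler_modulusD _ _) _; rewrite modulusN; lra.
Qed.

Lemma continuous_cstC (c : R[i]) : continuous (fun _ : X => c).
Proof.
apply/continuous_modulusP => x e e0; apply: filterE => y /=.
by rewrite subrr modulus0.
Qed.

End ComplexContinuity.

Lemma cmeasurable_continuous (R : realType) (X : ptopologicalType) (f : X -> R[i]) :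
  continuous f -> cmeasurable setT (f : borel X -> R[i]).
Proof.
move=> cf; split; apply: continuous_borel_real; first exact: continuous_Re.
exact: continuous_Im.
Qed.

Section Average.
Context d (T : measurableType d) (R : realType) (m : {measure set T -> \bar R}).

(** Integrate [psi - c] against the weight [h]. All approximations of a value by
    averages are instances. *)
Lemma average_close (h : T -> R) (psi : T -> R[i]) (c : R[i]) (e F : R) :
  measurable_fun setT h -> (forall x, 0 <= h x) ->
  (\int[m]_x (h x)%:E = F%:E)%E -> cmeasurable setT psi -> 0 <= e ->
  (forall x, h x != 0 -> modulus (psi x - c) <= e) ->
  cintegrable m (fun x => (h x)%:C * psi x) /\
  modulus (cintegral m setT (fun x => (h x)%:C * psi x) - F%:C * c) <= e * F.
Proof.
move=> mh h0 hF mpsi e0 close.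
have mhC : cmeasurable setT (fun x => (h x)%:C) by exact: cmeasurable_real.
have hi : cintegrable m (fun x => (h x)%:C).
  split=> //; under eq_integral do rewrite modulus_real ger0_norm//.
  by rewrite hF ltry.
have md : cmeasurable setT (fun x => (h x)%:C * (psi x - c)).
  apply: cmeasurableM => //; have := cmeasurableD mpsi (cmeasurable_cst setT (- c)).
  by [].
have dle x : modulus ((h x)%:C * (psi x - c)) <= e * h x.
  rewrite modulusM modulus_real ger0_norm// mulrC.
  by have [->|hx] := eqVneq (h x) 0; rewrite ?mulr0// ler_wpM2r// close.
have meh : measurable_fun setT (fun x => e * h x).
  by apply: measurable_funM => //; exact: measurable_cst.
have ieh : (\int[m]_x (e * h x)%:E = (e * F)%:E)%E.
  under eq_integral do rewrite EFinM; rewrite integralZ_ge0//.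
  - by rewrite hF.
  - exact/measurable_EFinP.
have di : cintegrable m (fun x => (h x)%:C * (psi x - c)).
  by apply: cintegrable_le md dle meh _; rewrite ieh ltry.
have E : (fun x => (h x)%:C * psi x) = (fun x => c * (h x)%:C + (h x)%:C * (psi x - c)).
  by apply/funext => x; ring.
split; first by rewrite E; exact: cintegrable_lin.
have -> : cintegral m setT (fun x => (h x)%:C * psi x) - F%:C * c =
    cintegral m setT (fun x => (h x)%:C * (psi x - c)).
  rewrite E cintegral_lin//.
  have -> : cintegral m setT (fun x => (h x)%:C) = F%:C.
    rewrite /cintegral /Rintegral /= hF/=; congr (_ +i* _).
    by rewrite integral0.
  by rewrite mulrC addrC addKr.
rewrite -lee_fin -ieh; apply: le_trans (modulus_cintegral_le di) _.
apply: le_integral_ge0 => [||x|x].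
- by apply/measurable_EFinP; exact: measurable_modulus.
- exact/measurable_EFinP.
- by rewrite lee_fin modulus_ge0.
- by rewrite lee_fin.
Qed.

End Average.

Section PositiveDefinite.
Context (R : realType) (G : topologicalGroupType).
Context (phi : G -> R[i]) (pd : positive_definite phi).

Let quad (a b : R[i]) (y : G) :
  0 <= a * a^*%C * phi 1%g + a * b^*%C * phi (y^-1)%g +
       b * a^*%C * phi y + b * b^*%C * phi 1%g.
Proof.
have := @pd 2 (fun i => if i == ord0 then 1%g else y) (fun i => if i == ord0 then a else b).
rewrite !big_ord_recl !big_ord0 /= !addr0 !mulVg !invg1 !mul1g !mulg1.
by rewrite !addrA.
Qed.

Lemma positive_definite1 : 0 <= phi 1%g.
Proof.
have := quad 1 0 1%g; rewrite !mul0r !conjc0 !mulr0 !mul0r !addr0 conjc1.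
by rewrite !mul1r.
Qed.

(** Positivity for the two points [1] and [y] with coefficients [1, 1] and [1, i] forces
    the form to be hermitian. *)
Lemma positive_definiteV y : phi (y^-1)%g = (phi y)^*%C.
Proof.
have := quad 1 1 y; have := quad 1 'i%C y; have := positive_definite1.
case: (phi 1%g) (phi y) (phi (y^-1)%g) => p p' [a b] [c d]; rewrite !lecE /=.
move=> /andP[/eqP -> _] /andP[/eqP h1 _] /andP[/eqP h2 _].
by apply/eqP; rewrite eq_complex /=; apply/andP; split; apply/eqP; lra.
Qed.

(** Two points again, with coefficients [1] and [- t conj(phi(y))], for the best [t]. *)
Lemma positive_definite_bound y : sqmod (phi y) <= complex.Re (phi 1%g) ^+ 2.
Proof.
set p := complex.Re (phi 1%g); set s := sqmod (phi y).
have p0 : 0 <= p by have := positive_definite1; rewrite lecE => /andP[].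
have key (t : R) : 0 <= p - 2 * t * s + t ^+ 2 * s * p.
  have := quad 1 (- t%:C * (phi y)^*%C) y; rewrite positive_definiteV.
  have := positive_definite1; rewrite /p /s /sqmod.
  case: (phi 1%g) (phi y) => q q' [a b]; rewrite !lecE /=.
  by move=> /andP[/eqP -> _] /andP[_]; lra.
have s0 : 0 <= s by exact: sqmod_ge0.
have [p00|pn0] := eqVneq p 0.
  have := key 1; rewrite p00 expr0n /=; lra.
have pp : 0 < p by rewrite lt_neqAle eq_sym pn0.
have := key p^-1; have -> : p^-1 ^+ 2 * s * p = p^-1 * s by field.
move=> h; rewrite expr2 -ler_pdivrMr// mulrC; lra.
Qed.

End PositiveDefinite.

Section Bump.
Context (R : realType) (G : topologicalGroupType).
Context (mu : {measure set (borel G) -> \bar R}) (K : set G).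
Hypotheses (hG : hausdorff_space G) (lG : locally_compact [set: G]).
Hypotheses (hmu : left_haar mu) (sK : compact_subgroup K).
Implicit Types (x y : G) (A W : set G).

(** The convolution of the indicator functions of [A] and [A^-1]. *)
Definition overlap A x : R := fine (mu ([set y | A (x^-1 * y)%g] `&` A : set (borel G))).

Section Good.
Context (A : set G) (gA : good mu K A).

Let mA : measurable (A : set (borel G)). Proof. exact: good_borel gA. Qed.
Let mxA x : measurable ([set y | A (x^-1 * y)%g] : set (borel G)).
Proof. exact: measurable_translate. Qed.
Let mov x : measurable ([set y | A (x^-1 * y)%g] `&` A : set (borel G)).
Proof. exact: measurableI. Qed.

Lemma overlapE x : mu ([set y | A (x^-1 * y)%g] `&` A : set (borel G)) = (overlap A x)%:E.
Proof.
rewrite fineK// ge0_fin_numE//; case: gA => _ _; apply: le_lt_trans.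
by apply: le_haar => // y [].
Qed.

Lemma overlap_ge0 x : 0 <= overlap A x.
Proof. exact/fine_ge0. Qed.

Lemma overlap_bi_invariant : bi_invariant K (fun x => (overlap A x)%:C).
Proof.
have [_ bA _] := gA.
move=> x k k' Kk Kk'; congr (_%:C); rewrite /overlap; congr fine.
rewrite -[RHS](haar_translate hmu k (mov x)); congr (mu _).
apply/seteqP; split=> y /=; rewrite !invgM -!mulgA => -[h1 h2].
  split; last by apply: (bi_stable_l sK bA) => //; exact: (subgroupV sK).
  by rewrite -[X in A X](mulVKg k'); apply: (bi_stable_l sK bA).
split; first by apply: (bi_stable_l sK bA) => //; exact: (subgroupV sK).
by rewrite -[y](mulVKg k); apply: (bi_stable_l sK bA).
Qed.

Lemma overlap_neq0 x : overlap A x != 0 -> exists2 a, A a & exists2 b, A b & x = (b * a^-1)%g.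
Proof.
move=> ox; have : [set y | A (x^-1 * y)%g] `&` A !=set0.
  apply/set0P/eqP => E; move/eqP: ox; apply.
  by rewrite /overlap E measure0.
by move=> [y [h1 h2]]; exists (x^-1 * y)%g => //; exists y; rewrite // invgM invgK mulVKg.
Qed.

Let overlap_le (e : R) W x y : (forall z, W z ->
    (mu A - e%:E <= mu ([set y | A (z^-1 * y)%g] `&` A : set (borel G)))%E) ->
  W (x^-1 * y)%g -> overlap A y <= overlap A x + e.
Proof.
move=> We Wxy; rewrite -lee_fin EFinD -!overlapE.
have [_ _ Afin] := gA.
have muAfin : mu A \is a fin_num by rewrite ge0_fin_numE.
pose D : set (borel G) := [set z | A (y^-1 * z)%g] `\` [set z | A (x^-1 * z)%g].
have mD : measurable D by exact: measurableD.
have U2 : (mu (([set z | A (x^-1 * z)%g] `&` A) `|` D) <=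
    mu ([set z | A (x^-1 * z)%g] `&` A) + mu D)%E.
  exact: (measureU2 mu (mov x) mD).
apply: (@le_trans _ _ (mu (([set z | A (x^-1 * z)%g] `&` A) `|` D))).
  apply: le_haar => //; first exact: measurableU.
  by move=> z [Ayz Az]; have [?|?] := pselect (A (x^-1 * z)%g); [left|right].
apply: le_trans U2 _; rewrite leeD2l//.
pose z0 := (x^-1 * y)%g.
have -> : mu D = mu ([set z | A (z0^-1 * z)%g] `\` A).
  rewrite -(haar_translate hmu x (measurableD (mxA z0) mA)); congr (mu _).
  by apply/seteqP; split=> z /=; rewrite /D /z0 /= invgM invgK -!mulgA mulVKg.
have DI : (mu [set z | A (z0^-1 * z)%g] = mu ([set z | A (z0^-1 * z)%g] `\` A) +
    mu ([set z | A (z0^-1 * z)%g] `&` A))%E by exact: (measureDI mu (mxA z0) mA).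
have := We _ Wxy; rewrite -/z0.
have tr := haar_translate hmu z0 mA.
move: DI; rewrite tr overlapE => DI.
have Dfin : mu ([set z | A (z0^-1 * z)%g] `\` A) \is a fin_num.
  rewrite ge0_fin_numE//; apply: le_lt_trans Afin; rewrite -tr.
  by apply: le_haar => //; exact: (measurableD (mxA z0) mA).
move: DI; rewrite -(fineK Dfin) -(fineK muAfin) -EFinD -EFinB !lee_fin => -[] ->.
lra.
Qed.

(** By left invariance the overlap changes by at most [mu (x^-1 y A \ A)], which
    [haar_overlap] makes small. *)
Lemma continuous_overlap : continuous (overlap A).
Proof.
move=> x; apply/cvgrPdist_lt => e e0; have e2 : 0 < e / 2 by rewrite divr_gt0.
have [W [oW KW We]] := haar_overlap hG hmu sK gA e2.
have W1 : W 1%g by apply: KW; case: sK.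
have nW : nbhs x [set y | W (x^-1 * y)%g /\ W (y^-1 * x)%g].
  apply: open_nbhs_nbhs; split; last by rewrite /= mulVg.
  apply: openI; apply: (@open_compg _ _ _ W) => //; apply: continuous_mulg.
  - exact: continuous_cstg.
  - exact: continuous_idg.
  - by apply: continuous_invg; exact: continuous_idg.
  - exact: continuous_cstg.
apply: filterS nW => y [W1y W2y].
have h1 := overlap_le We W1y; have h2 := overlap_le We W2y.
by rewrite ltr_norml; apply/andP; split; lra.
Qed.

End Good.

(** The weights [mu (x A & A)] are continuous and bi-invariant, have compact support
    inside of [W] and positive integral: they replace a bump function averaged over
    the compact subgroup. *)
Lemma bump_exists W : open W -> K `<=` W -> exists h : G -> R,
  [/\ CcK K (fun x => (h x)%:C), forall x, 0 <= h x, continuous h,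
      forall x, h x != 0 -> W x &
      exists2 F, 0 < F & (\int[mu]_x (h x)%:E = F%:E)%E].
Proof.
move=> oW KW; have [V1 [oV1 bV1 KV1 V1W]] := square_root_nbhs sK oW KW.
have [V0 [C [oV0 bV0 KV0 VC cC]]] := good_neighbourhood lG sK.
have [cK K1 _] := sK.
pose A := V1 `&` V0.
have AC : A `<=` C by move=> x [_ /VC].
have gA : good mu K A.
  apply: (good_compact hG hmu (C := C)) => //; first exact: openI.
  by move=> x k k' Kk Kk' [? ?]; split; [exact: bV1|exact: bV0].
have A1 : A 1%g by split; [exact: KV1|exact: KV0].
have [oA bA Afin] := gA.
have mA := good_borel gA.
have A0 : (0 < mu A)%E by apply: haar_open_gt0 => //; exists 1%g.
exists (overlap A).
pose C2 := setg C [set y^-1%g | y in C].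
have cC2 : compact C2.
  apply: compact_setg => //; apply: compact_image => //.
  by apply: continuous_invg; exact: continuous_idg.
have supp x : overlap A x != 0 -> C2 x.
  move=> /overlap_neq0[a Aa [b Ab ->]]; exists (b, a^-1)%g => //; split=> /=; first exact: AC.
  by exists a => //; exact: AC.
have ch := continuous_overlap gA.
have mh : measurable_fun setT (overlap A : borel G -> R) by exact: continuous_borel_real.
split => //.
- split.
  + exact: continuous_RtoC.
  + apply: (subclosed_compact _ cC2); first exact: closed_closure.
    have /closure_id -> := compact_closed hG cC2; apply: closureS => x.
    move=> hx; apply: supp; apply: contra_neq hx => ->.
    by [].
  + exact: overlap_bi_invariant.
- by move=> x; exact: overlap_ge0.
- move=> x /overlap_neq0[a [Aa _] [b [Ab _] ->]]; exact: V1W.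
have moE : measurable_fun setT (fun x : borel G => (overlap A x)%:E).
  exact/measurable_EFinP.
have mC2 := compact_borel hG cC2.
have Ile : (\int[mu]_x (overlap A x)%:E <= (fine (mu A))%:E * mu C2)%E.
  have -> : ((fine (mu A))%:E * mu C2)%E = (\int[mu]_x ((fine (mu A))%:E * (\1_C2 x)%:E))%E.
    rewrite integralZ_ge0 ?fine_ge0//; last exact/measurable_EFinP/measurable_indic.
    by rewrite integral_indic ?setIT.
  apply: le_integral_ge0 => [//||x|x]; last 2 first.
  - by rewrite lee_fin overlap_ge0.
  - rewrite -EFinM lee_fin indicE; have [->|ox] := eqVneq (overlap A x) 0.
      by rewrite mulr_ge0 ?fine_ge0// ler0n.
    rewrite mem_set ?mulr1; last exact: supp.
    rewrite -lee_fin -(overlapE gA) fineK ?ge0_fin_numE//; apply: le_haar => //.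
    by apply: measurableI => //; exact: measurable_translate.
  - exact/measurable_EFinP/measurable_funM/measurable_indic.
have Ifin : (\int[mu]_x (overlap A x)%:E)%E \is a fin_num.
  rewrite ge0_fin_numE; last by apply: integral_ge0 => x _; rewrite lee_fin overlap_ge0.
  apply: le_lt_trans Ile _; rewrite lte_mul_pinfty ?lee_fin ?fine_ge0//.
  exact: haar_compact.
exists (fine (\int[mu]_x (overlap A x)%:E)%E); last by rewrite fineK.
(* At the identity the overlap is [mu A]: it exceeds half of this on an open set. *)
pose c := fine (mu A) / 2.
have c0 : 0 < c by rewrite divr_gt0// fine_gt0// A0.
pose O := [set x | c < overlap A x].
have oO : open O by apply: (@open_comp _ _ (overlap A) [set r | c < r]) => [x _|]; [exact: ch|exact: open_gt].
have mO := open_borel oO.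
have O0 : (0 < mu O)%E.
  apply: haar_open_gt0 => //; exists 1%g; rewrite /O /= /overlap.
  rewrite (_ : [set y | A (1^-1 * y)%g] `&` A = A); last first.
    by apply/seteqP; split=> [y []//|y Ay]; split=> //=; rewrite invg1 mul1g.
  have : 0 < fine (mu A) by rewrite fine_gt0// A0.
  by rewrite /c; lra.
apply: fine_gt0; rewrite -ge0_fin_numE ?Ifin ?andbT; last first.
  by apply: integral_ge0 => x _; rewrite lee_fin overlap_ge0.
apply: (@lt_le_trans _ _ (\int[mu]_x (c%:E * (\1_O x)%:E))%E).
  rewrite integralZ_ge0 ?(ltW c0)//; last exact/measurable_EFinP/measurable_indic.
  by rewrite integral_indic ?setIT// mule_gt0.
apply: le_integral_ge0 => [|//|x|x].
- exact/measurable_EFinP/measurable_funM/measurable_indic.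
- by rewrite mule_ge0 ?lee_fin ?(ltW c0).
- rewrite -EFinM lee_fin indicE; have [xO|xO] := boolP (x \in O).
    by move: xO; rewrite inE /O /= mulr1 => /ltW.
  by rewrite mulr0 overlap_ge0.
Qed.

End Bump.

Section SphericalUnit.
Context (R : realType) (G : topologicalGroupType).
Context (mu : {measure set (borel G) -> \bar R}) (K : set G).
Hypotheses (hG : hausdorff_space G) (lG : locally_compact [set: G]).
Hypotheses (hmu : left_haar mu) (sK : compact_subgroup K).
Implicit Types (x y : G) (A W : set G).

Lemma cintegrable_compact (f : G -> R[i]) (B : R) (C : set G) : compact C ->
  cmeasurable setT (f : borel G -> R[i]) -> (forall x, ~ C x -> f x = 0) ->
  (forall x, modulus (f x) <= B) ->
  cintegrable mu (f : borel G -> R[i]) /\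
  modulus (cintegral mu setT f) <= B * fine (mu C).
Proof.
move=> cC mf f0 fB; have mC := compact_borel hG cC.
have B0 : 0 <= B by apply: le_trans (fB 1%g); exact: modulus_ge0.
have mBC : measurable_fun setT (fun x : borel G => (B * \1_C x)%:E).
  exact/measurable_EFinP/measurable_funM/measurable_indic.
have mmf : measurable_fun setT (fun x : borel G => (modulus (f x))%:E).
  exact/measurable_EFinP/measurable_modulus.
have le : (\int[mu]_x (modulus (f x))%:E <= (B * fine (mu C))%:E)%E.
  rewrite EFinM fineK; last by rewrite ge0_fin_numE//; exact: haar_compact.
  have -> : (B%:E * mu C)%E = (\int[mu]_x (B * \1_C x)%:E)%E.
    under eq_integral do rewrite EFinM.
    rewrite integralZ_ge0//; last exact/measurable_EFinP/measurable_indic.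
    by rewrite integral_indic ?setIT.
  apply: le_integral_ge0 => // x; first by rewrite lee_fin modulus_ge0.
  rewrite lee_fin indicE; have [xC|xC] := boolP (x \in C); first by rewrite mulr1.
  by rewrite f0 ?modulus0 ?mulr0//; move: xC; rewrite notin_setE.
have fi : cintegrable mu (f : borel G -> R[i]).
  by split=> //; apply: le_lt_trans le (ltry _).
by split=> //; rewrite -lee_fin; exact: le_trans (modulus_cintegral_le fi) le.
Qed.

Section Smoothing.
Context (g : G -> R[i]) (gc : CcK K g).

Lemma CcK_bounded : exists2 B : R, 0 <= B & forall x, modulus (g x) <= B.
Proof.
have [cg cS _] := gc; set S := closure _ in cS.
have cm := continuous_modulus cg.
have /compact_bounded [M [_ MB]] := compact_image cm cS.
exists (`|M| + 1); first by rewrite addr_ge0.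
move=> x; have [->|gx] := eqVneq (g x) 0; first by rewrite modulus0 addr_ge0.
have lt : M < `|M| + 1 by rewrite (le_lt_trans (ler_norm M)) ?ltrDl.
have hx : [set modulus (g y) | y in S] (modulus (g x)).
  by exists x => //; exact: subset_closure.
by have /= := MB _ lt _ hx; rewrite ger0_norm//; exact: modulus_ge0.
Qed.

(** Closeness of [g (y^-1 x)] to [g x] is an open condition that holds for [y] in [K], so
    the tube lemma gives it uniformly on the compact set [C]; outside of [C], both
    values vanish while [y] stays in [C0]. *)
Lemma uniform_translation : exists C C0, [/\ compact C, compact C0 &
  forall e : R, 0 < e -> exists W,
  [/\ open W, K `<=` W, W `<=` C0 &
      forall x y, W y -> modulus (g (y^-1 * x)%g - g x) <= e /\
        (~ C x -> g (y^-1 * x)%g = 0 /\ g x = 0)]].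
Proof.
have [cg cS ig] := gc; set S := closure _ in cS.
have [V [C0 [oV _ KV VC cC0]]] := good_neighbourhood lG sK.
have [_ K1 _] := sK.
pose C := setg C0 S; have cC : compact C by exact: compact_setg.
have out x y : V y -> ~ C x -> g (y^-1 * x)%g = 0 /\ g x = 0.
  move=> Vy Cx; split; apply: contrapT => /eqP gx; apply: Cx.
    exists (y, y^-1 * x)%g; rewrite /= ?mulVKg//; split; first exact: VC.
    by apply: subset_closure.
  exists (1%g, x); rewrite /= ?mul1g//; split; first exact/VC/KV.
  by apply: subset_closure.
pose f (p : G * G) := g (p.1^-1 * p.2)%g - g p.2.
have cf : continuous (fun p => modulus (f p)).
  apply/continuous_modulus/continuous_subC; apply: (continuous_compg _ cg).
    apply: continuous_mulg; last exact: continuous_sndg.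
    by apply: continuous_invg; exact: continuous_fstg.
  exact: continuous_sndg.
exists C, C0; split=> // e e0.
pose W := [set y | forall x, C x -> modulus (f (y, x)) < e] `&` V.
exists W; split=> //.
- apply: openI => //; apply: (@open_forall _ _ _ (fun p => modulus (f p)) C [set r | r < e]) => //.
- move=> k Kk; split; last exact: KV.
  move=> x Cx; rewrite /f /= -[(k^-1 * x)%g]mulg1 ig//; last exact: subgroupV.
  by rewrite subrr modulus0.
- by move=> y [_ /VC].
- move=> x y [Wy Vy]; split; last exact: out.
  have [Cx|Cx] := pselect (C x); first by apply/ltW/(Wy _ Cx).
  by have [-> ->] := out _ _ Vy Cx; rewrite subrr modulus0 ltW.
Qed.

Context (h : G -> R) (F : R) (C0 : set G).
Hypotheses (ch : continuous h) (h0 : forall x, 0 <= h x) (hF : (\int[mu]_x (h x)%:E = F%:E)%E).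
Hypotheses (cC0 : compact C0) (hC : forall x, h x != 0 -> C0 x) (F0 : 0 < F).
Context (e : R).
Hypothesis (close : forall x y, h y != 0 -> modulus (g (y^-1 * x)%g - g x) <= e).

Let cg : continuous g. Proof. by case: gc. Qed.
Let mh : measurable_fun setT (h : borel G -> R). Proof. exact: continuous_borel_real. Qed.
Let cshift x : continuous (fun y => g (y^-1 * x)%g).
Proof.
apply: (continuous_compg _ cg); apply: continuous_mulg; last exact: continuous_cstg.
by apply: continuous_invg; exact: continuous_idg.
Qed.
Let mshift x : cmeasurable setT (fun y : borel G => g (y^-1 * x)%g).
Proof. exact/cmeasurable_continuous/cshift. Qed.
Let hg := convolution mu (fun x => (h x)%:C) g.

Lemma convolution_close x (r : R) : 0 <= r ->
  (forall y, h y != 0 -> modulus (g (y^-1 * x)%g - g x) <= r) ->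
  modulus (hg x - F%:C * g x) <= r * F.
Proof.
by move=> r0 cl; have [_] := average_close mh h0 hF (mshift x) r0 cl.
Qed.

Let e0 : 0 <= e.
Proof.
have [y hy] : exists y, h y != 0.
  apply: contrapT => H; move: F0; have := hF.
  under eq_integral => x _.
    have -> : h x = 0 by apply/eqP; apply: contrapT => /negP hx; apply: H; exists x.
  over.
  by rewrite integral0 => -[<-]; rewrite ltxx.
exact: le_trans (modulus_ge0 _) (close 1%g hy).
Qed.

(** Uniform closeness of [g (y^-1 x')] to [g (y^-1 x)] for [y] in the compact set [C0];
    the hypothesis on [e] is used for integrability. *)
Lemma continuous_convolution : continuous hg.
Proof.
apply/continuous_modulusP => x r r0.
have r2 : 0 < r / (2 * F) by rewrite divr_gt0// mulr_gt0.
pose f (p : G * G) := g (p.2^-1 * p.1)%g - g (p.2^-1 * x)%g.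
have cf : continuous (fun p => modulus (f p)).
  apply/continuous_modulus/continuous_subC; apply: (continuous_compg _ cg).
    apply: continuous_mulg; last exact: continuous_fstg.
    by apply: continuous_invg; exact: continuous_sndg.
  apply: continuous_mulg; last exact: continuous_cstg.
  by apply: continuous_invg; exact: continuous_sndg.
pose N := [set x' | forall y, C0 y -> modulus (f (x', y)) < r / (2 * F)].
have oN : open N.
  by apply: (@open_forall _ _ _ (fun p => modulus (f p)) C0 [set z | z < _]) => //; exact: open_lt.
have Nx : N x by move=> y _; rewrite /f /= subrr modulus0.
apply: filterS (open_nbhs_nbhs (conj oN Nx)) => x' Nx'.
have [i1 _] := average_close mh h0 hF (mshift x) e0 (close x).
have [i2 _] := average_close mh h0 hF (mshift x') e0 (close x').
have md : cmeasurable setT (fun y : borel G => f (x', y)).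
  have := cmeasurableD (mshift x') (cmeasurableM (cmeasurable_cst setT (-1)) (mshift x)).
  by rewrite /f; under [X in cmeasurable _ X -> _]eq_fun do rewrite mulN1r.
have cl y : h y != 0 -> modulus (f (x', y) - 0) <= r / (2 * F).
  by move=> /hC Cy; rewrite subr0; apply/ltW/Nx'.
have [i3] := average_close mh h0 hF md (ltW r2) cl.
rewrite mulr0 subr0; set I := cintegral _ _ _ => Ile.
have E : hg x' = 1 * hg x + I.
  rewrite -cintegral_lin//; apply: eq_cintegral => y _; rewrite /f /=; ring.
suff Mr : modulus (hg x - hg x') < r by exact: Mr.
rewrite E mul1r opprD addrA subrr add0r modulusN; apply: le_lt_trans Ile _.
rewrite (_ : r / (2 * F) * F = r / 2); last by field; rewrite gt_eqF.
lra.
Qed.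

End Smoothing.

(** Tested against a bump [h] of mass [F] concentrated near [K], both the integral of
    [phi] and the convolution with [g] are almost multiplication, by [F phi(1)] and
    [F]; the character property then reads [F phi(1) chi(g) = F chi(g)] in the limit. *)
Lemma spherical1 (phi : G -> R[i]) : bounded_spherical mu K phi -> phi 1%g = 1.
Proof.
move=> [[cphi iphi [g gc /eqP chig] chiM] [M phiM]].
have [cg cS ig] := gc.
have M0 : 0 <= M by apply: le_trans (phiM 1%g); exact: modulus_ge0.
pose S := closure [set x | g x != 0]; have cS' : compact S by [].
have [B _ gB] := CcK_bounded gc.
set c := cintegral _ _ _ in chig.
have mphi := cmeasurable_continuous cphi; have mg := cmeasurable_continuous cg.
have prodM (f : G -> R[i]) (b : R) x : modulus (f x) <= b -> modulus (f x * phi x) <= b * M.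
  by move=> fb; rewrite modulusM ler_pM ?modulus_ge0.
have [gi _] : cintegrable mu (fun x : borel G => g x * phi x) /\ modulus (cintegral mu setT (fun x => g x * phi x)) <= (B * M) * fine (mu S).
  apply: cintegrable_compact => //; first exact: cmeasurableM.
    move=> x Sx; have [->|gx] := eqVneq (g x) 0; first by rewrite mul0r.
    by case: Sx; exact: subset_closure.
  by move=> x; exact: prodM.
apply/eqP; rewrite -subr_eq0; apply/eqP.
suff [Q Qb] : exists Q : R, forall e, 0 < e -> modulus ((phi 1%g - 1) * c) <= e * Q.
  have : modulus ((phi 1%g - 1) * c) <= 0.
    have Q1 : 0 < `|Q| + 1 by rewrite ltr_wpDl.
    apply/ler_addgt0Pr => e e0; rewrite add0r.
    have := Qb (e / (`|Q| + 1)); rewrite divr_gt0// => /(_ isT) /le_trans; apply.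
    rewrite -mulrA ler_piMr ?(ltW e0)// mulrC ler_pdivrMr// mul1r.
    by rewrite (le_trans (ler_norm Q))// lerDl.
  rewrite le_eqVlt ltNge modulus_ge0 orbF => /eqP/ComplexField.Normc.eq0_normc/eqP.
  by rewrite mulf_eq0 (negPf chig) orbF => /eqP.
have [C [C0 [cC cC0 tube]]] := uniform_translation gc.
exists (modulus c + M * fine (mu C)) => e e0.
have [W [oW KW WC0 Wg]] := tube e e0.
pose W' := W `&` [set y | modulus (phi 1%g - phi y) < e].
have oW' : open W'.
  apply: openI => //.
  have cd : continuous (fun y => modulus (phi 1%g - phi y)).
    exact: (continuous_modulus (continuous_subC (@continuous_cstC R G (phi 1%g)) cphi)).
  by apply: (@open_comp _ _ _ [set r | r < e]) => [x _|]; [exact: cd|exact: open_lt].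
have KW' : K `<=` W'.
  move=> k Kk; split; first exact: KW.
  have [_ K1 _] := sK.
  by rewrite /= -[k]mulg1 -[(k * 1)%g]mulg1 iphi// subrr modulus0.
have [h [hc h0 ch hW' [F F0 hF]]] := bump_exists hG lG hmu sK oW' KW'.
have mh : measurable_fun setT (h : borel G -> R) by exact: continuous_borel_real.
have hC0 x : h x != 0 -> C0 x by move=> /hW'[/WC0].
have hg x y : h y != 0 -> modulus (g (y^-1 * x)%g - g x) <= e.
  by move=> /hW'[/(Wg x)[]].
pose hC := fun x => (h x)%:C; pose q := convolution mu hC g.
have cq : continuous q by apply: (continuous_convolution gc ch h0 hF cC0 hC0 F0 hg).
have mq := cmeasurable_continuous cq.
have [_] : cintegrable mu (fun x => (h x)%:C * phi x) /\
    modulus (cintegral mu setT (fun x => (h x)%:C * phi x) - F%:C * phi 1%g) <= e * F.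
  apply: average_close => //; first exact: ltW.
  by move=> x /hW'[_ /= /ltW]; rewrite -opprB modulusN.
rewrite -[cintegral _ _ _]/(cintegral mu setT (fun x => hC x * phi x)).
set ch' := cintegral _ _ _ => chle.
have qg x : modulus (q x - F%:C * g x) <= e * F.
  apply: (convolution_close gc ch h0 hF (ltW e0)) => y; exact: hg.
have qout x : ~ C x -> q x - F%:C * g x = 0.
  move=> Cx; have := convolution_close gc ch h0 hF (lexx 0) (x := x).
  rewrite mul0r => H; apply/ComplexField.Normc.eq0_normc/eqP.
  rewrite -[X in X == _]/(modulus _) eq_le modulus_ge0 andbT; apply: H => y /hW'[Wy _].
  by have [_ /(_ Cx)[-> ->]] := Wg x y Wy; rewrite subrr modulus0.
have [di dle] : cintegrable mu (fun x : borel G => (q x - F%:C * g x) * phi x) /\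
    modulus (cintegral mu setT (fun x => (q x - F%:C * g x) * phi x)) <=
      (e * F * M) * fine (mu C).
  apply: (@cintegrable_compact _ _ C cC) => [|x|x].
  - apply: cmeasurableM => //.
    have -> : (fun x => q x - F%:C * g x) = (fun x => q x + (- F%:C) * g x).
      by apply/funext => x; rewrite mulNr.
    by apply: cmeasurableD => //; apply: cmeasurableM => //; exact: cmeasurable_cst.
  - by move=> /qout ->; rewrite mul0r.
  - exact: (@prodM (fun x => q x - F%:C * g x) _ x (qg x)).
have E : ch' * c = F%:C * c + cintegral mu setT (fun x => (q x - F%:C * g x) * phi x).
  rewrite -cintegral_lin// -chiM//; apply: eq_cintegral => x _.
  by rewrite -/q; ring.
set D := cintegral _ _ _ in dle E.
have FE : F * modulus ((phi 1%g - 1) * c) <= F * (e * (modulus c + M * fine (mu C))).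
  have -> : F * modulus ((phi 1%g - 1) * c) = modulus (D - (ch' - F%:C * phi 1%g) * c).
    rewrite -[in LHS](ger0_norm (ltW F0)) -modulus_real -modulusM; congr modulus.
    rewrite (_ : D = ch' * c - F%:C * c); last by rewrite E addrC addKr.
    ring.
  apply: le_trans (ler_modulusD _ _) _; rewrite modulusN modulusM.
  apply: (le_trans (lerD dle (ler_wpM2r (modulus_ge0 c) chle))).
  by rewrite le_eqVlt; apply/orP; left; apply/eqP; ring.
by move: FE; rewrite ler_pM2l.
Qed.

Lemma Splus_bound (phi : G -> R[i]) x : Splus mu K phi -> sqmod (phi x) <= 1.
Proof.
move=> [/spherical1 phi1 pd]; have := positive_definite_bound pd x.
by rewrite phi1 /= expr1n.
Qed.

End SphericalUnit.

(** * Measurability of the evaluations on the dual *)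

Section DualMeasurability.
Context (R : realType) (G : topologicalGroupType).
Context (mu : {measure set (borel G) -> \bar R}) (K : set G).
Hypotheses (hG : hausdorff_space G) (lG : locally_compact [set: G]).
Hypotheses (hmu : left_haar mu) (sK : compact_subgroup K).
Context (U : nat -> set G) (bU : neighbourhood_base K U).
Hypothesis lind : forall O : set G, open O -> O 1%g ->
  exists x : nat -> G, forall y, exists n, O ((x n)^-1 * y)%g.
Implicit Types (x y : G) (A W : set G).

Lemma LpK1_char A : good mu K A -> LpK mu K 1 (char_fun R A).
Proof.
move=> gA; have mA := good_borel gA; have [[_ _] bi] := LpK_char sK gA.
have [_ _ fA] := gA; split=> //; split; first exact: cmeasurable_char.
rewrite Lp1P; under eq_integral do rewrite modulus_real ger0_norm//.
by rewrite integral_indic// setIT.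
Qed.

Lemma measurable_Splus : measurable (Splus mu K : set (dual mu K)).
Proof. by apply: sub_sigma_algebra; exists setT; rewrite ?setTI//; exact: openT. Qed.

Lemma measurable_weak (f : weak mu K -> R) : continuous f ->
  measurable_fun (Splus mu K : set (dual mu K)) (f : dual mu K -> R).
Proof.
move=> cf; apply: (measurability _ (RGenOpens.measurableE R)) => //.
move=> _ [_ [a [b ->] <-]]; apply: sub_sigma_algebra.
exists (f @^-1` `]a, b[%classic); last by rewrite setIC.
by apply: open_comp => [x _|]; [exact: cf|exact: interval_open].
Qed.

Lemma continuous_spherical_transform h : LpK mu K 1 h ->
  continuous (fun phi : weak mu K => spherical_transform mu h phi).
Proof.
move=> Lh; pose i : set_type (LpK mu K 1) := exist _ h (mem_set Lh).
pose F := fun (phi : G -> R[i]) =>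
  ((fun h => spherical_transform mu (set_val h) phi) : {ptws (set_type (LpK mu K 1)) -> R[i]}).
have c1 : continuous (F : initial_topology F -> _) by exact: initial_continuous.
have c2 := @proj_continuous (set_type (LpK mu K 1)) (fun=> R[i]) i.
exact: (continuous_compg c1 c2).
Qed.

(** [phi(x^-1)] is the limit of the averages of [phi(y^-1)] over the small
    bi-invariant neighbourhoods of [K x K], which are spherical transforms of
    indicator functions and so weakly continuous in [phi]. *)
Lemma measurable_evalV x :
  measurable_fun (Splus mu K : set (dual mu K)) (fun phi : dual mu K => complex.Re (phi (x^-1)%g)) /\
  measurable_fun (Splus mu K : set (dual mu K)) (fun phi : dual mu K => complex.Im (phi (x^-1)%g)).
Proof.
have [V0 [C [oV0 bV0 KV0 V0C cC]]] := good_neighbourhood lG sK.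
have [cK K1 _] := sK.
pose A n := [set y | exists2 k, K k & (U n `&` V0) (x^-1 * (k * y))%g].
have sU n y k : (U n `&` V0) y -> K k -> (U n `&` V0) (y * k)%g.
  by move=> [? ?] Kk; split; [exact: (bi_stable_r sK (@base_stable _ _ _ bU n))|exact: (bi_stable_r sK bV0)].
have oA n : open (A n).
  pose f (p : G * G) := (x^-1 * (p.2 * p.1))%g.
  have cf : continuous f.
    apply: continuous_mulg; first exact: continuous_cstg.
    by apply: continuous_mulg; [exact: continuous_sndg|exact: continuous_fstg].
  by apply: (open_exists K cf); apply: openI => //; exact: (base_open bU).
have gA n : good mu K (A n).
  pose C' := setg K (setg [set x] C).
  have cC' : compact C' by do 2?[apply: compact_setg => //]; exact: compact_set1.
  apply: (good_compact hG hmu (C := C')) => //.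
  - move=> y k k' Kk Kk' [k1 Kk1 h]; exists (k1 * k^-1)%g.
      by apply: (subgroupM sK) => //; exact: (subgroupV sK).
    by rewrite -!mulgA mulKg !mulgA -!mulgA !mulgA -(mulgA x^-1%g); apply: sU.
  - move=> y [k Kk [_ /V0C h]]; exists (k^-1, k * y)%g; rewrite /= ?mulKg//.
    split; first exact: (subgroupV sK).
    by exists (x, x^-1 * (k * y))%g => //=; rewrite mulVKg.
have A0 n : (0 < mu (A n))%E.
  apply: haar_open_gt0 => //; exists x; exists 1%g => //.
  by rewrite mul1g mulVg; split; [exact: (base_subgroup bU)|exact: KV0].
pose F n := fine (mu (A n)).
have F0 n : 0 < F n by rewrite fine_gt0// A0; case: (gA n).
pose T n (phi : weak mu K) := spherical_transform mu (char_fun R (A n)) phi.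
have cT n : continuous (T n) by apply: continuous_spherical_transform; exact: LpK1_char.
have close (phi : G -> R[i]) : Splus mu K phi -> forall e : R, 0 < e ->
    \forall n \near \oo, modulus (T n phi - (F n)%:C * phi (x^-1)%g) <= e * F n.
  move=> [[[cphi iphi _ _] _] _] e e0.
  pose O := [set y | modulus (phi (x^-1)%g - phi (y^-1)%g) < e].
  have cV : continuous (fun y => phi (y^-1)%g).
    by apply: (continuous_compg _ cphi); exact: invg_continuous.
  have cd := continuous_modulus (continuous_subC (@continuous_cstC R G (phi (x^-1)%g)) cV).
  have oO : open O.
    by apply: (@open_comp _ _ _ [set r | r < e]) => [y _|]; [exact: cd|exact: open_lt].
  have xO k : K k -> O (x * k)%g.
    move=> Kk; rewrite /O /= invgM -[(_ * x^-1)%g]mulg1 iphi ?subrr ?modulus0//.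
    exact: (subgroupV sK).
  have [N NO] := base_at bU oO xO.
  near=> n.
  have mA := good_borel (gA n).
  have [] // := @average_close _ _ _ mu (\1_(A n)) (fun y : borel G => phi (y^-1)%g)
    (phi (x^-1)%g) e (F n).
  - by rewrite integral_indic// setIT fineK// ge0_fin_numE//; case: (gA n).
  - exact: cmeasurable_continuous.
  - exact: ltW.
  - move=> y; rewrite indicE pnatr_eq0 eqb0 negbK inE => -[k Kk [Un _]].
    have : O (k * y)%g.
      by apply: NO; apply: (base_mono bU (n := N) (p := n)) => //; near: n; exact: nbhs_infty_ge.
    rewrite /O /= invgM -[(y^-1)%g]mul1g iphi//; last exact: (subgroupV sK).
    by move/ltW; rewrite -opprB modulusN mul1g.
have gen (P : R[i] -> R) : (forall z, `|P z| <= modulus z) ->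
    (forall z w, P (z - w) = P z - P w) -> (forall (r : R) z, P (r%:C * z) = r * P z) ->
    (forall f : weak mu K -> R[i], continuous f -> continuous (fun z => P (f z))) ->
    measurable_fun (Splus mu K : set (dual mu K)) (fun phi : dual mu K => P (phi (x^-1)%g)).
  move=> P1 PB PZ Pc.
  have mT n : measurable_fun (Splus mu K : set (dual mu K))
      (fun phi : dual mu K => (F n)^-1 * P (T n phi)).
    by apply: measurable_funM; [exact: measurable_cst|apply: measurable_weak; exact: Pc].
  apply: (measurable_fun_cvg mT) => phi Sphi.
  apply/cvgrPdist_le => e e0; apply: filterS (close phi Sphi e e0) => n le.
  have -> : P (phi (x^-1)%g) - (F n)^-1 * P (T n phi) =
      - ((F n)^-1 * P (T n phi - (F n)%:C * phi (x^-1)%g)).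
    by rewrite PB PZ; field; rewrite gt_eqF.
  rewrite normrN normrM ger0_norm ?invr_ge0 ?(ltW (F0 n))// mulrC ler_pdivrMr//.
  exact: le_trans (P1 _) le.
split; apply: gen.
- exact: ler_Re_modulus.
- by move=> z w; exact: raddfB.
- by move=> r [a b] /=; rewrite mul0r subr0.
- by move=> f; exact: continuous_Re.
- exact: ler_Im_modulus.
- by move=> z w; exact: raddfB.
- by move=> r [a b] /=; rewrite mul0r addr0.
- by move=> f; exact: continuous_Im.
Unshelve. all: by end_near.
Qed.

(** The sigma-algebra of [dual] does not separate points outside of the set of
    positive-definite spherical functions, so the evaluation is cut off there. *)
Definition evaluation (x : G) (phi : dual mu K) : R[i] :=
  if phi \in Splus mu K then phi x else 0.

Lemma evaluationE x (phi : dual mu K) : Splus mu K phi -> evaluation x phi = phi x.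
Proof. by move=> S; rewrite /evaluation mem_set. Qed.

Lemma sqmod_evaluation x phi : sqmod (evaluation x phi) <= 1.
Proof.
rewrite /evaluation; case: ifPn => [|_]; last by rewrite sqmod0.
by rewrite inE => S; exact: (Splus_bound hG lG hmu sK).
Qed.

Lemma cmeasurable_evaluation :
  cmeasurable setT (fun p : borel G * dual mu K => evaluation p.1 p.2).
Proof.
have gen (P : R[i] -> R) : P 0 = 0 ->
    (forall f : G -> R[i], continuous f -> continuous (fun z => P (f z))) ->
    (forall x, measurable_fun (Splus mu K : set (dual mu K))
      (fun phi : dual mu K => P (phi (x^-1)%g))) ->
    measurable_fun setT (fun p : borel G * dual mu K => P (evaluation p.1 p.2)).
  move=> P0 Pc Pm.
  apply: (caratheodory sK bU lind (f := fun x phi => P (evaluation x phi))) => [phi|x k phi Kk|x].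
  - case: (boolP (phi \in Splus mu K)) => S; rewrite /evaluation ?S ?(negPf S).
      by move: S; rewrite inE => -[[[cphi _ _ _] _] _]; exact: Pc.
    by apply: Pc; exact: continuous_cstC.
  - rewrite /evaluation; case: ifPn => //; rewrite inE => -[[[_ iphi _ _] _] _].
    by rewrite -[(x * k)%g]mul1g mulgA iphi//; case: sK.
  - have := Pm (x^-1)%g; rewrite invgK => /(measurable_restrictT _ measurable_Splus).1.
    congr measurable_fun; apply/funext => phi; rewrite /patch /evaluation.
    by case: ifPn.
split; apply: gen => //.
- exact: continuous_Re.
- by move=> x; have [] := measurable_evalV x.
- exact: continuous_Im.
- by move=> x; have [] := measurable_evalV x.
Qed.

End DualMeasurability.

(** * Reduction to sigma-finite measures *)

Section SigmaFiniteCopy.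
Context d (T : measurableType d) (R : realType).
Context (m : {measure set T -> \bar R}) (h : sigma_finite setT m).

(** Indexed by the proof, so that the instances below can be inferred from the term. *)
Definition sigma_finite_fun of sigma_finite setT m : set T -> \bar R := m.

HB.instance Definition _ := Measure.copy (sigma_finite_fun h) m.
HB.instance Definition _ := Measure_isSigmaFinite.Build d T R (sigma_finite_fun h) h.

(** The measure itself, with its sigma-finiteness made visible to inference. *)
Definition sigma_finite_copy : {sigma_finite_measure set T -> \bar R} := sigma_finite_fun h.

End SigmaFiniteCopy.

Section SigmaFiniteSupport.
Context d1 d2 (T1 : measurableType d1) (T2 : measurableType d2) (R : realType).

Lemma integral_product_measure12 (m1 : {sigma_finite_measure set T1 -> \bar R})
    (m2 : {sigma_finite_measure set T2 -> \bar R}) (f : T1 * T2 -> \bar R) :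
  (\int[(m1 \x m2)%E]_z f z = \int[(m1 \x^ m2)%E]_z f z)%E.
Proof.
apply: eq_measure_integral => /= A mA _.
by apply: product_measure_unique => //= *; rewrite product_measure2E.
Qed.

Lemma product_sigma_finite (m1 : {sigma_finite_measure set T1 -> \bar R})
    (m2 : {sigma_finite_measure set T2 -> \bar R}) : sigma_finite setT (m1 \x m2)%E.
Proof.
have /sigma_finiteP[F [FT Fmono Ffin]] := sigma_finiteT m1.
have /sigma_finiteP[H [HT Hmono Hfin]] := sigma_finiteT m2.
exists (fun n => F n `*` H n).
  apply/esym/seteqP; split=> // -[x y] _.
  have [n _ Fx] : (\bigcup_n F n) x by rewrite -FT.
  have [p _ Hy] : (\bigcup_n H n) y by rewrite -HT.
  exists (maxn n p) => //; split => /=.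
    by move: x Fx; exact/subsetPset/Fmono/leq_maxl.
  by move: y Hy; exact/subsetPset/Hmono/leq_maxr.
move=> n; have [mF oF] := Ffin n; have [mH oH] := Hfin n.
split; first exact: measurableX.
by rewrite product_measure1E// lte_mul_pinfty// ge0_fin_numE.
Qed.

Lemma integral_mrestr (m : {measure set T2 -> \bar R}) (D : set T2) (mD : measurable D)
    (g : T2 -> \bar R) : (forall y, ~ D y -> g y = 0%E) ->
  (\int[mrestr m mD]_y g y = \int[m]_y g y)%E.
Proof.
move=> g0; have E (n : {measure set T2 -> \bar R}) : (\int[n]_y g y = \int[n]_(y in D) g y)%E.
  rewrite [RHS]integral_mkcond; apply: eq_integral => y _; rewrite patchE.
  by case: ifPn => //; rewrite notin_setE => /g0.
rewrite !E; apply: eq_measure_integral => A mA AD.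
by rewrite /= /mrestr (setIidl AD).
Qed.

Lemma chebyshev_le d (T : measurableType d) (m : {measure set T -> \bar R})
    (g : T -> \bar R) (c : R) : measurable_fun setT g -> (forall x, (0 <= g x)%E) ->
  0 < c -> (c%:E * m [set x | (c%:E < g x)%E] <= \int[m]_x g x)%E.
Proof.
move=> mg g0 c0; pose A := [set x | (c%:E < g x)%E].
have mA : measurable A.
  rewrite (_ : A = setT `&` [set x | (c%:E < g x)%E]); last by rewrite setTI.
  by apply: emeasurable_fun_o_infty.
rewrite -[X in (_ * m X)%E]setIT -integral_indic// -integralZ_ge0 ?(ltW c0)//; last first.
  exact/measurable_EFinP/measurable_indic.
apply: le_integral_ge0 => [|//|x|x].
- exact/measurable_EFinP/measurable_funM/measurable_indic.
- by rewrite mule_ge0// lee_fin ?(ltW c0).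
- rewrite indicE; have [xA|_] := boolP (x \in A); last by rewrite mule0.
  by rewrite mule1; move: xA; rewrite inE => /ltW.
Qed.

(** [D] collects the points [y] at which, for some [n], the section of [f > 1/n] has
    measure greater than [1/n]; Chebyshev's inequality, used for both measures, shows
    that each piece has finite measure. *)
Lemma sigma_finite_support (m1 : {sigma_finite_measure set T1 -> \bar R})
    (m2 : {measure set T2 -> \bar R}) (f : T1 * T2 -> \bar R) :
  measurable_fun setT f -> (forall z, (0 <= f z)%E) ->
  (\int[(m1 \x^ m2)%E]_z f z < +oo)%E ->
  exists (D : set T2) (mD : measurable D),
    [/\ sigma_finite setT (mrestr m2 mD),
        forall y, ~ D y -> (\int[m1]_x f (x, y) = 0)%E &
        (\int[m2]_(y in D) \int[m1]_x f (x, y) <= \int[(m1 \x^ m2)%E]_z f z)%E].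
Proof.
move=> mf f0; set I := (\int[_]_z f z)%E => Ioo.
pose G y := (\int[m1]_x f (x, y))%E.
have mG : measurable_fun setT G.
  have := @measurable_integral _ _ _ _ _ m1 (fun p => f (p.2, p.1)); apply.
  by apply: measurableT_comp mf _; exact: measurable_swap.
have G0 y : (0 <= G y)%E by exact: integral_ge0.
pose q n : R := n.+1%:R^-1; have q0 n : 0 < q n by rewrite invr_gt0.
pose E n := [set z | ((q n)%:E < f z)%E].
have mE n : measurable (E n).
  rewrite (_ : E n = setT `&` [set z | ((q n)%:E < f z)%E]); last by rewrite setTI.
  exact: emeasurable_fun_o_infty.
pose g n y := m1 (ysection (E n) y).
have mg n : measurable_fun setT (g n) by exact: measurable_fun_ysection.
pose D n := [set y | ((q n)%:E < g n y)%E].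
have mD n : measurable (D n).
  rewrite (_ : D n = setT `&` [set z | ((q n)%:E < g n z)%E]); last by rewrite setTI.
  exact: emeasurable_fun_o_infty.
have Dfin n : (m2 (D n) < +oo)%E.
  have h1 : ((q n)%:E * (m1 \x^ m2)%E (E n) <= I)%E by exact: chebyshev_le.
  have h2 : ((q n)%:E * m2 (D n) <= (m1 \x^ m2)%E (E n))%E.
    by apply: chebyshev_le => // y; exact: measure_ge0.
  have : ((q n)%:E * ((q n)%:E * m2 (D n)) < +oo)%E.
    by apply: le_lt_trans Ioo; apply: le_trans h1; rewrite lee_pmul2l// lte_fin.
  rewrite muleA -EFinM [(_ < +oo)%E in X in _ -> X]ltey => h; apply/eqP => Doo; move: h.
  by rewrite Doo gt0_muley ?ltxx// lte_fin mulr_gt0.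
pose D' := \bigcup_n D n.
have mD' : measurable D' by exact: bigcup_measurable.
have qle n p : (n <= p)%N -> q p <= q n.
  by move=> np; rewrite lef_pV2 ?posrE// ler_nat.
have small (c : R) : 0 < c -> exists n, forall p, (n <= p)%N -> q p < c.
  move=> c0; have [n _ nP] := near_infty_natSinv_lt (PosNum c0).
  by exists n => p np; exact: nP.
have Eincr n p y : (n <= p)%N -> (g n y <= g p y)%E.
  move=> np; apply: le_measure; rewrite ?inE; try exact: measurable_ysection.
  move=> x; rewrite /ysection /= !inE /E /= => /(le_lt_trans _); apply.
  by rewrite lee_fin qle.
have out y : ~ D' y -> G y = 0%E.
  move=> Dy; have gn n : g n y = 0%E.
    apply/eqP; rewrite eq_le measure_ge0 andbT leNgt; apply/negP => gn0.
    apply: Dy.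
    have [c c0 cg] : exists2 c : R, 0 < c & (c%:E < g n y)%E.
      case: (g n y) gn0 => [r| |]//; last by exists 1 => //; rewrite ltry.
      by rewrite lte_fin => r0; exists (r / 2); rewrite ?divr_gt0// lte_fin; lra.
    have [p pP] := small _ c0; exists (maxn n p) => //; rewrite /D /=.
    apply: lt_le_trans (Eincr _ _ y (leq_maxl n p)); apply: lt_trans cg.
    by rewrite lte_fin pP// leq_maxr.
  rewrite /G (ae_eq_integral (cst 0%E)) ?integral0//; first last.
    have : m1.-negligible (\bigcup_n ysection (E n) y).
      apply: negligible_bigcup => n; apply/negligibleP; first exact: measurable_ysection.
      exact: gn.
    apply: negligibleS => x /= /not_implyP[_ /eqP fx].
    have : (0 < f (x, y))%E by rewrite lt_neqAle eq_sym fx f0.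
    move=> fp; have [c c0 cg] : exists2 c : R, 0 < c & (c%:E < f (x, y))%E.
      case: (f (x, y)) fp => [r| |]//; last by exists 1 => //; rewrite ltry.
      by rewrite lte_fin => r0; exists (r / 2); rewrite ?divr_gt0// lte_fin; lra.
    have [p pP] := small _ c0; exists p => //; rewrite /ysection /= inE /E /=.
    by apply: lt_trans cg; rewrite lte_fin pP.
  exact: (measurable_fun_pair1 _ mf).
have sf : sigma_finite setT (mrestr m2 mD').
  exists (fun n => D n `|` ~` D').
    apply/seteqP; split=> // y _; have [[n _ Dy]|Dy] := pselect (D' y).
      by exists n => //; left.
    by exists 0%N => //; right.
  move=> n; split; first by apply: measurableU => //; exact: measurableC.
  apply: le_lt_trans (Dfin n); apply: le_measure; rewrite ?inE//.
    by apply: measurableI => //; apply: measurableU => //; exact: measurableC.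
  by move=> y [[//|Dy] Dy'].
exists D', mD'; split=> //; rewrite integral_mkcond.
pose mr := sigma_finite_copy sf.
have mr_le A : measurable A -> (mr A <= m2 A)%E.
  move=> mA; rewrite -[mr A]/(m2 (A `&` D')).
  by apply: le_measure; rewrite ?inE//; exact: measurableI.
rewrite -(@integral_mrestr m2 _ mD'); last first.
  by move=> y Dy; rewrite patchE; case: ifPn => //; rewrite inE.
apply: (@le_trans _ _ (\int[mr]_y G y)%E).
  apply: le_integral_ge0 => // y.
  - exact: ((measurable_restrictT _ mD').1 (measurable_funTS mG)).
  - by rewrite patchE; case: ifPn => // _; exact: G0.
  - by rewrite patchE; case: ifPn => // _; exact: G0.
have <- : (\int[(m1 \x mr)%E]_z f z = \int[mr]_y G y)%E by exact: fubini_tonelli2.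
rewrite integral_product_measure12.
apply: ge0_le_measure_integral => // A mA.
apply: ge0_le_measure_integral => //.
exact: measurable_fun_ysection.
Qed.

End SigmaFiniteSupport.

(** * The wavelets as a measurable kernel *)

Section Twist.
Context (R : realType) (G : topologicalGroupType).
Context (mu : {measure set (borel G) -> \bar R}) (hmu : left_haar mu).
Context (alpha : G -> G) (delta : R).
Hypotheses (aut : topological_automorphism alpha) (modu : automorphism_modulus mu alpha delta).
Implicit Types (x t : G).

Lemma automorphismV x : alpha (x^-1)%g = (alpha x)^-1%g.
Proof.
have [aM _ _] := aut; have a1 : alpha 1%g = 1%g.
  by apply: (mulgI (alpha 1%g)); rewrite -aM !mulg1.
by apply: (mulgI (alpha x)); rewrite -aM !mulgV.
Qed.

Lemma measurable_automorphism : measurable_fun setT (alpha : borel G -> borel G).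
Proof. by case: aut => _ ca _; exact: continuous_borel. Qed.

Lemma continuous_twist t : continuous (fun x => alpha (t^-1 * x)%g).
Proof.
have [_ ca _] := aut; apply: (continuous_compg _ ca); apply: continuous_mulg.
  exact: continuous_cstg.
exact: continuous_idg.
Qed.

Lemma measurable_twist t : measurable_fun setT (fun x : borel G => alpha (t^-1 * x)%g : borel G).
Proof. exact: (@continuous_borel G G (fun x => alpha (t^-1 * x)%g) (@continuous_twist t)). Qed.

(** [alpha] is onto, so [A] is the image of its preimage, whose measure [delta] scales. *)
Lemma haar_twist t (A : set (borel G)) : measurable A ->
  mu A = (delta%:E * mu ([set x | A (alpha (t^-1 * x)%g)] : set (borel G)))%E.
Proof.
move=> mA; have [_ _ [b [ab ba _]]] := aut; have [_ im] := modu.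
have mB : measurable ([set x | A (alpha x)] : set (borel G)).
  by rewrite -[X in measurable X]setTI; exact: measurable_automorphism.
rewrite (haar_translate hmu t mB) -im//; congr (mu _).
by apply/seteqP; split=> [y Ay|_ [x Ax <-]//]; exists (b y) => //=; rewrite ba.
Qed.

Lemma integral_twist t (f : borel G -> \bar R) : measurable_fun setT f ->
  (forall x, (0 <= f x)%E) ->
  (delta%:E * \int[mu]_x f (alpha (t^-1 * x)%g) = \int[mu]_x f x)%E.
Proof.
move=> mf f0; have mt := measurable_twist t; have [d0 _] := modu.
pose dn : {nonneg R} := NngNum (ltW d0).
have pf : (\int[pushforward mu (fun x : borel G => alpha (t^-1 * x)%g : borel G)]_y f y =
    \int[mu]_x f (alpha (t^-1 * x)%g))%E by exact: ge0_integral_pushforward.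
rewrite -pf -[delta]/(dn%:num).
rewrite -(ge0_integral_mscale _ _ dn)//.
by apply: eq_measure_integral => A mA _; rewrite /= /mscale (haar_twist t mA).
Qed.

Lemma null_twist t (N : set (borel G)) : measurable N -> mu N = 0%E ->
  mu ([set x | N (alpha (t^-1 * x)%g)] : set (borel G)) = 0%E.
Proof.
move=> mN; rewrite (haar_twist t mN) => /eqP; rewrite mule_eq0 => /orP[|/eqP //].
by have [d0 _] := modu; rewrite eqe gt_eqF.
Qed.

End Twist.

Lemma eq_cintegral_null d (T : measurableType d) (R : realType)
    (m : {measure set T -> \bar R}) (f g : T -> R[i]) (N : set T) :
  cmeasurable setT f -> cmeasurable setT g -> measurable N -> m N = 0%E ->
  (forall x, ~ N x -> f x = g x) -> cintegral m setT f = cintegral m setT g.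
Proof.
move=> [f1 f2] [g1 g2] mN N0 fg.
have gen (P : R[i] -> R) : measurable_fun setT (fun x => P (f x)) ->
    measurable_fun setT (fun x => P (g x)) ->
    Rintegral m setT (fun x => P (f x)) = Rintegral m setT (fun x => P (g x)).
  move=> mf mg; congr fine; apply: ae_eq_integral => //; try exact/measurable_EFinP.
  exists N; split=> // x /= h; apply: contrapT => /fg E; apply: h => _.
  by rewrite E.
by rewrite /cintegral !gen.
Qed.

Section WaveletKernel.
Context (R : realType) (G : topologicalGroupType).
Context (mu : {measure set (borel G) -> \bar R}) (K : set G).
Hypotheses (hG : hausdorff_space G) (lG : locally_compact [set: G]).
Hypotheses (hmu : left_haar mu) (sK : compact_subgroup K).
Context (U : nat -> set G) (bU : neighbourhood_base K U).
Hypothesis lind : forall O : set G, open O -> O 1%g ->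
  exists x : nat -> G, forall y, exists n, O ((x n)^-1 * y)%g.
Hypothesis sf : sigma_finite setT mu.
Context (alpha : G -> G) (delta : R) (theta : G -> R[i]).
Hypotheses (aut : topological_automorphism alpha) (modu : automorphism_modulus mu alpha delta).
Hypotheses (Ltheta : LpK mu K 2 theta) (theta1 : Lp_norm mu setT 2 theta = 1%E).
Context (N : set G).
Hypotheses (jN : jointly_measurable N) (mN : measurable (N : set (borel G))) (N0 : mu N = 0%E).
Hypothesis jtheta : cmeasurable setT (fun p : borel G * borel G =>
  theta (p.1^-1 * p.2)%g * (\1_(~` N) (p.1^-1 * p.2)%g)%:C).
Implicit Types (x t : G).

Let muS := sigma_finite_copy sf.

(** The wavelets for [theta] cut off on a null set, which makes them jointly
    measurable, and for [phi] cut off outside of the dual. *)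
Definition kernel (z : borel G * dual mu K) x : R[i] :=
  (Num.sqrt delta)%:C * evaluation x z.2 *
  (theta (alpha (z.1^-1 * x)%g) * (\1_(~` N) (alpha (z.1^-1 * x)%g))%:C).

Lemma cmeasurable_kernel :
  cmeasurable setT (fun p : (borel G * dual mu K) * borel G => kernel p.1 p.2).
Proof.
have [aM _ _] := aut; have ma := measurable_automorphism aut.
have m1 : measurable_fun setT (fun p : (borel G * dual mu K) * borel G => (p.2, p.1.2)).
  by apply/measurable_fun_pair => //; exact: measurableT_comp.
have m2 : measurable_fun setT
    (fun p : (borel G * dual mu K) * borel G => (alpha p.1.1 : borel G, alpha p.2 : borel G)).
  by apply/measurable_fun_pair; apply: measurableT_comp => //; exact: measurableT_comp.
apply: cmeasurableM.
  apply: cmeasurableM; first exact: cmeasurable_cst.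
  exact: (cmeasurable_comp (cmeasurable_evaluation hG lG hmu sK bU lind) m1).
have := cmeasurable_comp jtheta m2.
congr cmeasurable; apply/funext => -[[t phi] x] /=.
by rewrite aM (automorphismV aut).
Qed.

Lemma integral_theta : (\int[mu]_x (sqmod (theta x))%:E = 1)%E.
Proof.
have [[Lt _] _] := Ltheta; have [_ foo] := (L2P mu theta).1 Ltheta.1.
move: theta1; rewrite Lp_norm2.
have I0 : (0 <= \int[mu]_x (sqmod (theta x))%:E)%E.
  by apply: integral_ge0 => x _; rewrite lee_fin sqmod_ge0.
case: (\int[mu]_x (sqmod (theta x))%:E)%E foo I0 => [r| |]// _; rewrite lee_fin => r0 [].
by rewrite powR12_sqrt// => s1; rewrite -(sqr_sqrtr r0) s1 expr1n.
Qed.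

Let mtheta : cmeasurable setT (theta : borel G -> R[i]).
Proof. by have [mt _] := (L2P mu theta).1 Ltheta.1. Qed.

(** The bound on the spherical function leaves [delta] times the integral of the
    twisted [|theta|^2], which is the integral of [|theta|^2]. *)
Lemma kernel_norm z : (\int[mu]_x (sqmod (kernel z x))%:E <= 1)%E.
Proof.
have [d0 _] := modu.
have mt : measurable_fun setT (fun x : borel G => (sqmod (theta x))%:E).
  exact/measurable_EFinP/measurable_sqmod.
have mtt : measurable_fun setT (fun x : borel G => (sqmod (theta (alpha (z.1^-1 * x)%g)))%:E).
  exact: (measurableT_comp mt (measurable_twist aut z.1)).
have mk : cmeasurable setT (kernel z : borel G -> R[i]).
  have m2 : measurable_fun setT (fun x : borel G => (z, x)) by exact: pair1_measurable.
  exact: (cmeasurable_comp cmeasurable_kernel m2).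
rewrite -integral_theta -(integral_twist hmu aut modu z.1 mt); last first.
  by move=> x; rewrite lee_fin sqmod_ge0.
rewrite -integralZ_ge0 ?(ltW d0)//; last by move=> x; rewrite lee_fin sqmod_ge0.
apply: le_integral_ge0 => [||x|x].
- exact/measurable_EFinP/measurable_sqmod.
- exact: measurable_funeM.
- by rewrite lee_fin sqmod_ge0.
rewrite -EFinM lee_fin /kernel !sqmodM !sqmod_real sqr_sqrtr ?(ltW d0)//.
rewrite -mulrA ler_wpM2l ?(ltW d0)//.
rewrite mulrCA ler_piMr ?sqmod_ge0// mulr_ile1 ?sqmod_ge0 ?sqr_ge0//.
  exact: (sqmod_evaluation hG lG hmu sK).
Qed.

Lemma kernelE (phi : dual mu K) t x : Splus mu K phi -> ~ N (alpha (t^-1 * x)%g) ->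
  kernel (t, phi) x = wavelet alpha delta theta phi t x.
Proof.
move=> S nN; rewrite /kernel /wavelet /= evaluationE// indicE mem_set ?mulr1//.
Qed.

(** For fixed [t], the cut-off of [theta] changes the wavelet on a null set of [x]. *)
Lemma stockwell_kernel (f : G -> R[i]) t (phi : dual mu K) : L2G mu f -> Splus mu K phi ->
  stockwell mu alpha delta theta f t phi = coef muS kernel f (t, phi).
Proof.
move=> /L2P[mf _] S; have [[[cphi _ _ _] _] _] := S.
have mtt : cmeasurable setT (fun x : borel G => theta (alpha (t^-1 * x)%g)).
  exact: (cmeasurable_comp mtheta (measurable_twist aut t)).
have mNt : measurable ([set x | N (alpha (t^-1 * x)%g)] : set (borel G)).
  by rewrite -[X in measurable X]setTI; exact: (measurable_twist aut t).
have mk : cmeasurable setT (kernel (t, phi) : borel G -> R[i]).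
  have m2 : measurable_fun setT (fun x : borel G => ((t, phi) : borel G * dual mu K, x)).
    exact: pair1_measurable.
  exact: (cmeasurable_comp cmeasurable_kernel m2).
apply: (@eq_cintegral_null _ _ _ mu _ _ _ _ _ mNt (null_twist hmu aut modu t mN N0)).
- apply: cmeasurableM => //; apply: cmeasurableJ; apply: cmeasurableM => //.
  by apply: cmeasurableM; [exact: cmeasurable_cst|exact: cmeasurable_continuous].
- by apply: cmeasurableM => //; exact: cmeasurableJ.
by move=> x nN; rewrite kernelE.
Qed.

(** For fixed [x], the cut-off changes the wavelet on a null set of [t]: the equality
    holds at every [x], although [theta] has been changed. *)
Lemma integral_kernel (f : G -> R[i]) (v : borel G -> R[i]) (phi : dual mu K) x :
  L2G mu f -> Splus mu K phi -> cmeasurable setT v ->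
  cintegral mu setT (fun t => v t * stockwell mu alpha delta theta f t phi *
    wavelet alpha delta theta phi t x) =
  cintegral mu setT (fun t => v t * (coef muS kernel f (t, phi) * kernel (t, phi) x)).
Proof.
move=> Lf S mv; have [aM _ _] := aut.
have cs : continuous (fun t => alpha (t^-1 * x)%g).
  have [_ ca _] := aut; apply: (continuous_compg _ ca); apply: continuous_mulg.
    by apply: continuous_invg; exact: continuous_idg.
  exact: continuous_cstg.
have ms : measurable_fun setT (fun t : borel G => alpha (t^-1 * x)%g : borel G).
  exact: (@continuous_borel G G (fun t => alpha (t^-1 * x)%g) cs).
have mNx : measurable ([set t | N (alpha (t^-1 * x)%g)] : set (borel G)).
  by rewrite -[X in measurable X]setTI; exact: ms.
have Nx0 : mu ([set t | N (alpha (t^-1 * x)%g)] : set (borel G)) = 0%E.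
  have mM : measurable ([set t | N (t^-1 * alpha x)%g] : set (borel G)).
    have m2 : measurable_fun setT (fun t : borel G => (t, alpha x : borel G)).
      exact: pair2_measurable.
    by have := m2 measurableT _ jN; rewrite setTI.
  have M0 := inverse_null (mu := muS) hmu jN mN N0 (alpha x).
  rewrite -[RHS](null_twist hmu aut modu 1%g mM M0); congr (mu _).
  by apply/seteqP; split=> t /=; rewrite invg1 mul1g aM (automorphismV aut).
have mc : cmeasurable setT (fun t : borel G => coef muS kernel f (t, phi)).
  have m2 : measurable_fun setT (fun t : borel G => (t, phi)) by exact: pair2_measurable.
  have mz : cmeasurable setT (coef muS kernel f).
    by apply: cmeasurable_coef => //; [exact: cmeasurable_kernel].
  exact: (cmeasurable_comp mz m2).
have mk : cmeasurable setT (fun t : borel G => kernel (t, phi) x).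
  have m2 : measurable_fun setT (fun t : borel G => ((t, phi), x : borel G)).
    by apply/measurable_fun_pair => //; exact: pair2_measurable.
  exact: (cmeasurable_comp cmeasurable_kernel m2).
have mw : cmeasurable setT (fun t : borel G => wavelet alpha delta theta phi t x).
  apply: cmeasurableM; first exact: cmeasurable_cst.
  exact: (cmeasurable_comp mtheta ms).
apply: (@eq_cintegral_null _ _ _ mu _ _ _ _ _ mNx Nx0).
- apply: cmeasurableM => //; apply: cmeasurableM => //.
  by under eq_fun do rewrite stockwell_kernel//.
- by apply: cmeasurableM => //; exact: cmeasurableM.
by move=> t nN; rewrite stockwell_kernel// kernelE// mulrA.
Qed.

End WaveletKernel.

(** * Localization operators as kernel operators *)

Lemma cintegral_fubini d1 d2 (T1 : measurableType d1) (T2 : measurableType d2) (R : realType)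
    (m1 : {sigma_finite_measure set T1 -> \bar R})
    (m2 : {sigma_finite_measure set T2 -> \bar R}) (f : T1 * T2 -> R[i]) :
  cintegrable (m1 \x m2)%E f ->
  cintegral m2 setT (fun y => cintegral m1 setT (fun x => f (x, y))) =
  cintegral (m1 \x m2)%E setT f.
Proof.
move=> fi.
have gen (P : R[i] -> R) :
    (m1 \x m2)%E.-integrable setT (EFin \o (fun z => P (f z))) ->
    Rintegral m2 setT (fun y => Rintegral m1 setT (fun x => P (f (x, y)))) =
    Rintegral (m1 \x m2)%E setT (fun z => P (f z)).
  move=> Pi; congr fine; rewrite -integral21_prod_meas1//.
  have mG := measurable_fubini_G Pi.
  apply: ae_eq_integral => //.
    apply/measurable_EFinP; apply: (measurableT_comp (f := fine)) mG.
    exact: fine_measurable.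
  apply: filterS (ae_integrable2 Pi) => y iy _.
  by rewrite /fubini_G /Rintegral fineK//; exact: integrable_fin_num.
rewrite [LHS]/cintegral [RHS]/cintegral /=; congr (_ +i* _).
- by apply: (gen (@complex.Re R)); exact: cintegrable_Re.
- by apply: (gen (@complex.Im R)); exact: cintegrable_Im.
Qed.

Lemma cintegral_mkcond d (T : measurableType d) (R : realType)
    (m : {measure set T -> \bar R}) (D : set T) (f : T -> R[i]) :
  (forall x, ~ D x -> f x = 0) -> cintegral m D f = cintegral m setT f.
Proof.
move=> f0; rewrite /cintegral; congr (_ +i* _); rewrite Rintegral_mkcond;
  by apply: eq_Rintegral => x _; rewrite patchE; case: ifPn => //;
  rewrite notin_setE => /f0 ->.
Qed.

Lemma cintegral_mrestr d (T : measurableType d) (R : realType)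
    (m : {measure set T -> \bar R}) (D : set T) (mD : measurable D) (f : T -> R[i]) :
  (forall x, ~ D x -> f x = 0) -> cintegral (mrestr m mD) setT f = cintegral m setT f.
Proof.
move=> f0; rewrite /cintegral; congr (_ +i* _); congr fine;
  by apply: integral_mrestr => x /f0 ->.
Qed.

Section LocalizationKernel.
Context (R : realType) (G : topologicalGroupType).
Context (mu : {measure set (borel G) -> \bar R}) (K : set G).
Hypotheses (hG : hausdorff_space G) (lG : locally_compact [set: G]).
Hypotheses (hmu : left_haar mu) (sK : compact_subgroup K).
Context (U : nat -> set G) (bU : neighbourhood_base K U).
Hypothesis lind : forall O : set G, open O -> O 1%g ->
  exists x : nat -> G, forall y, exists n, O ((x n)^-1 * y)%g.
Hypothesis sf : sigma_finite setT mu.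
Context (alpha : G -> G) (delta : R) (theta : G -> R[i]).
Hypotheses (aut : topological_automorphism alpha) (modu : automorphism_modulus mu alpha delta).
Hypotheses (Ltheta : LpK mu K 2 theta) (theta1 : Lp_norm mu setT 2 theta = 1%E).
Context (N : set G).
Hypotheses (jN : jointly_measurable N) (mN : measurable (N : set (borel G))) (N0 : mu N = 0%E).
Hypothesis jtheta : cmeasurable setT (fun p : borel G * borel G =>
  theta (p.1^-1 * p.2)%g * (\1_(~` N) (p.1^-1 * p.2)%g)%:C).
Context (pl : {measure set (dual mu K) -> \bar R}) (u : borel G * dual mu K -> R[i]).
Hypothesis Lu : product_Lp pl 1 u.

Let muS := sigma_finite_copy sf.
Let k : borel G * dual mu K -> borel G -> R[i] := @kernel R G mu K alpha delta theta N.
Let L := localization pl alpha delta theta u.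
Let Sp : set (dual mu K) := Splus mu K.

(** The part of the dual that carries [u], where the Plancherel measure is
    sigma-finite, replaces the dual. *)
Lemma localization_superpose :
  exists (u1 : borel G * dual mu K -> R[i])
    (m : {sigma_finite_measure set (borel G * dual mu K)%type -> \bar R}),
  [/\ cmeasurable setT u1,
      (\int[m]_z (modulus (u1 z))%:E <= product_norm pl 1 u)%E,
      forall f, L2G mu f -> cmeasurable setT (L f : borel G -> R[i]) &
      forall f, L2G mu f ->
        {ae muS, forall x, L f x = superpose m k u1 (coef muS k f) x}].
Proof.
have [mu_ uoo] := Lu; have mSp : measurable Sp by exact: measurable_Splus.
have mST : measurable (setT `*` Sp : set (borel G * dual mu K)).
  by apply: measurableX.
pose u0 (z : borel G * dual mu K) := if z.2 \in Sp then u z else 0.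
have u0E (P : R[i] -> R) : P 0 = 0 -> (fun z => P (u0 z)) = (fun z => P (u z)) \_ (setT `*` Sp).
  move=> P0; apply/funext => z; rewrite patchE /u0.
  have -> : (z \in setT `*` Sp) = (z.2 \in Sp).
    by rewrite in_setX in_setT.
  by case: ifPn.
have mu0 : cmeasurable setT u0.
  have [m1 m2] := mu_; split; rewrite u0E//; apply/(measurable_restrictT _ mST).
    exact: m1.
  exact: m2.
have mmu0 : measurable_fun setT (fun z => (modulus (u0 z))%:E).
  by apply/measurable_EFinP; exact: (measurable_modulus mu0).
have normE : (\int[(muS \x^ pl)%E]_z (modulus (u0 z))%:E)%E = product_norm pl 1 u.
  rewrite /product_norm.
  have -> := Lp1P (muS \x^ pl)%E u (setT `*` Sp).
  rewrite [RHS]integral_mkcond; apply: eq_integral => z _.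
  rewrite -[modulus (u0 z)]/((fun z => modulus (u0 z)) z) u0E ?modulus0//.
  by rewrite !patchE; case: ifPn.
have [] := @sigma_finite_support _ _ _ _ _ muS pl (fun z => (modulus (u0 z))%:E) mmu0.
- by move=> z; rewrite lee_fin modulus_ge0.
- by rewrite normE.
rewrite normE => D [mD [sfD out le]].
pose u1 (z : borel G * dual mu K) := if z.2 \in D then u0 z else 0.
have u1out z : ~ D z.2 -> u1 z = 0.
  by move=> Dz; rewrite /u1; case: ifPn => //; rewrite inE.
have mTD : measurable (setT `*` D : set (borel G * dual mu K)) by apply: measurableX.
have mu1 : cmeasurable setT u1.
  have E (P : R[i] -> R) : P 0 = 0 -> (fun z => P (u1 z)) = (fun z => P (u0 z)) \_ (setT `*` D).
    move=> P0; apply/funext => z; rewrite patchE /u1.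
    have -> : (z \in setT `*` D) = (z.2 \in D) by rewrite in_setX in_setT.
    by case: ifPn.
  have [m1 m2] := mu0; split; rewrite E//; apply/(measurable_restrictT _ mTD);
    exact: measurable_funTS.
pose m2 := sigma_finite_copy sfD.
pose m := sigma_finite_copy (product_sigma_finite muS m2).
have mk := cmeasurable_kernel hG lG hmu sK bU lind delta aut jtheta.
have k1 := kernel_norm hG lG hmu sK bU lind aut modu Ltheta theta1 jtheta.
pose W f (z : borel G * dual mu K) x := u1 z * (coef muS k f z * k z x).
have mW f : L2G mu f -> cmeasurable setT (fun p : (borel G * dual mu K) * borel G => W f p.1 p.2).
  move=> Lf; have mc : cmeasurable setT (coef muS k f).
    by apply: cmeasurable_coef => //; exact: mk.
  apply: cmeasurableM; first exact: (cmeasurable_comp mu1 measurable_fst).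
  by apply: cmeasurableM => //; exact: (cmeasurable_comp mc measurable_fst).
have LE f x : L2G mu f -> L f x =
    cintegral m2 setT (fun phi => cintegral muS setT (fun t => W f (t, phi) x)).
  move=> Lf; pose J phi := cintegral mu setT (fun t => W f (t, phi) x).
  have J0 phi : ~ D phi -> J phi = 0.
    move=> Dphi; rewrite -[RHS](cintegral0 mu); apply: eq_cintegral => t _.
    by rewrite /W u1out// mul0r.
  have J0' phi : ~ Sp phi -> J phi = 0.
    move=> Sphi; rewrite -[RHS](cintegral0 mu); apply: eq_cintegral => t _.
    by rewrite /W /u1 /u0 /= (memNset Sphi) if_same mul0r.
  have -> : cintegral m2 setT J = cintegral pl Sp J.
    by rewrite cintegral_mkcond//; exact: cintegral_mrestr.
  apply: eq_cintegral => phi Sphi; rewrite /J.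
  have mv : cmeasurable setT (fun t : borel G => u0 (t, phi)).
    have mp : measurable_fun setT (fun t : borel G => (t, phi)) by exact: pair2_measurable.
    exact: (cmeasurable_comp mu0 mp).
  have u0S t : u (t, phi) = u0 (t, phi) by rewrite /u0 /= mem_set.
  under eq_cintegral => t _ do rewrite u0S.
  rewrite (integral_kernel hG lG hmu sK bU lind sf aut modu Ltheta jN mN N0 jtheta)//.
  have [Dphi|Dphi] := pselect (D phi).
    by apply: eq_cintegral => t _; rewrite /W /u1 /= mem_set.
  rewrite -/(J phi) J0//.
  have mf : measurable_fun setT (fun t : borel G => (modulus (u0 (t, phi)))%:E).
    exact/measurable_EFinP/measurable_modulus.
  have : ae_eq muS setT (fun t : borel G => (modulus (u0 (t, phi)))%:E) (cst 0%E).
    apply/ae_eq_integral_abs => //; rewrite -[RHS](out _ Dphi); apply: eq_integral => t _.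
    by rewrite gee0_abs// lee_fin modulus_ge0.
  move=> [A [mA A0 Asub]].
  have mz : cmeasurable setT (coef muS k f).
    by apply: cmeasurable_coef => //; exact: mk.
  have mp : measurable_fun setT (fun t : borel G => (t, phi)) by exact: pair2_measurable.
  have mpx : measurable_fun setT (fun t : borel G => ((t, phi), x : borel G)).
    by apply/measurable_fun_pair => //; exact: pair2_measurable.
  rewrite -(cintegral0 mu); apply: (@eq_cintegral_null _ _ _ mu _ _ A) => //.
    apply: cmeasurableM => //; apply: cmeasurableM; first exact: (cmeasurable_comp mz mp).
    exact: (cmeasurable_comp mk mpx).
  move=> t At; suff -> : u0 (t, phi) = 0 by rewrite mul0r.
  apply: ComplexField.Normc.eq0_normc; apply: EFin_inj; apply: contrapT => u0n.
  by apply: At; apply: Asub => h; apply: u0n; exact: (h Logic.I).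
have mWx f : L2G mu f -> cmeasurable setT (fun q : borel G * dual mu K =>
    cintegral muS setT (fun t => W f (t, q.2) q.1)).
  move=> Lf.
  have ms : measurable_fun setT (fun r : (borel G * dual mu K) * borel G => ((r.2, r.1.2), r.1.1)).
    apply/measurable_fun_pair; last exact: measurableT_comp.
    by apply/measurable_fun_pair => //; exact: measurableT_comp.
  exact: (@cmeasurable_cintegral _ _ _ _ _ muS (fun r => W f (r.2, r.1.2) r.1.1)
    (cmeasurable_comp (mW f Lf) ms)).
have norm0 : (0 <= product_norm pl 1 u)%E.
  by rewrite -normE; apply: integral_ge0 => z _; rewrite lee_fin modulus_ge0.
have uC : (\int[m]_z (modulus (u1 z))%:E <= product_norm pl 1 u)%E.
  apply: le_trans le.
  have -> : (\int[m]_z (modulus (u1 z))%:E =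
      \int[m2]_y \int[muS]_x (modulus (u1 (x, y)))%:E)%E.
    apply: (@fubini_tonelli2 _ _ _ _ _ muS m2 (fun z => (modulus (u1 z))%:E)).
      by apply/measurable_EFinP; exact: (measurable_modulus mu1).
    by move=> z; rewrite lee_fin modulus_ge0.
  have -> : (\int[m2]_y \int[muS]_x (modulus (u1 (x, y)))%:E =
      \int[pl]_y \int[muS]_x (modulus (u1 (x, y)))%:E)%E.
    apply: integral_mrestr => y Dy; apply: integral0_eq => x _.
    by rewrite u1out// modulus0.
  rewrite [X in (_ <= X)%E]integral_mkcond le_eqVlt; apply/orP; left; apply/eqP.
  apply: eq_integral => y _; rewrite patchE; case: ifPn => Dy.
    by apply: eq_integral => x _; rewrite /u1 /= Dy.
  by apply: integral0_eq => x _; rewrite /u1 /= (negPf Dy) modulus0.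
exists u1, m; split=> // f Lf.
- have -> : L f = fun x => cintegral m2 setT (fun phi => cintegral muS setT (fun t => W f (t, phi) x)).
    by apply/funext => x; exact: LE.
  exact: (@cmeasurable_cintegral _ _ _ _ _ m2
    (fun q => cintegral muS setT (fun t => W f (t, q.2) q.1)) (mWx f Lf)).
- pose C := fine (product_norm pl 1 u) + 1.
  have C0 : 0 < C by rewrite ltr_wpDl// fine_ge0.
  have uC' : (\int[m]_z (modulus (u1 z))%:E <= C%:E)%E.
    apply: le_trans uC _; rewrite EFinD fineK; last by rewrite ge0_fin_numE.
    by rewrite leeDl.
  have mz : cmeasurable setT (coef muS k f).
    by apply: cmeasurable_coef => //; exact: mk.
  have ae_i : {ae muS, forall x, cintegrable m (fun z => u1 z * (coef muS k f z * k z x))}.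
    apply: (@ae_superpose_integrable _ _ _ _ _ muS m k u1 C mk k1 mu1 uC' _
      (hnorm (inner muS) f) mz) => z.
    exact: modulus_coef.
  by apply: filterS ae_i => x ix; rewrite LE//; exact: (cintegral_fubini ix).
Qed.

End LocalizationKernel.

(** * The Hilbert-Schmidt bound *)

Section BiInvariantL2.
Context (R : realType) (G : topologicalGroupType).
Context (mu : {measure set (borel G) -> \bar R}) (K : set G).

Lemma LpK2_L2 : LpK mu K 2 `<=` (Lp mu setT 2 : set (borel G -> R[i])).
Proof. by move=> f []. Qed.

Lemma linear_LpK2 : linear_subset (LpK mu K 2 : set (borel G -> R[i])).
Proof.
have [L0 Llin] := linear_L2 mu; split; first by split.
move=> c f g [Lf fK] [Lg gK]; split; first exact: Llin.
move=> x k k' Kk Kk'.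
by rewrite -[LHS]/(c * f (k * x * k')%g + g (k * x * k')%g) fK// gK.
Qed.

(** Bi-invariance at every point passes to the limit given by [L2_complete]. *)
Lemma complete_LpK2 : complete_subset (inner mu) (LpK mu K 2 : set (borel G -> R[i])).
Proof.
move=> h hK hC; have [g [Lg ginv gcv]] := L2_complete (fun n => LpK2_L2 (hK n)) hC.
exists g => //; split=> // x k k' Kk Kk'; apply: ginv => n.
by have [_] := hK n; apply.
Qed.

End BiInvariantL2.

Theorem theorem4p7 (R : realType) (G : topologicalGroupType)
    (mu : {measure set (borel G) -> \bar R}) (K : set G)
    (pl : {measure set (dual mu K) -> \bar R})
    (alpha : G -> G) (delta : R) (theta : G -> R[i])
    (u : borel G * dual mu K -> R[i]) :
  hausdorff_space G -> locally_compact [set: G] ->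
  left_haar mu -> compact_subgroup K -> gelfand_pair mu K ->
  separable (inner mu) (LpK mu K 2) ->
  plancherel pl ->
  topological_automorphism alpha -> automorphism_modulus mu alpha delta ->
  LpK mu K 2 theta -> Lp_norm mu setT 2 theta = 1%E ->
  product_Lp pl 1 u -> product_Lp pl 2 u ->
  let H := LpK mu K 2 in
  let L := localization pl alpha delta theta u in
  [/\ schatten_class (inner mu) H (L2G mu) 2 L,
      (schatten_norm (inner mu) H (L2G mu) 2 L <= product_norm pl 1 u)%E,
      (exists T, induced_operator (inner mu) H L T) &
      forall T, induced_operator (inner mu) H L T ->
        schatten_class (inner mu) H H 2 T /\
        (schatten_norm (inner mu) H H 2 T <= product_norm pl 1 u)%E].
Proof.
move=> hG lG hmu sK _ hsep _ aut modu Ltheta theta1 Lu _ H L.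
have [U bU] := neighbourhood_base_exists hG lG hmu sK hsep.
have sf := haar_sigma_finite hG lG hmu sK hsep.
have lind (O : set G) : open O -> O 1%g ->
    exists x : nat -> G, forall y, exists n, O ((x n)^-1 * y)%g.
  exact: (lindelof hG lG hmu sK hsep).
have joint (O : set G) : open O -> right_stable K O -> jointly_measurable O.
  by move=> oO rO; exact: (joint_open sK bU lind oO rO).
have [N [jN mN N0 jtheta]] := modify_L2 hmu sK joint Ltheta.
have [u1 [m [mu1 uC mL aeL]]] := localization_superpose hG lG hmu sK bU lind sf aut modu
  Ltheta theta1 jN mN N0 jtheta Lu.
have mk := cmeasurable_kernel hG lG hmu sK bU lind delta aut jtheta.
have k1 := kernel_norm hG lG hmu sK bU lind aut modu Ltheta theta1 jtheta.
have [Elin ipE] := (linear_L2 mu, semi_inner_product_L2 mu).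
have Hlin := @linear_LpK2 R G mu K; have HE := @LpK2_L2 R G mu K.
have Hc := @complete_LpK2 R G mu K.
have [_ uoo] := Lu.
have n0 : (0 <= product_norm pl 1 u)%E.
  by apply: le_trans uC; apply: integral_ge0 => z _; rewrite lee_fin modulus_ge0.
set r := product_norm pl 1 u in uC uoo n0 *.
have rE : r = (fine r)%:E by rewrite fineK// ge0_fin_numE.
have r0 : 0 <= fine r by exact: fine_ge0.
have uCe (e : R) : 0 < e -> (\int[m]_z (modulus (u1 z))%:E <= (fine r + e)%:E)%E.
  by move=> e0; apply: le_trans uC _; rewrite rE lee_fin lerDl ltW.
have Ce (e : R) : 0 < e -> 0 < fine r + e by move=> e0; rewrite ltr_wpDl.
have mLH f : H f -> cmeasurable setT (L f : borel G -> R[i]) by move=> /HE; exact: mL.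
have aeLH f (Hf : H f) := aeL f (HE f Hf).
pose muS := sigma_finite_copy sf.
pose k : borel G * dual mu K -> borel G -> R[i] := kernel alpha delta theta N.
have k1S : forall z, (\int[muS]_x (sqmod (k z x))%:E <= 1)%E by exact: k1.
have HES : H `<=` (Lp muS setT 2 : set (borel G -> R[i])) by exact: HE.
have hsepS : separable (inner muS) H by exact: hsep.
have HcS : complete_subset (inner muS) H by exact: Hc.
have cptS := @kernel_operator_compact _ _ _ _ _ muS m k _ _ mk k1S mu1 (Ce _ ltr01) (uCe _ ltr01)
  H Hlin HES L mLH aeLH hsepS HcS.
have cptL : compact_operator (inner mu) H (L2G mu) L by exact: cptS.
have HS (e : R) : 0 < e -> forall (I : finType) (v : I -> G -> R[i]), (forall i, H (v i)) ->
    orthonormal (inner mu) v ->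
    \sum_i hnorm (inner mu) (L (v i)) ^+ 2 <= (fine r + e) ^+ 2.
  move=> e0 I v Hv ov.
  exact: (@kernel_operator_hilbert_schmidt _ _ _ _ _ muS m k _ _ mk k1S mu1 (Ce _ e0) (uCe _ e0)
    H HES L mLH aeLH I v Hv ov).
have LE := cptL.1.1.
have normL : (schatten_norm (inner mu) H (L2G mu) 2 L <= r)%E.
  apply/lee_addgt0Pr => e e0; rewrite rE -EFinD.
  exact: (schatten_norm_le Elin ipE Hlin HE (fun f h => h) LE (ltW (Ce _ e0)) (HS _ e0)).
split; [|exact: normL|exact: (induced_operator_exists Elin ipE Hlin HE Hc LE)|].
  by split; [exact: cptL|exact: (le_lt_trans normL uoo)].
move=> T indT; have cptT := compact_induced Elin ipE Hlin HE Hc LE indT cptL.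
have normT : (schatten_norm (inner mu) H H 2 T <= r)%E.
  apply/lee_addgt0Pr => e e0; rewrite rE -EFinD.
  have HT f : H f -> H (T f) by case: indT => + _; exact.
  apply: (schatten_norm_le Elin ipE Hlin HE HE HT (ltW (Ce _ e0))) => I v Hv ov.
  apply: le_trans (HS _ e0 I v Hv ov); apply: ler_sum => i _.
  rewrite ler_pXn2r ?nnegrE ?hnorm_ge0//.
  exact: (hnorm_induced Elin ipE HE LE indT (Hv i)).
by split; [split; [exact: cptT|exact: (le_lt_trans normT uoo)]|exact: normT].
Qed.
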